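(* For every $t,s\ge 0$ and $\Phi\in\mathfrak{so}(t,s)$, the oscillator algebra $\mathfrak{osc}_\Phi(t,s)$ is conformally Einstein. In particular, all indecomposable Lorentzian metric Lie algebras and all indecomposable $4$-dimensional metric Lie algebras are conformally Einstein.
   Context: A metric Lie algebra is a finite-dimensional real Lie algebra with a non-degenerate symmetric $\mathrm{ad}$-invariant bilinear form (any signature); it defines a bi-invariant semi-Riemannian metric $\mathrm g$ on the simply connected Lie group $G$ with this Lie algebra. It is called indecomposable if it is not a direct sum of two nonzero mutually orthogonal ideals, and Lorentzian if the form has signature $(1,n-1)$. It is conformally Einstein if $\mathrm g$ is locally conformally equivalent to an Einstein metric on $G$, i.e. each point of $G$ has a neighbourhood $U$ and $\varphi\in C^\infty(U)$ such that $e^{2\varphi}\mathrm g$ is Einstein (Ricci tensor a possibly vanishing multiple of the metric) on $U$. The oscillator algebra $\mathfrak{osc}_\Phi(t,s)$ of signature $(t+1,s+1)$ is the double extension of the abelian metric Lie algebra $\mathbb R^{t,s}$ (with standard inner product $\langle\cdot,\cdot\rangle_{t,s}$ of signature $(t,s)$) by $\mathbb R$ and $\Phi\in\mathfrak{so}(t,s)$: as a vector space it is $\mathbb R\oplus\mathbb R^{t,s}\oplus\mathbb R$ with bracket $$[(\rho,X,r),(\hat\rho,\hat X,\hat r)]=\big(\langle\Phi X,\hat X\rangle_{t,s},\ r\Phi\hat X-\hat r\Phi X,\ 0\big)$$ and scalar product $\langle(\rho,X,r),(\hat\rho,\hat X,\hat r)\rangle=\langle X,\hat X\rangle_{t,s}+\rho\hat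 r+\hat\rho r$. *)

(* Defs.v *)
From HB Require Import structures.
From mathcomp Require Import all_boot all_order all_algebra.
From mathcomp Require Import all_classical all_reals all_analysis.
From mathcomp Require Import ring lra.

Set Implicit Arguments.
Unset Strict Implicit.
Unset Printing Implicit Defensive.

Import Order.TTheory GRing.Theory Num.Theory.
Import numFieldNormedType.Exports.
Local Open Scope classical_set_scope.
Local Open Scope ring_scope.

Record metricLieAlgebra (R : realType) := MetricLieAlgebra {
  mla_sort :> vectType R;
  mla_bracket : mla_sort -> mla_sort -> mla_sort;
  mla_form : mla_sort -> mla_sort -> R;
  bracket_linearl : forall y, linear (mla_bracket^~ y);
  bracket_linearr : forall x, linear (mla_bracket x);
  bracket_alt : forall x, mla_bracket x x = 0;
  bracket_jacobi : forall x y z,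
    mla_bracket x (mla_bracket y z) + mla_bracket y (mla_bracket z x)
      + mla_bracket z (mla_bracket x y) = 0;
  form_linear : forall x, scalar (mla_form x);
  form_sym : forall x y, mla_form x y = mla_form y x;
  form_nondeg : forall x, (forall y, mla_form x y = 0) -> x = 0;
  form_ad_invariant : forall x y z,
    mla_form (mla_bracket x y) z + mla_form y (mla_bracket x z) = 0
}.

Definition is_ideal (R : realType) (g : metricLieAlgebra R) (I : {vspace g}) :=
  forall x y : g, y \in I -> mla_bracket x y \in I.

Definition orthogonal_ideals (R : realType) (g : metricLieAlgebra R)
    (I J : {vspace g}) :=
  forall x y : g, x \in I -> y \in J -> mla_form x y = 0.

Definition indecomposable (R : realType) (g : metricLieAlgebra R) :=
  ~ exists I J : {vspace g},
      [/\ is_ideal I /\ is_ideal J, I != 0%VS /\ J != 0%VS,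
          orthogonal_ideals I J,
          (I :&: J = 0)%VS & (I + J = fullv)%VS].

(* Convention: in a signature (p, q), p is the number of minus signs. *)
Definition sig_sign (R : realType) (p i : nat) : R :=
  if (i < p)%N then -1 else 1.

Definition has_signature (R : realType) (g : metricLieAlgebra R) (p q : nat) :=
  exists b : (p + q).-tuple g,
    basis_of fullv b /\
    forall i j : 'I_(p + q),
      mla_form b`_i b`_j =
      if i == j then sig_sign R p i else 0.

Definition lorentzian (R : realType) (g : metricLieAlgebra R) :=
  exists m : nat, has_signature g 1 m.

Section Oscillator.
Variables (R : realType) (t s : nat).

Definition std_inner (X Y : 'cV[R]_(t + s)) : R :=
  \sum_(i < t + s) sig_sign R t i * X i 0 * Y i 0.

Definition in_so (Phi : 'M[R]_(t + s)) :=
  forall X Y, std_inner (Phi *m X) Y + std_inner X (Phi *m Y) = 0.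

Definition osc_space : vectType R := (R^o * 'cV[R]_(t + s) * R^o)%type.

Definition osc_bracket (Phi : 'M[R]_(t + s)) (x y : osc_space) : osc_space :=
  let: (_, X, r) := x in
  let: (_, Y, r') := y in
  (std_inner (Phi *m X) Y, r *: (Phi *m Y) - r' *: (Phi *m X), 0).

Definition osc_form (x y : osc_space) : R :=
  let: (rho, X, r) := x in
  let: (rho', Y, r') := y in
  std_inner X Y + rho * r' + rho' * r.

Lemma std_innerC X Y : std_inner X Y = std_inner Y X.
Proof. by apply: eq_bigr => i _; ring. Qed.

Lemma std_innerDr X Y Z : std_inner X (Y + Z) = std_inner X Y + std_inner X Z.
Proof. by rewrite -big_split /=; apply: eq_bigr => i _; rewrite !mxE; ring. Qed.

Lemma std_innerZr X a Y : std_inner X (a *: Y) = a * std_inner X Y.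
Proof. by rewrite mulr_sumr; apply: eq_bigr => i _; rewrite !mxE; ring. Qed.

Lemma std_innerBr X Y Z : std_inner X (Y - Z) = std_inner X Y - std_inner X Z.
Proof. by rewrite std_innerDr -scaleN1r std_innerZr mulN1r. Qed.

Lemma std_innerDl X Y Z : std_inner (Y + Z) X = std_inner Y X + std_inner Z X.
Proof. by rewrite std_innerC std_innerDr !(std_innerC X). Qed.

Lemma std_innerZl X a Y : std_inner (a *: Y) X = a * std_inner Y X.
Proof. by rewrite std_innerC std_innerZr std_innerC. Qed.

Lemma std_innerBl X Y Z : std_inner (Y - Z) X = std_inner Y X - std_inner Z X.
Proof. by rewrite std_innerC std_innerBr !(std_innerC X). Qed.

Lemma std_inner_nondeg X : (forall Y, std_inner X Y = 0) -> X = 0.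
Proof.
move=> H; apply/matrixP => i j; rewrite ord1 mxE.
have := H (delta_mx i 0); rewrite /std_inner (bigD1 i) //= big1 => [|k ki].
  by rewrite !mxE !eqxx mulr1 addr0; rewrite /sig_sign; case: ifP => _; lra.
by rewrite !mxE (negbTE ki) mulr0.
Qed.

Variables (Phi : 'M[R]_(t + s)) (Phi_so : in_so Phi).

Lemma std_inner_so X Y : std_inner (Phi *m X) Y = - std_inner X (Phi *m Y).
Proof. by have := Phi_so X Y; lra. Qed.

Lemma osc_bracket_linearl y : linear ((osc_bracket Phi)^~ y).
Proof.
move=> a [[x1 x2] x3] [[z1 z2] z3]; case: y => [[y1 y2] y3] /=.
congr (_, _, _) => /=.
- by rewrite mulmxDr -scalemxAr std_innerDl std_innerZl.
- rewrite mulmxDr -scalemxAr scalerDl !scalerDr scalerN !scalerA opprD.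
  by rewrite addrACA (mulrC a y3).
- by rewrite scaler0 addr0.
Qed.

Lemma osc_bracket_alt x : osc_bracket Phi x x = 0.
Proof.
case: x => [[x1 x2] x3] /=; congr (_, _, _) => /=; last by rewrite subrr.
by have := Phi_so x2 x2; rewrite (std_innerC x2); lra.
Qed.

Lemma osc_bracket_linearr x : linear (osc_bracket Phi x).
Proof.
move=> a [[y1 y2] y3] [[z1 z2] z3]; case: x => [[x1 x2] x3] /=.
congr (_, _, _) => /=.
- by rewrite std_innerDr std_innerZr.
- rewrite mulmxDr -scalemxAr scalerDl !scalerDr scalerN !scalerA opprD.
  by rewrite addrACA (mulrC a x3).
- by rewrite scaler0 addr0.
Qed.

Lemma osc_bracket_jacobi x y z :
  osc_bracket Phi x (osc_bracket Phi y z)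
  + osc_bracket Phi y (osc_bracket Phi z x)
  + osc_bracket Phi z (osc_bracket Phi x y) = 0.
Proof.
case: x y z => [[x1 x2] x3] [[y1 y2] y3] [[z1 z2] z3] /=.
congr (_, _, _) => /=.
- rewrite !std_innerBr !std_innerZr.
  rewrite !(std_innerC (Phi *m y2) (Phi *m x2)).
  rewrite !(std_innerC (Phi *m z2) (Phi *m x2)).
  by rewrite !(std_innerC (Phi *m z2) (Phi *m y2)); ring.
- rewrite !scale0r !subr0 !mulmxBr -!scalemxAr.
  by apply/matrixP => i j; rewrite !mxE; ring.
- by rewrite !addr0.
Qed.

Lemma osc_form_linear x : scalar (osc_form x).
Proof.
move=> a [[y1 y2] y3] [[z1 z2] z3]; case: x => [[x1 x2] x3] /=.
rewrite std_innerDr std_innerZr /= /GRing.scale /=; ring.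
Qed.

Lemma osc_form_sym x y : osc_form x y = osc_form y x.
Proof.
case: x y => [[x1 x2] x3] [[y1 y2] y3] /=.
by rewrite std_innerC addrAC.
Qed.

Lemma osc_form_nondeg x : (forall y, osc_form x y = 0) -> x = 0.
Proof.
case: x => [[x1 x2] x3] H; congr (_, _, _).
- have := H (0, 0, 1) => /=.
  by rewrite -(scale0r 0) std_innerZr; rewrite !mul0r mulr1 add0r addr0.
- apply: std_inner_nondeg => Y; have := H (0, Y, 0) => /=.
  by rewrite mulr0 mul0r !addr0.
- have := H (1, 0, 0) => /=.
  by rewrite -(scale0r 0) std_innerZr; rewrite !mul0r mul1r mulr0 !add0r.
Qed.

Lemma osc_form_ad_invariant x y z :
  osc_form (osc_bracket Phi x y) z + osc_form y (osc_bracket Phi x z) = 0.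
Proof.
case: x y z => [[x1 x2] x3] [[y1 y2] y3] [[z1 z2] z3] /=.
rewrite !std_innerBl !std_innerBr !std_innerZl !std_innerZr.
rewrite (std_inner_so y2) (std_innerC y2 (Phi *m x2)); ring.
Qed.

Definition osc : metricLieAlgebra R :=
  MetricLieAlgebra osc_bracket_linearl osc_bracket_linearr osc_bracket_alt
    osc_bracket_jacobi osc_form_linear osc_form_sym osc_form_nondeg
    osc_form_ad_invariant.

End Oscillator.

(* C^k via iterated directional derivatives; this is the usual notion when V is
   finite-dimensional and U is open, the only case used below. *)
Fixpoint Ck (R : realType) (V W : normedModType R) (k : nat) (U : set V)
    (f : V -> W) {struct k} : Prop :=
  (forall x, U x -> {for x, continuous f}) /\
  match k with
  | 0%N => True
  | k'.+1 => forall v, (forall x, U x -> derivable f x v) /\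
                       Ck k' U (fun x => 'D_v f x)
  end.

Definition smooth_on (R : realType) (V W : normedModType R) (U : set V)
    (f : V -> W) := forall k, Ck k U f.

Record chart (R : realType) (n : nat) (T : topologicalType) := Chart {
  cdom : set T;
  cmap : T -> 'rV[R]_n;
  cinv : 'rV[R]_n -> T;
  cdom_open : open cdom;
  cim_open : open (cmap @` cdom);
  cmapK : forall p, cdom p -> cinv (cmap p) = p;
  cmap_continuous : forall p, cdom p -> {for p, continuous cmap};
  cinv_continuous : forall u, (cmap @` cdom) u -> {for u, continuous cinv}
}.

Definition chart_compatible (R : realType) (n : nat) (T : topologicalType)
    (c d : chart R n T) :=
  smooth_on (cmap c @` (cdom c `&` cdom d)) (cmap d \o cinv c).

Record lieGroup (R : realType) (n : nat) := LieGroup {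
  lg_sort :> topologicalType;
  lg_hausdorff : hausdorff_space lg_sort;
  lg_second_countable : @second_countable lg_sort;
  atlas : set (chart R n lg_sort);
  atlas_cover : forall p, exists2 c, atlas c & cdom c p;
  atlas_compatible : forall c d, atlas c -> atlas d -> chart_compatible c d;
  gmul : lg_sort -> lg_sort -> lg_sort;
  ginv : lg_sort -> lg_sort;
  gone : lg_sort;
  gmulA : associative gmul;
  gmul1 : left_id gone gmul;
  gmulV : left_inverse gone ginv gmul;
  gmul_continuous : continuous (fun pq : lg_sort * lg_sort => gmul pq.1 pq.2);
  ginv_continuous : continuous ginv;
  gmul_smooth : forall c d e, atlas c -> atlas d -> atlas e ->
    smooth_on
      [set uv : 'rV[R]_n * 'rV[R]_n |
        [/\ (cmap c @` cdom c) uv.1, (cmap d @` cdom d) uv.2 &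
            cdom e (gmul (cinv c uv.1) (cinv d uv.2))]]
      (fun uv => cmap e (gmul (cinv c uv.1) (cinv d uv.2)));
  ginv_smooth : forall c d, atlas c -> atlas d ->
    smooth_on
      [set u : 'rV[R]_n | (cmap c @` cdom c) u /\ cdom d (ginv (cinv c u))]
      (fun u => cmap d (ginv (cinv c u)))
}.

Definition simply_connected (R : realType) (T : topologicalType) :=
  (forall p q : T, exists f : R -> T,
     [/\ {within `[0, 1], continuous f}, f 0 = p & f 1 = q]) /\
  (forall f : R -> T, {within `[0, 1], continuous f} -> f 0 = f 1 ->
     exists H : R * R -> T,
       {within `[0, 1] `*` `[0, 1], continuous H} /\
       forall x, `[0, 1]%classic x ->
         [/\ H (0, x) = f x, H (1, x) = f 0, H (x, 0) = f 0 & H (x, 1) = f 0]).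

Section LieGroupGeometry.
Variables (R : realType) (n : nat) (G : lieGroup R n).

(* The derivative at p, in the charts c (at p) and d (at F p), of F : G -> G,
   applied to the tangent vector with components v. *)
Definition tangent_map (F : G -> G) (c d : chart R n G) (p : G)
    (v : 'rV[R]_n) : 'rV[R]_n :=
  'D_v (cmap d \o F \o cinv c) (cmap c p).

(* X c p is the row of components of the field at p in the chart c; only the
   values for c in the atlas and p in its domain are meaningful. *)
Definition vfield := chart R n G -> G -> 'rV[R]_n.

Definition is_vfield (X : vfield) :=
  (forall c d p, atlas c -> atlas d -> cdom c p -> cdom d p ->
     X d p = tangent_map id c d p (X c p)) /\
  (forall c, atlas c -> smooth_on (cmap c @` cdom c) (X c \o cinv c)).

Definition left_invariant_vfield (X : vfield) :=
  forall a c d p, atlas c -> atlas d -> cdom c p -> cdom d (gmul a p) ->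
    X d (gmul a p) = tangent_map (gmul a) c d p (X c p).

Definition vfield_bracket (X Y : vfield) : vfield := fun c p =>
  'D_(X c p) (Y c \o cinv c) (cmap c p)
  - 'D_(Y c p) (X c \o cinv c) (cmap c p).

(* L identifies g with the Lie algebra of left-invariant fields of G, the latter
   being isomorphic to the tangent space at the unit by evaluation. *)
Record is_lie_algebra_of (g : metricLieAlgebra R) (L : g -> vfield) : Prop :=
  IsLieAlgebraOf {
  lie_vfield : forall x, is_vfield (L x);
  lie_left_invariant : forall x, left_invariant_vfield (L x);
  lie_linear : forall c p, atlas c -> cdom c p -> linear (fun x => L x c p);
  lie_bracket : forall x y c p, atlas c -> cdom c p ->
    L (mla_bracket x y) c p = vfield_bracket (L x) (L y) c p;
  lie_bijective : forall c, atlas c -> cdom c (gone G) ->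
    bijective (fun x => L x c (gone G))
}.

(* m c p is the Gram matrix at p of the coordinate fields of the chart c. *)
Definition tensor2 := chart R n G -> G -> 'M[R]_n.

Definition tensor_eval (m : tensor2) (c : chart R n G) (p : G)
    (v w : 'rV[R]_n) : R := (v *m m c p *m w^T) 0 0.

Definition preserves_tensor (m : tensor2) (F : G -> G) :=
  forall c d p v w, atlas c -> atlas d -> cdom c p -> cdom d (F p) ->
    tensor_eval m d (F p) (tangent_map F c d p v) (tangent_map F c d p w)
    = tensor_eval m c p v w.

(* Invariance under the identity is the change-of-chart law. *)
Record is_semi_riemannian_metric (m : tensor2) : Prop :=
  IsSemiRiemannianMetric {
  metric_chart : preserves_tensor m id;
  metric_smooth : forall c, atlas c ->
    smooth_on (cmap c @` cdom c) (m c \o cinv c);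
  metric_sym : forall c p, atlas c -> cdom c p -> (m c p)^T = m c p;
  metric_nondeg : forall c p, atlas c -> cdom c p -> m c p \in unitmx
}.

Definition bi_invariant (m : tensor2) :=
  forall a, preserves_tensor m (gmul a) /\ preserves_tensor m ((@gmul _ _ G)^~ a).

Definition metric_extends_form (g : metricLieAlgebra R) (L : g -> vfield)
    (m : tensor2) :=
  forall c x y, atlas c -> cdom c (gone G) ->
    tensor_eval m c (gone G) (L x c (gone G)) (L y c (gone G)) = mla_form x y.

End LieGroupGeometry.

Section Curvature.
Variables (R : realType) (n : nat).
Implicit Types (h : 'rV[R]_n -> 'M[R]_n) (u : 'rV[R]_n).

Definition partial (i : 'I_n) (f : 'rV[R]_n -> R) (u : 'rV[R]_n) : R :=
  'D_(delta_mx 0 i) f u.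

Definition christoffel h (k i j : 'I_n) (u : 'rV[R]_n) : R :=
  2^-1 * \sum_(l < n) invmx (h u) k l *
    (partial i (fun x => h x j l) u + partial j (fun x => h x i l) u
     - partial l (fun x => h x i j) u).

Definition ricci h u : 'M[R]_n := \matrix_(i, j) \sum_(k < n)
  (partial k (christoffel h k i j) u - partial j (christoffel h k i k) u
   + \sum_(l < n) (christoffel h k k l u * christoffel h l i j u
                   - christoffel h k j l u * christoffel h l i k u)).

End Curvature.

Section ConformallyEinstein.
Variables (R : realType) (n : nat) (G : lieGroup R n).

Definition smooth_function (U : set G) (phi : G -> R) :=
  forall c, atlas c -> smooth_on (cmap c @` (cdom c `&` U)) (phi \o cinv c).

Definition conformal_change (phi : G -> R) (m : tensor2 G) : tensor2 G :=
  fun c p => expR (2 * phi p) *: m c p.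

Definition einstein_on (U : set G) (m : tensor2 G) :=
  exists lambda : R, forall c p, atlas c -> cdom c p -> U p ->
    ricci (m c \o cinv c) (cmap c p) = lambda *: m c p.

Definition locally_conformally_einstein (m : tensor2 G) :=
  forall p : G, exists U : set G, exists phi : G -> R,
    [/\ open U, U p, smooth_function U phi &
        einstein_on U (conformal_change phi m)].

End ConformallyEinstein.

(* The simply connected Lie group with Lie algebra g is unique up to
   isomorphism; the property is stated for every model of it. *)
Definition conformally_einstein (R : realType) (g : metricLieAlgebra R) :=
  forall (n : nat) (G : lieGroup R n) (L : g -> vfield G) (m : tensor2 G),
    simply_connected R G -> is_lie_algebra_of L ->
    is_semi_riemannian_metric m -> bi_invariant m ->
    metric_extends_form L m ->
    locally_conformally_einstein m.

(* Main.v *)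
(* The Killing form B(x, y) = Tr (ad x ad y) controls everything: the Ricci tensor of a
   bi-invariant metric is -B/4. If B = lam <., .> the metric is Einstein. If
   B = c <z, .> <z, .> for a central null z, then z is parallel, so <z, .> = dr locally,
   and for phi = f(r) the metric exp(2 phi) g has Ricci tensor
   (-c/4 - (n - 2) (f'' - f'^2)) <z, .> <z, .>, which vanishes once f solves a Riccati
   equation.

   B has the second form as soon as the orthogonal of z is abelian modulo z; this covers
   oscillator algebras. On a 4-dimensional metric algebra the 3-form <[x, y], w> has a
   kernel vector z, which is central; a central non-null vector splits the algebra, so z is
   null in the indecomposable case, and the orthogonal of z is abelian modulo z because
   a 3-form on a 3-dimensional space with a kernel vector vanishes.

   In the Lorentzian case let K be the self-adjoint operator with B(x, y) = <K x, y>. It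
   commutes with ad, so by indecomposability and Fitting every polynomial in K is nilpotent
   or invertible. K has a real eigenvalue l (a non-real one would force
   (K - a)^2 = -b^2, impossible in Lorentzian signature and dimension at least 3). If
   K - l is nonzero, the image of its top power is a null line and an ideal, hence central;
   therefore l = 0, and negativity of the Killing form gives K^2 = 0, so that B has the
   second form. *)

Require Import Defs.
From HB Require Import structures.
From mathcomp Require Import all_boot all_order all_algebra.
From mathcomp Require Import all_classical all_reals all_analysis.
From mathcomp Require Import ring lra zify.
From mathcomp Require Import complex.

Set Implicit Arguments.
Unset Strict Implicit.
Unset Printing Implicit Defensive.

Import Order.TTheory GRing.Theory Num.Theory.
Import numFieldNormedType.Exports.
Local Open Scope classical_set_scope.
Local Open Scope ring_scope.

(** * Directional derivatives and smooth functions *)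

(** The Ricci tensor is defined by Christoffel symbols in charts, which cannot be evaluated directly
    on an abstract group; the curvature is computed in a left-invariant frame instead. There the
    metric has the constant Gram matrix [eta], and the Maurer-Cartan equation turns derivatives of
    the frame into brackets, so that the computation becomes an identity between endomorphisms of
    the Lie algebra. The conformal factor is absorbed by scaling the coframe by exp(phi). For d phi
    = T <z, .> this adds to the connection only T times a skew endomorphism of rank at most two;
    since z is central and null, the terms linear and quadratic in T cancel and only kap = T' - T^2
    survives. Ricci-flatness then reads kap = - c / (4 (n - 2)), which is why n > 2 accompanies the
    second form of B; in dimension at most 2 the algebra is abelian and B = 0. Solutions of the
    Riccati equation may blow up, so r is restricted to a neighbourhood where it is small. *)

Section DirectionalDerivative.
Context {R : realType} {V : normedModType R}.
Implicit Types (f : V -> R) (x v : V) (O : set V).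

Lemma is_derive_line (W : normedModType R) (f : V -> W) a b (t : R) d :
  is_derive (a + t *: b) b f d ->
  is_derive t 1 (fun s : R => f (a + s *: b)) d.
Proof.
move=> [fd <-].
have eqq : (fun h : R => h^-1 *: (f (a + (h *: 1 + t) *: b) - f (a + t *: b))) =
           (fun h => h^-1 *: (f (h *: b + (a + t *: b)) - f (a + t *: b))).
  apply/funext => h; congr (_ *: (f _ - _)).
  by rewrite /= [h *: 1]mulr1 scalerDl addrCA.
by apply: DeriveDef; rewrite /derivable /derive /= eqq.
Qed.

Lemma is_derive_scale (W : normedModType R) (f : V -> W) x v (s : R) d :
  is_derive x v f d -> is_derive x (s *: v) f (s *: d).
Proof.
move=> [fd <-]; have [->|s0] := eqVneq s 0.
  by rewrite !scale0r; apply: DeriveDef; [exact: derivable0|exact: derive0].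
suff H : h^-1 *: ((f \o shift x) (h *: (s *: v)) - f x) @[h --> 0^']
         --> s *: 'D_v f x.
  by apply: DeriveDef; [apply/cvg_ex; eexists; exact: H | apply/cvg_lim].
have -> : (fun h : R => h^-1 *: ((f \o shift x) (h *: (s *: v)) - f x)) =
   (fun h => s *: ((h * s)^-1 *: ((f \o shift x) ((h * s) *: v) - f x))).
  apply/funext => h; rewrite [RHS]scalerA invfM (mulrCA s) mulfV // mulr1.
  by rewrite [in RHS]/= -scalerA.
apply: cvgZr.
apply: (@cvg_comp _ _ _ (fun h : R => h * s)
  (fun k => k^-1 *: ((f \o shift x) (k *: v) - f x)) _ (0^')); last exact: fd.
move=> A [e /= e0 Ae].
near=> h; apply: Ae => /=.
- rewrite sub0r normrN normrM.
  rewrite -ltr_pdivlMr ?normr_gt0 //.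
  by near: h; apply: dnbhs0_lt; rewrite divr_gt0 // normr_gt0.
- by rewrite mulf_neq0 //; near: h; exact: nbhs_dnbhs_neq.
Unshelve. all: by end_near. Qed.

Lemma deriveZ_dir (W : normedModType R) (f : V -> W) x v (s : R) :
  derivable f x v -> 'D_(s *: v) f x = s *: 'D_v f x.
Proof. by move=> /derivableP/(is_derive_scale s)[]. Qed.

(** The mean value theorem on a segment needs derivability only in the direction of the segment, so
    it is available before differentiability, which is deduced from it in
    [smooth_differentiable]. *)
Lemma MVT_line f a b :
  (forall t : R, 0 <= t <= 1 -> derivable f (a + t *: b) b) ->
  exists2 t : R, 0 <= t <= 1 & f (a + b) - f a = 'D_b f (a + t *: b).
Proof.
move=> fd; pose g (t : R) := f (a + t *: b).
have gd (t : R) : 0 <= t <= 1 -> is_derive t 1 g ('D_b f (a + t *: b)).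
  by move=> /fd/derivableP; exact: is_derive_line.
have [||t t01] := @MVT R g (fun t => 'D_b f (a + t *: b)) 0 1 ltr01.
- by move=> t /andP[/ltW t0 /ltW t1]; apply: gd; rewrite t0.
- apply: derivable_within_continuous => t; rewrite in_itv /= => /gd[].
  by [].
rewrite /g scale1r scale0r addr0 subr0 mulr1 => E.
by exists t => //; move: t01; rewrite in_itv /= => /andP[/ltW-> /ltW->].
Qed.

Lemma ball_segment (x a b : V) (e t : R) : 0 <= t <= 1 ->
  ball x e a -> ball x e (a + b) -> ball x e (a + t *: b).
Proof.
move=> /andP[t0 t1]; rewrite -!ball_normE /= => xa xb.
have -> : x - (a + t *: b) = (1 - t) *: (x - a) + t *: (x - (a + b)).
  by rewrite (opprD a b) (addrA x) (scalerBr t) [RHS]addrA -scalerDl subrK scale1r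
    opprD addrA.
apply: le_lt_trans (ler_normD _ _) _; rewrite !normrZ.
rewrite (ger0_norm t0) (@ger0_norm _ (1 - t)) ?subr_ge0 //.
have [t00|tn0] := eqVneq t 0; first by rewrite t00 subr0 mul1r mul0r addr0.
have tp : 0 < t by rewrite lt_def tn0.
have -> : e = (1 - t) * e + t * e by ring.
by apply: ler_ltD; [apply: ler_wpM2l; [rewrite subr_ge0|exact: ltW] |
  rewrite ltr_pM2l].
Qed.

End DirectionalDerivative.

(** * Closure properties of the classes C^k *)

Section CkClosure.
Context {R : realType} {V W : normedModType R}.
Implicit Types (O : set V).

Lemma Ck_sub k O O' (f : V -> W) : O' `<=` O -> Ck k O f -> Ck k O' f.
Proof.
move=> sO; elim: k f => [|k IH] f [fc fd]; split; try by move=> x /sO; exact: fc.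
  by [].
move=> v; have [dv cv] := fd v; split; last exact: IH.
by move=> x /sO; exact: dv.
Qed.

Lemma CkW k O (f : V -> W) : Ck k.+1 O f -> Ck k O f.
Proof.
elim: k f => [|k IH] f [fc fd]; split => // v; have [dv cv] := fd v.
by split => //; exact: IH.
Qed.

Lemma continuous_open_eq O (f g : V -> W) x : open O ->
  (forall y, O y -> f y = g y) -> O x ->
  {for x, continuous f} -> {for x, continuous g}.
Proof.
move=> oO fg Ox fc; suff : g @ x --> g x by [].
rewrite -(fg _ Ox); apply: cvg_trans fc; apply: near_eq_cvg.
by apply: filterS fg _; exact: open_nbhs_nbhs.
Qed.

Lemma Ck_ext k O (f g : V -> W) : open O -> (forall x, O x -> f x = g x) ->
  Ck k O f -> Ck k O g.
Proof.
move=> oO; have nO x : O x -> nbhs x O by move=> Ox; exact: open_nbhs_nbhs.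
elim: k f g => [|k IH] f g fg [fc fd]; split => //.
- by move=> x Ox; apply: continuous_open_eq oO fg Ox (fc _ Ox).
- by move=> x Ox; apply: continuous_open_eq oO fg Ox (fc _ Ox).
- move=> v; have [dv cv] := fd v.
  have nfg x : O x -> {near x, f =1 g} by move=> /nO; apply: filterS.
  split; first by move=> x Ox; apply: near_eq_derivable (nfg _ Ox) (dv _ Ox).
  by apply: IH cv => x Ox; apply: near_eq_derive; exact: nfg.
Qed.

Lemma Ck_cst k O (a : W) : Ck k O (cst a : V -> W).
Proof.
elim: k a => [|k IH] a; split => //; try by move=> x _; exact: cst_continuous.
move=> v; split; first by move=> x _; exact: derivable_cst.
have -> : (fun x : V => 'D_v (cst a) x) = cst 0 by apply/funext => x; rewrite derive_cst.
exact: IH.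
Qed.

Lemma CkD k O (f g : V -> W) : open O -> Ck k O f -> Ck k O g ->
  Ck k O (fun x => f x + g x).
Proof.
move=> oO; elim: k f g => [|k IH] f g [fc fd] [gc gd]; split => //.
- by move=> x Ox; apply: continuousD; [exact: fc|exact: gc].
- by move=> x Ox; apply: continuousD; [exact: fc|exact: gc].
- move=> v; have [fv fk] := fd v; have [gv gk] := gd v; split.
    by move=> x Ox; apply: derivableD; [exact: fv|exact: gv].
  apply: Ck_ext oO _ (IH _ _ fk gk) => x Ox.
  by symmetry; exact: (deriveD (fv _ Ox) (gv _ Ox)).
Qed.

End CkClosure.

Section CkScalar.
Context {R : realType} {V : normedModType R}.
Implicit Types (O : set V) (f g : V -> R).

Lemma CkM k O f g : open O -> Ck k O f -> Ck k O g ->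
  Ck k O (fun x => f x * g x).
Proof.
move=> oO; elim: k f g => [|k IH] f g [fc fd] [gc gd]; split => //.
- by move=> x Ox; apply: continuousM; [exact: fc|exact: gc].
- by move=> x Ox; apply: continuousM; [exact: fc|exact: gc].
- move=> v; have [fv fk] := fd v; have [gv gk] := gd v; split.
    by move=> x Ox; apply: derivableM; [exact: fv|exact: gv].
  have fk' : Ck k O f by apply: CkW; split.
  have gk' : Ck k O g by apply: CkW; split.
  apply: Ck_ext oO _ (CkD oO (IH _ _ fk' gk) (IH _ _ gk' fk)) => x Ox.
  by symmetry; exact: (deriveM (fv _ Ox) (gv _ Ox)).
Qed.

Lemma smooth_cst O (a : R) : smooth_on O (fun _ : V => a).
Proof. by move=> k; exact: Ck_cst. Qed.

Lemma smoothD O f g : open O -> smooth_on O f -> smooth_on O g ->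
  smooth_on O (fun x => f x + g x).
Proof. by move=> oO sf sg k; exact: CkD. Qed.

Lemma smoothM O f g : open O -> smooth_on O f -> smooth_on O g ->
  smooth_on O (fun x => f x * g x).
Proof. by move=> oO sf sg k; exact: CkM. Qed.

Lemma smoothN O f : open O -> smooth_on O f -> smooth_on O (fun x => - f x).
Proof.
move=> oO sf k; apply: (Ck_ext oO _ (CkM oO (@Ck_cst R V R k O (-1)) (sf k))) => x _.
by rewrite mulN1r.
Qed.

Lemma smooth_sum O (I : Type) (r : seq I) (P : pred I) (F : I -> V -> R) :
  open O -> (forall i, P i -> smooth_on O (F i)) ->
  smooth_on O (fun x => \sum_(i <- r | P i) F i x).
Proof.
move=> oO sF k; elim: r => [|i r IH].
  by apply: (Ck_ext oO _ (@Ck_cst R V R k O 0)) => x _; rewrite big_nil.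
case Pi : (P i); last by apply: (Ck_ext oO _ IH) => x _; rewrite big_cons Pi.
apply: (Ck_ext oO _ (CkD oO (sF i Pi k) IH)) => x _.
by rewrite [RHS]big_cons Pi.
Qed.

End CkScalar.

Section Smooth.
Context {R : realType} {V W : normedModType R}.
Implicit Types (O : set V) (f g : V -> W).

Lemma smooth_sub O O' f : O' `<=` O -> smooth_on O f -> smooth_on O' f.
Proof. by move=> sO sf k; exact: Ck_sub (sf k). Qed.

Lemma smooth_ext O f g : open O -> (forall x, O x -> f x = g x) ->
  smooth_on O f -> smooth_on O g.
Proof. by move=> oO fg sf k; apply: Ck_ext oO fg (sf k). Qed.

Lemma smooth_continuous O f x : smooth_on O f -> O x -> {for x, continuous f}.
Proof. by move=> /(_ 0%N)[fc _]; exact: fc. Qed.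

Lemma smooth_derivable O f x v : smooth_on O f -> O x -> derivable f x v.
Proof. by move=> /(_ 1%N)[_ /(_ v)[fd _]]; exact: fd. Qed.

Lemma smooth_derive O f v : smooth_on O f -> smooth_on O (fun x => 'D_v f x).
Proof. by move=> sf k; have [_ /(_ v)[]] := sf k.+1. Qed.

End Smooth.

Lemma smooth_entry (R : realType) (V : normedModType R) (m n : nat) (O : set V)
    (M : V -> 'M[R]_(m, n)) i j :
  open O -> smooth_on O M -> smooth_on O (fun x => M x i j).
Proof.
move=> oO sM k; elim: k M sM => [|k IH] M sM; split => //.
- by move=> x Ox; apply: (@continuous_comp _ _ _ M (fun A : 'M[R]_(m, n) => A i j));
    [exact: smooth_continuous sM Ox|exact: coord_continuous].
- by move=> x Ox; apply: (@continuous_comp _ _ _ M (fun A : 'M[R]_(m, n) => A i j));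
    [exact: smooth_continuous sM Ox|exact: coord_continuous].
- move=> v; split.
    by move=> x Ox; have /derivable_mxP := @smooth_derivable _ _ _ _ _ x v sM Ox; exact.
  apply: Ck_ext oO _ (IH _ (smooth_derive v sM)) => x Ox.
  by rewrite derive_mx ?mxE //; exact: smooth_derivable sM Ox.
Qed.

(** * Additivity in the direction and symmetry of second derivatives *)

Section SmoothCalculus.
Context {R : realType} {V : normedModType R}.
Implicit Types (O : set V) (f : V -> R) (x v w : V).

Lemma near_line_ball x v (e : R) : 0 < e ->
  \forall h \near (0 : R)^', ball x e (h *: v + x).
Proof.
move=> e0; near=> h; rewrite -ball_normE /= opprD addrCA subrr addr0 normrN normrZ.
have v1 : 0 < `|v| + 1 by rewrite ltr_wpDl.
apply: (@le_lt_trans _ _ (`|h| * (`|v| + 1))).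
  by rewrite ler_wpM2l // lerDl.
rewrite -ltr_pdivlMr //; near: h; apply: dnbhs0_lt; exact: divr_gt0.
Unshelve. all: by end_near. Qed.

Lemma smooth_near O f x v (e : R) : open O -> smooth_on O f -> O x -> 0 < e ->
  exists2 d : R, 0 < d & forall y, ball x d y ->
    O y /\ `|'D_v f x - 'D_v f y| <= e.
Proof.
move=> oO sf Ox e0.
have dc : 'D_v f y @[y --> x] --> 'D_v f x.
  exact: (smooth_continuous (smooth_derive v sf) Ox).
have nO : nbhs x O by exact: open_nbhs_nbhs.
have : \forall y \near x, O y /\ `|'D_v f x - 'D_v f y| <= e.
  near=> y; split; first by near: y.
  near: y; move/cvgrPdist_le : dc => /(_ _ e0); exact.
by move=> /nbhs_ballP[d /= d0 H]; exists d => // y /H.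
Unshelve. all: by end_near. Qed.

(** Derivability in every direction does not give additivity; continuity of the derivative along w
    does. The increment along h w starts at the moved point x + h v, where the mean value theorem
    expresses it by a value of the derivative close to that at x. *)
Lemma deriveD_dir O f x v w : open O -> smooth_on O f -> O x ->
  'D_(v + w) f x = 'D_v f x + 'D_w f x.
Proof.
move=> oO sf Ox.
suff H : h^-1 *: ((f \o shift x) (h *: (v + w)) - f x) @[h --> 0^']
   --> 'D_w f x + 'D_v f x by rewrite [RHS]addrC; apply/cvg_lim.
have -> : (fun h : R => h^-1 *: ((f \o shift x) (h *: (v + w)) - f x)) =
  (fun h => h^-1 *: (f (h *: v + x + h *: w) - f (h *: v + x)) +
            h^-1 *: ((f \o shift x) (h *: v) - f x)).
  apply/funext => h; rewrite -scalerDr; congr (_ *: _) => /=.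
  by rewrite subrKA scalerDr addrAC.
apply: cvgD; last exact: (@smooth_derivable _ _ _ O).
apply/cvgrPdist_le => e e0.
have [d d0 dP] := smooth_near w oO sf Ox e0.
have d0' := d0.
near=> h.
have h0 : h != 0 by near: h; exact: nbhs_dnbhs_neq.
have b1 : ball x d (h *: v + x) by near: h; exact: near_line_ball.
have b2 : ball x d (h *: v + x + h *: w).
  rewrite addrAC -scalerDr; near: h; exact: near_line_ball.
have bt (t : R) : 0 <= t <= 1 -> ball x d (h *: v + x + t *: (h *: w)).
  by move=> t01; apply: ball_segment.
have fd (t : R) : 0 <= t <= 1 ->
    derivable f (h *: v + x + t *: (h *: w)) (h *: w).
  by move=> /bt/dP[Oy _]; exact: smooth_derivable sf Oy.
have [t t01 ->] := MVT_line fd.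
rewrite deriveZ_dir; last exact: smooth_derivable sf (dP _ (bt t t01)).1.
by rewrite scalerA mulVf // scale1r; exact: (dP _ (bt t t01)).2.
Unshelve. all: by end_near. Qed.

(** The mean value theorem is applied to z |-> f(z + b) - f(z) along a, then to the derivative of f
    along a in the direction b. The left-hand side is symmetric in a and b, which is what
    [derive_comm] exploits. *)
Lemma second_difference f x a b (d : R) : smooth_on (ball x d) f ->
  `|a| + `|b| < d ->
  exists2 y, ball x d y &
    f (x + a + b) - f (x + a) - (f (x + b) - f x) = 'D_b (fun z => 'D_a f z) y.
Proof.
move=> sf abd.
have bst (s t : R) : 0 <= s <= 1 -> 0 <= t <= 1 ->
    ball x d (x + s *: a + t *: b).
  move=> /andP[s0 s1] /andP[t0 t1]; rewrite -ball_normE /=.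
  rewrite -addrA opprD addNKr normrN.
  apply: le_lt_trans (ler_normD _ _) _; apply: le_lt_trans abd.
  by rewrite !normrZ !ger0_norm // lerD // ler_piMl.
pose g (y : V) := f (y + b) - f y.
have dsh (y : V) v : ball x d (y + b) ->
    is_derive y v (fun z => f (z + b)) ('D_v f (y + b)).
  move=> yb.
  have E : (fun h : R => h^-1 *: (f (h *: v + y + b) - f (y + b))) =
           (fun h => h^-1 *: (f (h *: v + (y + b)) - f (y + b))).
    by apply/funext => h; rewrite -addrA.
  apply: DeriveDef; last by rewrite /derive /= E.
  rewrite /derivable /= E; exact: smooth_derivable sf yb.
have i01 : ((0 : R) <= (1 : R)) && ((1 : R) <= (1 : R)) by rewrite ler01 lexx.
have i00 : ((0 : R) <= (0 : R)) && ((0 : R) <= (1 : R)) by rewrite ler01 lexx.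
have gd (s : R) : 0 <= s <= 1 ->
    is_derive (x + s *: a) a g ('D_a f (x + s *: a + b) - 'D_a f (x + s *: a)).
  move=> s01; have := bst s 1 s01 i01; rewrite scale1r => bs.
  have := bst s 0 s01 i00; rewrite scale0r addr0 => bs'.
  apply: is_deriveB; first exact: dsh.
  by apply: derivableP; exact: smooth_derivable sf bs'.
have gd' (s : R) : 0 <= s <= 1 -> derivable g (x + s *: a) a.
  by move=> /gd[].
have [s s01] := MVT_line gd'.
rewrite (@derive_val _ _ _ _ _ _ _ (gd s s01)) /g => Es.
have fd (t : R) : 0 <= t <= 1 ->
    derivable (fun z => 'D_a f z) (x + s *: a + t *: b) b.
  by move=> t01; apply: smooth_derivable (smooth_derive a sf) (bst s t s01 t01).
have [t t01 Et] := MVT_line fd.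
by exists (x + s *: a + t *: b); [exact: bst | rewrite -Et -Es; ring].
Qed.

(** The second difference with steps h v and h w equals h^2 times each of the two mixed derivatives,
    at two points near x; continuity of both mixed derivatives makes their values at x differ by at
    most any e. *)
Lemma derive_comm O f x v w : open O -> smooth_on O f -> O x ->
  'D_v (fun z => 'D_w f z) x = 'D_w (fun z => 'D_v f z) x.
Proof.
move=> oO sf Ox; apply/eqP; rewrite -subr_eq0 -normr_le0.
apply/ler_addgt0Pr => e e0; rewrite add0r.
have e2 : 0 < e / 2 by rewrite divr_gt0.
have [d1 d10 P1] := smooth_near v oO (smooth_derive w sf) Ox e2.
have [d2 d20 P2] := smooth_near w oO (smooth_derive v sf) Ox e2.
pose d := Order.min d1 d2.
have d0 : 0 < d by rewrite lt_min d10.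
have sb1 y : ball x d y -> ball x d1 y by apply: le_ball; rewrite ge_min lexx.
have sb2 y : ball x d y -> ball x d2 y by apply: le_ball; rewrite ge_min lexx orbT.
have sfb : smooth_on (ball x d) f by apply: smooth_sub sf => y /sb1/P1[].
have vw1 : 0 < `|v| + `|w| + 1 by rewrite ltr_wpDl // addr_ge0.
have [h h0 hd] : exists2 h : R, 0 < h & `|h *: v| + `|h *: w| < d.
  pose h := d / 2 / (`|v| + `|w| + 1).
  have h0 : 0 < h by rewrite !divr_gt0.
  exists h => //; rewrite (normrZ h v) (normrZ h w) -mulrDr (gtr0_norm h0) /h.
  rewrite (mulrAC (d / 2)) ltr_pdivrMr // -mulrA ltr_pM2l //.
  by have := normr_ge0 v; have := normr_ge0 w; lra.
have Dh a b y : ball x d y ->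
    'D_(h *: b) (fun z => 'D_(h *: a) f z) y = h * h * 'D_b (fun z => 'D_a f z) y.
  move=> by_; rewrite deriveZ_dir; last exact: smooth_derivable (smooth_derive _ sfb) by_.
  have -> : 'D_b (fun z => 'D_(h *: a) f z) y = 'D_b (h \*: (fun z => 'D_a f z)) y.
    apply: near_eq_derive; near=> z.
    rewrite deriveZ_dir //; apply: smooth_derivable sfb _.
    by near: z; apply: open_nbhs_nbhs; split => //; exact: ball_open.
  rewrite deriveZ; last exact: smooth_derivable (smooth_derive _ sfb) by_.
  by rewrite /GRing.scale /= mulrA.
have [y by_ Ey] := second_difference sfb hd.
have hd' : `|h *: w| + `|h *: v| < d by rewrite addrC.
have [z bz Ez] := second_difference sfb hd'.
have yz : 'D_w (fun z => 'D_v f z) y = 'D_v (fun z => 'D_w f z) z.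
  apply: (@mulfI _ (h * h)); first by rewrite mulf_neq0 // (gt_eqF h0).
  apply: (etrans (esym (Dh v w y by_))); apply: (etrans _ (Dh w v z bz)).
  rewrite -Ey -Ez (addrAC x (h *: w)).
  move: (f (x + h *: v + h *: w)) (f (x + h *: v)) (f (x + h *: w)) (f x).
  by move=> p q r s; ring.
have [_ H1] := P1 _ (sb1 _ bz); have [_ H2] := P2 _ (sb2 _ by_).
have tri (p q r : R) : `|p - r| <= e / 2 -> `|q - r| <= e / 2 -> `|p - q| <= e.
  move=> pr qr; apply: (le_trans (ler_distD r p q)).
  by rewrite (distrC r) (splitr e); exact: lerD.
by rewrite yz in H2; exact: tri H1 H2.
Unshelve. all: by end_near. Qed.

End SmoothCalculus.

(** The inner map is only derivable in one direction; restricting it to the line through x along v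
    gives a function of one real variable, for which derivable and differentiable agree. *)
Lemma derive_comp_differentiable (R : realType) (U V W : normedModType R)
    (f : V -> W) (g : U -> V) x v :
  differentiable f (g x) -> derivable g x v ->
  is_derive x v (f \o g) ('D_('D_v g x) f (g x)).
Proof.
move=> dfg dg.
pose k (h : R) := g (h *: v + x).
have k0 : k 0 = g x by rewrite /k scale0r add0r.
have dk : differentiable k 0 by apply/derivable1_diffP; exact: (derivable1P g x v).1 dg.
have df : differentiable f (k 0) by rewrite k0.
have line_derive (W' : normedModType R) (q : U -> W') :
    'D_1 (fun h : R => q (h *: v + x)) 0 = 'D_v q x.
  have E : (fun h : R => h^-1 *: (q ((h *: 1 + 0) *: v + x) - q (0 *: v + x))) =
      (fun h => h^-1 *: (q (h *: v + x) - q x)).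
    by apply/funext => h; rewrite scale0r add0r addr0 [h *: 1]mulr1.
  by rewrite /derive /= E.
have kE : 'D_1 k 0 = 'D_v g x by exact: line_derive.
have fgE : 'D_1 (f \o k) 0 = 'D_v (f \o g) x by exact: (line_derive _ (f \o g)).
apply: DeriveDef.
  apply: (derivable1P (f \o g) x v).2; apply/derivable1_diffP.
  exact: differentiable_comp dk df.
rewrite -fgE deriveE; last exact: differentiable_comp.
by rewrite diff_comp //= -deriveE // -deriveE // kE k0.
Qed.

Lemma derive_comp1 (R : realType) (U : normedModType R) (f : R -> R) (g : U -> R)
    x v df : is_derive (g x) 1 f df -> derivable g x v ->
  is_derive x v (f \o g) (df * 'D_v g x).
Proof.
move=> [fd <-] dg.
have H := derive_comp_differentiable ((derivable1_diffP _ _).1 fd) dg.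
apply: is_derive_eq H _.
have -> : 'D_v g x = 'D_v g x *: (1 : R) by rewrite [_ *: _]mulr1.
rewrite (deriveZ_dir _ fd) -[_ *: (1 : R)]/(_ * 1) mulr1.
by rewrite [LHS]mulrC.
Qed.

(** * Smooth functions of several real variables *)

Section RowCalculus.
Context {R : realType} {n : nat}.
Local Notation V := 'rV[R]_n.
Implicit Types (O : set V) (f : V -> R).

Lemma derive_partial O f x v : open O -> smooth_on O f -> O x ->
  'D_v f x = \sum_i v 0 i * partial i f x.
Proof.
move=> oO sf Ox; rewrite {1}[v]row_sum_delta.
rewrite (big_morph (fun w => 'D_w f x) (id1 := 0) (op1 := +%R)); first last.
- exact: derive0.
- by move=> a b; apply: deriveD_dir oO sf Ox.
apply: eq_bigr => i _; rewrite deriveZ_dir //; exact: smooth_derivable sf Ox.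
Qed.

Lemma coord_le_norm (v : V) i : `|v 0 i| <= `|v|.
Proof.
by rewrite [leRHS]/Num.Def.normr /= mx_normrE; apply: (le_bigmax _ _ (0, i)).
Qed.

(** By the mean value theorem the remainder is the sum of h_i times the variation of the i-th
    partial derivative between x and a nearby point, and these variations are uniformly small by
    continuity. *)
Lemma smooth_differentiable O f x : open O -> smooth_on O f -> O x ->
  differentiable f x.
Proof.
move=> oO sf Ox.
pose L (v : V) := \sum_i v 0 i * partial i f x.
have Llin : linear L.
  move=> a u v; rewrite /L scaler_sumr -big_split /=; apply: eq_bigr => i _.
  by rewrite !mxE mulrDl -mulrA.
pose LL : {linear V -> R} := HB.pack L (GRing.isLinear.Build _ _ _ _ _ Llin).
have Lc : continuous LL.
  apply: (@continuous_big R _ +%R 0); first exact: add_continuous.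
  have ci i : continuous (fun v : V => v 0 i * partial i f x).
    move=> v; apply: (@continuousM R V (fun v : V => v 0 i) (cst (partial i f x))).
      exact: coord_continuous.
    exact: cst_continuous.
  by move=> i _; exact: ci.
have Lo (e : R) : 0 < e ->
    \forall h \near (0 : V), `|f (h + x) - (f x + L h)| <= e * `|h|.
  move=> e0.
  (* Dividing by n + 1 rather than n covers n = 0. *)
  have n1 : 0 < n%:R + 1 :> R by rewrite ltr_wpDl.
  have e1 : 0 < e / (n%:R + 1) by rewrite divr_gt0.
  have [d d0 dP] : exists2 d : R, 0 < d & forall y, ball x d y ->
      O y /\ forall i, `|partial i f x - partial i f y| <= e / (n%:R + 1).
    have H i := smooth_near (delta_mx 0 i) oO sf Ox e1.
    pose D i := sval (cid2 (H i)).
    have [d0 d00 dO] : exists2 d : R, 0 < d & ball x d `<=` O.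
      by have /nbhs_ballP[d /= d0 dO] := open_nbhs_nbhs (conj oO Ox); exists d.
    exists (\big[Order.min/d0]_i D i).
      apply/bigmin_gtP; split => // i _; rewrite /D; case: cid2 => //.
    move=> y xy; split; first by apply: dO; apply: le_ball xy; exact: bigmin_le_id.
    move=> i; have : ball x (D i) y by apply: le_ball xy; exact: bigmin_le.
    by rewrite /D; case: cid2 => //= r r0 Hr /Hr[].
  near=> h.
  have bh : ball x d (h + x).
    near: h; apply/nbhs_ballP; exists d => // y; rewrite -ball_normE /= sub0r.
    by rewrite opprD addrCA subrr addr0.
  have bt (t : R) : 0 <= t <= 1 -> ball x d (x + t *: h).
    by move=> t01; apply: ball_segment; rewrite // 1?addrC //; exact: ballxx.
  have fd (t : R) : 0 <= t <= 1 -> derivable f (x + t *: h) h.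
    by move=> /bt/dP[Oy _]; exact: smooth_derivable sf Oy.
  have [t t01 Et] := MVT_line fd.
  have [Oy Hy] := dP _ (bt t t01).
  have -> : f (h + x) - (f x + L h) =
      \sum_i h 0 i * (partial i f (x + t *: h) - partial i f x).
    transitivity ('D_h f (x + t *: h) - L h).
      by rewrite -Et (addrC x h) opprD addrA.
    rewrite (derive_partial _ oO sf Oy) /L -sumrB.
    by apply: eq_bigr => i _; rewrite mulrBr.
  apply: le_trans (ler_norm_sum _ _ _) _.
  apply: (@le_trans _ _ (\sum_(i < n) `|h| * (e / (n%:R + 1)))).
    apply: ler_sum => i _; rewrite normrM ler_pM // ?coord_le_norm //.
    by rewrite distrC; exact: Hy.
  rewrite sumr_const card_ord -[_ *+ n]mulr_natl mulrCA mulrC; apply: ler_wpM2r => //.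
  rewrite mulrCA; apply: ler_piMr; first exact: ltW.
  by rewrite ler_pdivrMr // mul1r lerDl.
have dL : 'd f x = LL :> (V -> R).
  by apply: diff_unique => //; apply/eqaddoP; exact: Lo.
apply/diff_locallyP; rewrite dL; split => //; apply/eqaddoP; exact: Lo.
Unshelve. all: by end_near. Qed.

Lemma derive_chain (U : normedModType R) O f (g : U -> V) x v :
  open O -> smooth_on O f -> O (g x) -> derivable g x v ->
  is_derive x v (f \o g) ('D_('D_v g x) f (g x)).
Proof.
move=> oO sf Og dg; apply: derive_comp_differentiable => //.
exact: smooth_differentiable oO sf Og.
Qed.

End RowCalculus.

(** * Primitives of closed 1-forms *)

Section Primitive.
Context {R : realType}.
Local Notation mu := (@lebesgue_measure R).

(** Dominated differentiation under the integral sign, combined with the fundamental theorem of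
    calculus: at s = 0 the differentiated integrand has the primitive G in t. *)
Lemma is_derive_integral01 (f f1 : R -> R -> R) (G : R -> R) (d C : R) :
  0 < d ->
  (forall s t : R, `|s| < d -> 0 <= t <= 1 -> is_derive s 1 (f^~ t) (f1 s t)) ->
  (forall s : R, `|s| < d -> {within `[0, 1], continuous (f s)}) ->
  (forall s t : R, `|s| < d -> 0 <= t <= 1 -> `|f1 s t| <= C) ->
  (forall t : R, 0 <= t <= 1 -> is_derive t 1 G (f1 0 t)) ->
  {within `[0, 1], continuous (f1 0)} ->
  is_derive (0 : R) 1 (fun s => \int[mu]_(t in `[0, 1]) f s t) (G 1 - G 0).
Proof.
move=> d0 fd fc fC Gd f1c.
have inI s : s \in `](- d), d[ = (`|s| < d) by rewrite in_itv /= ltr_norml.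
have in01 (t : R) : (t \in `[0, 1]) = (0 <= t <= 1) by rewrite in_itv.
have m01 : measurable (`[0, 1]%classic : set (measurableTypeR R)) by [].
have I0 : (`](- d), d[%classic : set R) 0 by rewrite /= inI normr0.
have intf s : (`](- d), d[%classic : set R) s ->
    mu.-integrable `[0, 1] (EFin \o f s).
  rewrite /= inI => sd; apply: continuous_compact_integrable (fc _ sd).
  exact: segment_compact.
have derf s t : (`](- d), d[%classic : set R) s ->
    (`[0, 1]%classic : set R) t -> derivable (f ^~ t) s 1.
  by rewrite /= inI in01 => sd t01; have [] := fd s t sd t01.
have d1E s t : (`](- d), d[%classic : set R) s ->
    (`[0, 1]%classic : set R) t -> partial1of2 f s t = f1 s t.
  rewrite /= inI in01 => sd t01; rewrite partial1of2E.
  by have [_ ->] := fd s t sd t01.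
have C0 : 0 <= C.
  apply: le_trans (fC 0 0 _ _) => //; first by rewrite normr0.
  by rewrite lexx ler01.
have intC : mu.-integrable `[0, 1] (EFin \o (cst C : R -> R)).
  apply: continuous_compact_integrable; first exact: segment_compact.
  by apply: continuous_subspaceT; exact: cst_continuous.
have fub s t : (`](- d), d[%classic : set R) s ->
    (`[0, 1]%classic : set R) t -> `|partial1of2 f s t| <= (cst C : R -> R) t.
  move=> sd t01; rewrite d1E //.
  by move: sd t01; rewrite /= inI in01; exact: fC.
have dF := @derivable_under_integral R _ _ mu f _ m01 0 (- d) d I0 intf derf
  (cst C) (fun=> C0) intC fub.
have eF := @differentiation_under_integral R _ _ mu f _ m01 0 (- d) d I0 intf derf
  (cst C) (fun=> C0) intC fub.
apply: DeriveDef; first exact: dF.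
rewrite -derive1E eF /=.
have -> : (\int[mu]_(y in `[0, 1]) partial1of2 f 0 y) =
    (\int[mu]_(y in `[0, 1]) f1 0 y).
  by apply: eq_Rintegral => y; rewrite inE => y01; exact: d1E.
rewrite /Rintegral (@continuous_FTC2 R (f1 0) G) //.
- have Gc : {within `[0, 1], continuous G}.
    by apply: derivable_within_continuous => t; rewrite in01 => /Gd[].
  have [_ G0 G1] := (continuous_within_itvP G (@ltr01 R)).1 Gc.
  split; [move=> t|exact: G0|exact: G1].
  rewrite in_itv /= => /andP[/ltW t0 /ltW t1].
  by have [|] := Gd t; first by rewrite t0.
- move=> t; rewrite in_itv /= => /andP[/ltW t0 /ltW t1].
  by rewrite derive1E; have [|_ ->] := Gd t; rewrite ?t0.
Qed.

Lemma closed_ball_bound n (u0 : 'rV[R]_n) (e : R) (f : 'rV[R]_n -> R) :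
  0 <= e -> (forall x, `|u0 - x| <= e -> {for x, continuous f}) ->
  exists C, forall x, `|u0 - x| <= e -> `|f x| <= C.
Proof.
move=> e0 fc; pose A := [set x : 'rV[R]_n | `|u0 - x| <= e].
have cA : compact A.
  have -> : A = closed_ball_ (fun x => `|x|) u0 e by [].
  apply: bounded_closed_compact; last exact: closed_closed_ball_.
  exists (`|u0| + e); split; first exact: num_real.
  move=> M uM x /= xe; apply: ltW; apply: le_lt_trans uM.
  rewrite -[x](subKr u0); apply: le_trans (ler_normB _ _) _.
  by rewrite lerD2l.
have [||c _ Hc] := @EVT_max_rV R n (fun x => `|f x|) A _ cA.
- by exists u0; rewrite /A /= subrr normr0.
- apply: continuous_in_subspaceT => x; rewrite inE => /fc fx.
  apply: (@continuous_comp _ _ _ f (fun y => `|y|)) => //; exact: norm_continuous.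
by exists `|f c| => x xe; apply: Hc; rewrite inE.
Qed.
End Primitive.

Lemma continuous_dist (R : realType) (V : normedModType R) (f : V -> R) x :
  {for x, continuous f} <->
  forall e : R, 0 < e -> \forall y \near x, `|f x - f y| <= e.
Proof. by split=> [fc e e0|fe]; [move/cvgrPdist_le: fc; exact|exact/cvgrPdist_le]. Qed.

Lemma is_derive_mull (R : realType) (a : R) (g : R -> R) (s d : R) :
  is_derive s 1 g d -> is_derive s 1 (fun t => a * g t) (a * d).
Proof. exact: is_deriveZ. Qed.

Lemma is_derive_sumf (R : realType) n (h : 'I_n -> R -> R) (dh : 'I_n -> R) (s : R) :
  (forall i, is_derive s 1 (h i) (dh i)) ->
  is_derive s 1 (fun t => \sum_i h i t) (\sum_i dh i).
Proof.
move=> hd; have -> : (fun t => \sum_i h i t) = \sum_i h i.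
  by apply/funext => t; rewrite fct_sumE.
exact: is_derive_sum.
Qed.

Section ClosedForm.
Context {R : realType} {n : nat}.
Local Notation V := 'rV[R]_n.
Local Notation mu := (@lebesgue_measure R).
Implicit Types (O : set V) (f : V -> R).

(** The Poincare lemma on a ball: the primitive is the integral of the form along the radius from
    u0. *)
Lemma closed_form_primitive (u0 : V) (e : R) (th : 'I_n -> V -> R) :
  (forall i, smooth_on (ball u0 e) (th i)) ->
  (forall x i j, ball u0 e x -> partial i (th j) x = partial j (th i) x) ->
  exists2 r : V -> R, r u0 = 0 &
    forall x v, ball u0 e x -> is_derive x v r (\sum_i v 0 i * th i x).
Proof.
move=> sth cth.
have oB : open (ball u0 e) by exact: ball_open.
pose seg (y : V) (t : R) := u0 + t *: (y - u0).
pose r (y : V) := \int[mu]_(t in `[0, 1]) \sum_i (y - u0) 0 i * th i (seg y t).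
exists r.
  rewrite /r; transitivity (\int[mu]_(t in `[0, 1]) (cst 0 : R -> R) t).
    by apply: eq_Rintegral => t _; rewrite subrr big1 // => i _; rewrite mxE mul0r.
  by rewrite Rintegral_cst // mul0r.
move=> x v bx.
have xe : `|u0 - x| < e by move: bx; rewrite -ball_normE.
(* The closed ball of radius e' < e is compact, which will bound the coefficients and their
   derivatives; d below is such that x + s v stays in it for |s| < d. *)
pose e' := (`|u0 - x| + e) / 2.
have e'e : e' < e by rewrite /e'; lra.
have e'0 : 0 <= e' by rewrite /e'; have := normr_ge0 (u0 - x); lra.
have inB y : `|u0 - y| <= e' -> ball u0 e y.
  by rewrite -ball_normE /= => /le_lt_trans; exact.
have v1 : 0 < `|v| + 1 by rewrite ltr_wpDl.
pose d := (e' - `|u0 - x|) / (`|v| + 1).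
have d0 : 0 < d by rewrite divr_gt0 // /e'; lra.
pose w (s : R) := s *: v + x - u0.
have we (s : R) : `|s| < d -> `|w s| <= e'.
  move=> sd; rewrite /w -addrA; apply: le_trans (ler_normD _ _) _.
  rewrite (distrC x) normrZ.
  suff : `|s| * `|v| <= e' - `|u0 - x| by lra.
  have : `|s| * (`|v| + 1) <= e' - `|u0 - x|.
    by rewrite -ler_pdivlMr //; exact: ltW.
  by apply: le_trans; rewrite ler_wpM2l // lerDl.
have ce (s t : R) : `|s| < d -> 0 <= t <= 1 -> `|u0 - (u0 + t *: w s)| <= e'.
  move=> /we ws /andP[t0 t1]; rewrite opprD addNKr normrN normrZ ger0_norm //.
  by apply: le_trans ws; rewrite ler_piMl.
pose Dth i y := 'D_v (th i) y.
pose f (s t : R) := \sum_i (w s) 0 i * th i (u0 + t *: w s).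
pose f1 (s t : R) := \sum_i (v 0 i * th i (u0 + t *: w s) +
                       w s 0 i * (t * Dth i (u0 + t *: w s))).
(* By closedness, the derivative [f1 0] of the integrand along v is the t-derivative of G, so its
   integral is G 1 - G 0. *)
pose G (t : R) := t * \sum_i v 0 i * th i (u0 + t *: w 0).
have w0 : w 0 = x - u0 by rewrite /w scale0r add0r.
have rE : (fun s : R => r (s *: v + x)) = (fun s => \int[mu]_(t in `[0, 1]) f s t).
  by [].
have GE : G 1 - G 0 = \sum_i v 0 i * th i x.
  rewrite /G mul0r subr0 mul1r; apply: eq_bigr => i _.
  by rewrite scale1r w0 addrC subrK.
have d00 : `|0 : R| < d by rewrite normr0.
have thd i y u : `|u0 - y| <= e' -> derivable (th i) y u.
  by move=> /inB; exact: smooth_derivable.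
have Dthd i y u : `|u0 - y| <= e' -> derivable (Dth i) y u.
  by move=> /inB; apply: smooth_derivable; exact: smooth_derive.
have wd (s : R) i : is_derive s 1 (fun s => w s 0 i) (v 0 i).
  have -> : (fun s => w s 0 i) = (fun s => (s * v 0 i + (x - u0) 0 i)).
    by apply/funext => s'; rewrite /w !mxE addrA.
  have : is_derive s 1 (fun s : R => s * v 0 i + (x - u0) 0 i) (v 0 i *: 1 + 0).
    apply: is_deriveD.
    have -> : (fun s : R => s * v 0 i) = (v 0 i) \*: (id : R -> R).
      by apply/funext => s' /=; rewrite mulrC.
    exact: is_deriveZ.
  by rewrite addr0 [_ *: 1]mulr1.
have lined (g : V -> R) (s t : R) : derivable g (u0 + t *: w s) v ->
    is_derive s 1 (fun s => g (u0 + t *: w s)) (t * 'D_v g (u0 + t *: w s)).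
  move=> gd.
  have Ep s' : u0 + t *: w s' = (u0 + t *: (x - u0)) + s' *: (t *: v).
    rewrite /w -(addrA (s' *: v)) scalerDr addrCA addrC; congr (_ + _).
    by rewrite !scalerA mulrC.
  have E : (fun s => g (u0 + t *: w s)) =
      (fun s => g ((u0 + t *: (x - u0)) + s *: (t *: v))).
    by apply/funext => s'; rewrite Ep.
  rewrite E; apply: is_derive_line; rewrite -Ep.
  exact: (is_derive_scale t (derivableP gd)).
have linet (g : V -> R) (t : R) s : derivable g (u0 + t *: w s) (w s) ->
    is_derive t 1 (fun t => g (u0 + t *: w s)) ('D_(w s) g (u0 + t *: w s)).
  by move=> gd; apply: is_derive_line; exact: derivableP.
have fd (s t : R) : `|s| < d -> 0 <= t <= 1 -> is_derive s 1 (f^~ t) (f1 s t).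
  move=> sd t01.
  have Hi i : is_derive s 1 (fun s => w s 0 i * th i (u0 + t *: w s))
      (v 0 i * th i (u0 + t *: w s) + w s 0 i * (t * Dth i (u0 + t *: w s))).
    have H := is_deriveM (wd s i) (lined (th i) s t (thd i _ _ (ce s t sd t01))).
    apply: is_derive_eq H _.
    by rewrite /= /GRing.scale /= addrC mulrC.
  exact: (is_derive_sumf Hi).
have f1c (s : R) : `|s| < d -> {within `[0, 1], continuous (f1 s)}.
  move=> sd; apply: derivable_within_continuous => t; rewrite in_itv /= => t01.
  have Hi i : is_derive t 1
      (fun t => v 0 i * th i (u0 + t *: w s) + w s 0 i * (t * Dth i (u0 + t *: w s)))
      (v 0 i * 'D_(w s) (th i) (u0 + t *: w s) + w s 0 i *
        (t *: 'D_(w s) (Dth i) (u0 + t *: w s) + Dth i (u0 + t *: w s) *: (1 : R))).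
    have H1 := is_derive_mull (v 0 i) (linet (th i) t s (thd i _ _ (ce s t sd t01))).
    have H := is_deriveM (is_derive_id t 1)
      (linet (Dth i) t s (Dthd i _ _ (ce s t sd t01))).
    have H2 := is_derive_mull (w s 0 i) H.
    exact: (is_deriveD H1 H2).
  by have [] := is_derive_sumf Hi.
have fc (s : R) : `|s| < d -> {within `[0, 1], continuous (f s)}.
  move=> sd; apply: derivable_within_continuous => t; rewrite in_itv /= => t01.
  have Hi i := is_derive_mull (w s 0 i) (linet (th i) t s (thd i _ _ (ce s t sd t01))).
  by have [] := is_derive_sumf Hi.
have Gd (t : R) : 0 <= t <= 1 -> is_derive t 1 G (f1 0 t).
  move=> t01; set y := u0 + t *: w 0.
  have by_ : ball u0 e y by apply: inB; exact: ce.
  have Hi i := is_derive_mull (v 0 i) (linet (th i) t 0 (thd i _ _ (ce 0 t d00 t01))).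
  have Sd := is_derive_sumf Hi.
  have H := is_deriveM (is_derive_id t 1) Sd.
  apply: is_derive_eq H _; rewrite /GRing.scale /= mulr1 /f1 big_split /= addrC.
  congr (_ + _).
  have E (a b : V) : \sum_i a 0 i * 'D_b (th i) y =
      \sum_i \sum_j a 0 i * (b 0 j * partial j (th i) y).
    by apply: eq_bigr => i _; rewrite (derive_partial b oB (sth i) by_) mulr_sumr.
  transitivity (t * \sum_i w 0 0 i * 'D_v (th i) y).
    congr (t * _); rewrite !E exchange_big /=; apply: eq_bigr => i _.
    by apply: eq_bigr => j _; rewrite (cth _ _ _ by_) mulrCA.
  by rewrite mulr_sumr; apply: eq_bigr => i _; rewrite mulrCA.
have thb i : exists C, forall y, `|u0 - y| <= e' -> `|th i y| <= C.
  apply: closed_ball_bound => // y /inB By; exact: smooth_continuous (sth i) By.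
have Dthb i : exists C, forall y, `|u0 - y| <= e' -> `|Dth i y| <= C.
  apply: closed_ball_bound => // y /inB By.
  exact: smooth_continuous (smooth_derive v (sth i)) By.
pose A i := sval (cid (thb i)); pose B i := sval (cid (Dthb i)).
have HA i y : `|u0 - y| <= e' -> `|th i y| <= A i.
  by rewrite /A; case: cid => ? /= H /H.
have HB i y : `|u0 - y| <= e' -> `|Dth i y| <= B i.
  by rewrite /B; case: cid => ? /= H /H.
have f1b (s t : R) : `|s| < d -> 0 <= t <= 1 ->
    `|f1 s t| <= \sum_i (`|v 0 i| * A i + e' * B i).
  move=> sd t01; have cst_ := ce s t sd t01.
  apply: le_trans (ler_norm_sum _ _ _) _; apply: ler_sum => i _.
  apply: le_trans (ler_normD _ _) _; rewrite !normrM; apply: lerD.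
    by rewrite ler_wpM2l // HA.
  apply: ler_pM => //.
  - by apply: le_trans (we s sd); exact: coord_le_norm.
  - apply: le_trans (HB i _ cst_).
    by move/andP: t01 => [t0 t1]; rewrite ger0_norm // ler_piMl.
have H := is_derive_integral01 d0 fd fc f1b Gd (f1c 0 d00).
rewrite -rE GE in H.
have Hd : derivable r x v by apply: (derivable1P r x v).2; case: H.
have Hv : 'D_v r x = \sum_i v 0 i * th i x.
  case: H => _ <-.
  have E : (fun h : R => h^-1 *: (r ((h *: 1 + 0) *: v + x) - r (0 *: v + x))) =
      (fun h => h^-1 *: (r (h *: v + x) - r x)).
    by apply/funext => h; rewrite scale0r add0r addr0 [h *: 1]mulr1.
  by rewrite /derive /= E.
by split.
Qed.

(** Only continuity takes work: it follows from local bounds on the partial derivatives and the mean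
    value theorem. All higher regularity is that of the coefficients [th i]. *)
Lemma smooth_of_partials O (r : V -> R) (th : 'I_n -> V -> R) : open O ->
  (forall i, smooth_on O (th i)) ->
  (forall x v, O x -> is_derive x v r (\sum_i v 0 i * th i x)) ->
  smooth_on O r.
Proof.
move=> oO sth rd.
have rc x : O x -> {for x, continuous r}.
  move=> Ox; have nO : nbhs x O by exact: open_nbhs_nbhs.
  pose M i := `|th i x| + 1.
  have M0 i : 0 <= M i by rewrite addr_ge0.
  have : \forall y \near x, O y /\ forall i, `|th i y| <= M i.
    near=> y; split; first by near: y.
    move=> i; move: i; near: y; apply: filter_forall => i.
    have /continuous_dist/(_ 1 ltr01) := smooth_continuous (sth i) Ox.
    apply: filterS => y thy; rewrite -[th i y](subKr (th i x)).
    by apply: le_trans (ler_normB _ _) _; rewrite lerD2l.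
  move=> /nbhs_ballP[d /= d0 dP].
  have S1 : 0 < \sum_i M i + 1 by rewrite ltr_wpDl // sumr_ge0.
  apply/continuous_dist => e e0; near=> y.
  have xy : ball x d y by near: y; exact: nbhsx_ballx.
  have bt (t : R) : 0 <= t <= 1 -> ball x d (x + t *: (y - x)).
    by move=> t01; apply: ball_segment; rewrite // 1?addrC ?subrK //; exact: ballxx.
  have fd (t : R) : 0 <= t <= 1 -> derivable r (x + t *: (y - x)) (y - x).
    by move=> /bt/dP[Oy _]; have [] := rd _ (y - x) Oy.
  have [t t01] := MVT_line fd; rewrite (addrC x (y - x)) subrK => Et.
  have [Oy Hy] := dP _ (bt t t01).
  rewrite distrC Et; have [_ ->] := rd _ (y - x) Oy.
  apply: le_trans (ler_norm_sum _ _ _) _.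
  apply: (@le_trans _ _ (\sum_i `|y - x| * M i)).
    apply: ler_sum => i _; rewrite normrM; apply: ler_pM => //.
    exact: coord_le_norm.
  rewrite -mulr_sumr.
  apply: (@le_trans _ _ (`|y - x| * (\sum_i M i + 1))).
    by rewrite ler_wpM2l // lerDl.
  rewrite -ler_pdivlMr // distrC; apply: ltW.
  have : ball x (e / (\sum_i M i + 1)) y.
    by near: y; apply: nbhsx_ballx; exact: divr_gt0.
  by rewrite -ball_normE.
move=> [|k]; split => //; move=> v; split.
  by move=> x Ox; have [] := rd x v Ox.
have sS : smooth_on O (fun x => \sum_i v 0 i * th i x).
  apply: smooth_sum => // i _; apply: smoothM => //; exact: smooth_cst.
by apply: Ck_ext oO _ (sS k) => x Ox; have [_ ->] := rd x v Ox.
Unshelve. all: by end_near. Qed.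

End ClosedForm.

(** * Curvature in a moving frame *)

Section MatrixCalculus.
Context {R : realType} {n : nat}.
Local Notation V := 'rV[R]_n.
Implicit Types (O : set V).

(** Asked entry by entry, so that products and linear images of matrices reduce to sums and products
    of scalar functions. *)
Definition smooth_mx p q O (M : V -> 'M[R]_(p, q)) :=
  forall a b, smooth_on O (fun x => M x a b).

Definition partial_mx p q (i : 'I_n) (M : V -> 'M[R]_(p, q)) u :=
  \matrix_(a, b) partial i (fun x => M x a b) u.

Lemma partial_mxE p q i (M : V -> 'M[R]_(p, q)) u a b :
  partial_mx i M u a b = partial i (fun x => M x a b) u.
Proof. by rewrite mxE. Qed.

Lemma partial_ext O i (f g : V -> R) u : open O -> (forall x, O x -> f x = g x) ->
  O u -> partial i f u = partial i g u.
Proof.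
move=> oO fg Ou; apply: near_eq_derive; apply: filterS fg _.
exact: open_nbhs_nbhs.
Qed.

Lemma partialD O i (f g : V -> R) u : smooth_on O f -> smooth_on O g -> O u ->
  partial i (fun x => f x + g x) u = partial i f u + partial i g u.
Proof.
move=> sf sg Ou; have fd := @smooth_derivable _ _ _ _ _ _ (delta_mx 0 i) sf Ou.
have gd := @smooth_derivable _ _ _ _ _ _ (delta_mx 0 i) sg Ou.
exact: (deriveD fd gd).
Qed.

Lemma partialM O i (f g : V -> R) u : smooth_on O f -> smooth_on O g -> O u ->
  partial i (fun x => f x * g x) u = partial i f u * g u + f u * partial i g u.
Proof.
move=> sf sg Ou; have fd := @smooth_derivable _ _ _ _ _ _ (delta_mx 0 i) sf Ou.
have gd := @smooth_derivable _ _ _ _ _ _ (delta_mx 0 i) sg Ou.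
by apply: (etrans (deriveM fd gd)); rewrite /GRing.scale /= addrC mulrC.
Qed.

Lemma partial_cst i (a : R) u : partial i (fun _ : V => a) u = 0.
Proof. exact: derive_cst. Qed.

Lemma partialMl O i (a : R) (f : V -> R) u : smooth_on O f -> O u ->
  partial i (fun x => a * f x) u = a * partial i f u.
Proof.
move=> sf Ou; rewrite (partialM _ (smooth_cst O a) sf Ou) partial_cst mul0r.
by rewrite add0r.
Qed.

Lemma partial_sum O i (I : Type) (r : seq I) (F : I -> V -> R) u : open O ->
  (forall k, smooth_on O (F k)) -> O u ->
  partial i (fun x => \sum_(k <- r) F k x) u = \sum_(k <- r) partial i (F k) u.
Proof.
move=> oO sF Ou; elim: r => [|k r IH].
  rewrite big_nil -[RHS](partial_cst i 0 u); apply: (partial_ext _ oO) => // x _.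
  by rewrite big_nil.
rewrite big_cons -IH -(partialD _ (sF k) _ Ou); last exact: smooth_sum.
by apply: (partial_ext _ oO) => // x _; rewrite big_cons.
Qed.

Lemma partial_comm O i j (f : V -> R) u : open O -> smooth_on O f -> O u ->
  partial i (partial j f) u = partial j (partial i f) u.
Proof. by move=> oO sf Ou; exact: derive_comm oO sf Ou. Qed.

Lemma smooth_partial O i (f : V -> R) : smooth_on O f -> smooth_on O (partial i f).
Proof. exact: smooth_derive. Qed.

Lemma smooth_mx_cst p q O (A : 'M[R]_(p, q)) : smooth_mx O (fun=> A).
Proof. by move=> a b; exact: smooth_cst. Qed.

Lemma smooth_mxD p q O (A B : V -> 'M[R]_(p, q)) : open O ->
  smooth_mx O A -> smooth_mx O B -> smooth_mx O (fun x => A x + B x).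
Proof.
move=> oO sA sB a b; apply: (smooth_ext oO _ (smoothD oO (sA a b) (sB a b))).
by move=> x _; rewrite mxE.
Qed.

Lemma smooth_mxZ p q O (f : V -> R) (A : V -> 'M[R]_(p, q)) : open O ->
  smooth_on O f -> smooth_mx O A -> smooth_mx O (fun x => f x *: A x).
Proof.
move=> oO sf sA a b; apply: (smooth_ext oO _ (smoothM oO sf (sA a b))).
by move=> x _; rewrite mxE.
Qed.

Lemma smooth_mxM p q r O (A : V -> 'M[R]_(p, q)) (B : V -> 'M[R]_(q, r)) :
  open O -> smooth_mx O A -> smooth_mx O B -> smooth_mx O (fun x => A x *m B x).
Proof.
move=> oO sA sB a b.
have S : smooth_on O (fun x => \sum_k A x a k * B x k b).
  by apply: smooth_sum => // k _; apply: smoothM.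
by apply: (smooth_ext oO _ S) => x _; rewrite mxE.
Qed.

Lemma smooth_mx_tr p q O (A : V -> 'M[R]_(p, q)) :
  open O -> smooth_mx O A -> smooth_mx O (fun x => (A x)^T).
Proof.
by move=> oO sA a b; apply: (smooth_ext oO _ (sA b a)) => x _; rewrite mxE.
Qed.

Lemma smooth_partial_mx p q O i (A : V -> 'M[R]_(p, q)) :
  open O -> smooth_mx O A -> smooth_mx O (partial_mx i A).
Proof.
move=> oO sA a b; apply: (smooth_ext oO _ (smooth_partial i (sA a b))) => x _.
by rewrite mxE.
Qed.

Lemma linear_mxE p q r s (f : {linear 'M[R]_(p, q) -> 'M[R]_(r, s)}) A a b :
  f A a b = \sum_k \sum_l A k l * f (delta_mx k l) a b.
Proof.
rewrite {1}[A]matrix_sum_delta linear_sum summxE; apply: eq_bigr => k _.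
by rewrite linear_sum summxE; apply: eq_bigr => l _; rewrite linearZ mxE.
Qed.

Lemma smooth_mx_linear p q r s O (f : {linear 'M[R]_(p, q) -> 'M[R]_(r, s)})
    (A : V -> 'M[R]_(p, q)) : open O -> smooth_mx O A ->
  smooth_mx O (fun x => f (A x)).
Proof.
move=> oO sA a b.
have S : smooth_on O (fun x => \sum_k \sum_l A x k l * f (delta_mx k l) a b).
  apply: smooth_sum => // k _; apply: smooth_sum => // l _; apply: smoothM => //.
  exact: smooth_cst.
by apply: (smooth_ext oO _ S) => x _; rewrite -linear_mxE.
Qed.

Lemma partial_mx_ext p q O i (A B : V -> 'M[R]_(p, q)) u : open O ->
  (forall x, O x -> A x = B x) -> O u -> partial_mx i A u = partial_mx i B u.
Proof.
move=> oO AB Ou; apply/matrixP => a b; rewrite !mxE.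
by apply: (partial_ext _ oO) => // x /AB ->.
Qed.

Lemma partial_mx_cst p q i (A : 'M[R]_(p, q)) u : partial_mx i (fun=> A) u = 0.
Proof. by apply/matrixP => a b; rewrite !mxE partial_cst. Qed.

Lemma partial_mxD p q O i (A B : V -> 'M[R]_(p, q)) u : open O ->
  smooth_mx O A -> smooth_mx O B -> O u ->
  partial_mx i (fun x => A x + B x) u = partial_mx i A u + partial_mx i B u.
Proof.
move=> oO sA sB Ou; apply/matrixP => a b; rewrite !mxE.
rewrite -(partialD _ (sA a b) (sB a b) Ou).
by apply: (partial_ext _ oO) => // x _; rewrite mxE.
Qed.

Lemma partial_mxZ p q O i (f : V -> R) (A : V -> 'M[R]_(p, q)) u : open O ->
  smooth_on O f -> smooth_mx O A -> O u ->
  partial_mx i (fun x => f x *: A x) u =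
  partial i f u *: A u + f u *: partial_mx i A u.
Proof.
move=> oO sf sA Ou; apply/matrixP => a b; rewrite !mxE.
rewrite -(partialM _ sf (sA a b) Ou).
by apply: (partial_ext _ oO) => // x _; rewrite mxE.
Qed.

Lemma partial_mxM p q r O i (A : V -> 'M[R]_(p, q)) (B : V -> 'M[R]_(q, r)) u :
  open O -> smooth_mx O A -> smooth_mx O B -> O u ->
  partial_mx i (fun x => A x *m B x) u =
  partial_mx i A u *m B u + A u *m partial_mx i B u.
Proof.
move=> oO sA sB Ou; apply/matrixP => a b; rewrite !mxE.
have -> : partial i (fun x => (A x *m B x) a b) u =
    partial i (fun x => \sum_k A x a k * B x k b) u.
  by apply: (partial_ext _ oO) => // x _; rewrite mxE.
rewrite (partial_sum _ _ oO) //; last by move=> k; exact: smoothM.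
rewrite -big_split /=; apply: eq_bigr => k _; rewrite !mxE.
exact: partialM.
Qed.

Lemma partial_mx_tr p q O i (A : V -> 'M[R]_(p, q)) u : open O -> O u ->
  partial_mx i (fun x => (A x)^T) u = (partial_mx i A u)^T.
Proof.
move=> oO Ou; apply/matrixP => a b; rewrite !mxE.
by apply: (partial_ext _ oO) => // x _; rewrite mxE.
Qed.

Lemma partial_mx_linear p q r s O i (f : {linear 'M[R]_(p, q) -> 'M[R]_(r, s)})
    (A : V -> 'M[R]_(p, q)) u : open O -> smooth_mx O A -> O u ->
  partial_mx i (fun x => f (A x)) u = f (partial_mx i A u).
Proof.
move=> oO sA Ou; apply/matrixP => a b; rewrite [RHS]linear_mxE !mxE.
have -> : partial i (fun x => f (A x) a b) u =
    partial i (fun x => \sum_k \sum_l A x k l * f (delta_mx k l) a b) u.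
  by apply: (partial_ext _ oO) => // x _; rewrite -linear_mxE.
rewrite (partial_sum _ _ oO) //; last first.
  move=> k; apply: smooth_sum => // l _; apply: smoothM => //; exact: smooth_cst.
apply: eq_bigr => k _; rewrite (partial_sum _ _ oO) //; last first.
  move=> l; apply: smoothM => //; exact: smooth_cst.
apply: eq_bigr => l _.
rewrite (partialM _ (sA k l) (smooth_cst O _) Ou) partial_cst mulr0 addr0.
by rewrite mxE.
Qed.

Lemma partial_mx_comm p q O i j (A : V -> 'M[R]_(p, q)) u : open O ->
  smooth_mx O A -> O u ->
  partial_mx i (partial_mx j A) u = partial_mx j (partial_mx i A) u.
Proof.
move=> oO sA Ou.
apply/matrixP => a b.
apply: (etrans (partial_mxE i (partial_mx j A) u a b)).
apply: (etrans _ (esym (partial_mxE j (partial_mx i A) u a b))).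
transitivity (partial i (partial j (fun x => A x a b)) u).
  by apply: (partial_ext _ oO) => // x _; rewrite partial_mxE.
rewrite (partial_comm _ _ oO (sA a b) Ou).
by apply: (partial_ext _ oO) => // x _; rewrite partial_mxE.
Qed.

End MatrixCalculus.

(** * Cartan's structure equations and the Ricci tensor *)

Section Cartan.
Context {R : realType} {n : nat}.
Local Notation V := 'rV[R]_n.
Variables (O : set V) (F E : V -> 'M[R]_n) (A : 'I_n -> V -> 'M[R]_n).
Variables (eta : 'M[R]_n) (h : V -> 'M[R]_n).
Hypotheses (oO : open O) (sF : smooth_mx O F) (sE : smooth_mx O E).
Hypothesis sA : forall i, smooth_mx O (A i).
Hypothesis FE : forall x, O x -> F x *m E x = 1%:M.
Hypotheses (eta_sym : eta^T = eta) (eta_unit : eta \in unitmx).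
Hypothesis hE : forall x, O x -> h x = F x *m eta *m (F x)^T.
Hypothesis skewA : forall i x, O x -> A i x *m eta + eta *m (A i x)^T = 0.

(** Row j of F x holds the frame components of the j-th coordinate field, and [A i] is the
    connection matrix along the i-th one. Row j of [G i] is thus the covariant derivative of the
    j-th coordinate field along the i-th, and [torsionA] is the absence of torsion. *)
Let G i x := partial_mx i F x + F x *m A i x.

Hypothesis torsionA : forall i j x, O x -> row j (G i x) = row i (G j x).

Let EF x : O x -> E x *m F x = 1%:M.
Proof. by move=> Ox; apply: mulmx1C; exact: FE. Qed.

(** Metric compatibility: by [skewA] the contributions of [A i] to the two terms of the product rule
    cancel, so [G i] may replace the derivative of F. *)
Let partial_h i x : O x ->
  partial_mx i h x = G i x *m eta *m (F x)^T + (G i x *m eta *m (F x)^T)^T.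
Proof.
move=> Ox; rewrite (partial_mx_ext _ oO hE Ox).
have sFe : smooth_mx O (fun x => F x *m eta).
  by apply: smooth_mxM => //; exact: smooth_mx_cst.
have sFt := smooth_mx_tr oO sF.
rewrite (partial_mxM _ oO sFe sFt Ox) (partial_mxM _ oO sF (smooth_mx_cst O eta) Ox).
rewrite partial_mx_cst mulmx0 addr0 (partial_mx_tr _ _ oO Ox) /G.
have -> : partial_mx i F x = G i x - F x *m A i x by rewrite /G addrK.
move: (G i x) => g; rewrite subrK !trmx_mul eta_sym trmxK linearB /= trmx_mul.
rewrite !mulmxBl mulmxBr -!mulmxA.
have -> : A i x *m (eta *m (F x)^T) = - (eta *m ((A i x)^T *m (F x)^T)).
  rewrite !mulmxA; apply/eqP; rewrite -subr_eq0 opprK -mulmxDl.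
  by rewrite skewA // mul0mx.
rewrite mulmxN opprK.
by rewrite addrACA subrr addr0.
Qed.

Let invh x : O x -> invmx (h x) = (E x)^T *m invmx eta *m E x.
Proof.
move=> Ox; have H : h x *m ((E x)^T *m invmx eta *m E x) = 1%:M.
  rewrite hE // -!mulmxA (mulmxA (F x)^T) -trmx_mul EF // trmx1 mul1mx.
  by rewrite (mulmxA eta) mulmxV // mul1mx FE.
have [hu _] := mulmx1_unit H.
by rewrite -[RHS]mul1mx -(mulVmx hu) -(mulmxA (invmx (h x))) H mulmx1.
Qed.

Let torsion_entry i j l x : O x -> (G i x *m eta *m (F x)^T) j l =
  (G j x *m eta *m (F x)^T) i l.
Proof.
move=> Ox; have H := torsionA i j Ox.
have {}H : row j (G i x *m eta *m (F x)^T) = row i (G j x *m eta *m (F x)^T).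
  by rewrite -!mulmxA !row_mul H.
by move/rowP/(_ l): H; rewrite !mxE.
Qed.

(** Uniqueness of the Levi-Civita connection: metric compatibility and symmetry make the Koszul
    combination of derivatives of h collapse to twice a single term. *)
Lemma christoffel_frame k i j x : O x ->
  christoffel h k i j x = (G i x *m E x) j k.
Proof.
move=> Ox; rewrite /christoffel.
have dh a b c : partial a (fun y => h y b c) x =
    (G a x *m eta *m (F x)^T) b c + (G a x *m eta *m (F x)^T) c b.
  by rewrite -partial_mxE partial_h // mxE [X in _ + X]mxE.
pose H := G i x *m eta *m (F x)^T.
transitivity (\sum_l H j l * (invmx (h x))^T l k).
  rewrite mulr_sumr; apply: eq_bigr => l _; rewrite !dh.
  rewrite [(invmx _)^T l k]mxE -/H (torsion_entry j i l Ox) -/H.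
  rewrite (torsion_entry i l j Ox) (torsion_entry j l i Ox).
  by field.
have -> : \sum_l H j l * (invmx (h x))^T l k = (H *m (invmx (h x))^T) j k.
  by rewrite mxE.
rewrite invh // !trmx_mul trmxK trmx_inv eta_sym /H -!mulmxA.
by rewrite (mulmxA (F x)^T) -trmx_mul EF // trmx1 mul1mx (mulmxA eta) mulmxV // mul1mx.
Qed.

Lemma christoffel_frameC k i j x : O x ->
  christoffel h k i j x = (G j x *m E x) i k.
Proof.
move=> Ox; rewrite christoffel_frame //.
have H : row j (G i x *m E x) = row i (G j x *m E x).
  by rewrite !row_mul torsionA.
by move/rowP/(_ k): H; rewrite !mxE.
Qed.

(** The commutator of the covariant derivatives along the k-th and j-th coordinate fields. The
    products are in reversed order because matrices act on rows from the right. *)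
Definition frame_curvature k j x :=
  partial_mx k (A j) x - partial_mx j (A k) x + A j x *m A k x - A k x *m A j x.

(** Curvature is tensorial under the change of gauge F. Both sides are compared after multiplication
    by F on the right: differentiating Gam F = G gives the derivatives of Gam without
    differentiating E. *)
Lemma curvature_gauge k j x : O x ->
  let Gam i y := G i y *m E y in
  partial_mx k (Gam j) x - partial_mx j (Gam k) x
    + Gam j x *m Gam k x - Gam k x *m Gam j x =
  F x *m frame_curvature k j x *m E x.
Proof.
move=> Ox Gam.
have sG i : smooth_mx O (G i).
  by apply: smooth_mxD => //; [exact: smooth_partial_mx|exact: smooth_mxM].
have sGam i : smooth_mx O (Gam i) by apply: smooth_mxM.
have GamF i y : O y -> Gam i y *m F y = G i y.
  by move=> Oy; rewrite /Gam -mulmxA EF // mulmx1.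
have dGam i l : partial_mx i (Gam l) x *m F x =
    partial_mx i (partial_mx l F) x + partial_mx i F x *m A l x
    + F x *m partial_mx i (A l) x - Gam l x *m partial_mx i F x.
  have H := partial_mxM i oO (sGam l) sF Ox.
  rewrite (partial_mx_ext _ oO (GamF l) Ox) /G in H.
  rewrite (partial_mxD _ oO (smooth_partial_mx l oO sF) (smooth_mxM oO sF (sA l)) Ox) in H.
  rewrite (partial_mxM _ oO sF (sA l) Ox) addrA in H.
  by rewrite H addrK.
set M := (X in X = _).
suff MF : M *m F x = F x *m frame_curvature k j x.
  by rewrite -MF -mulmxA FE // mulmx1.
rewrite /M /frame_curvature !mulmxDl !mulNmx (dGam k j) (dGam j k).
rewrite -(mulmxA _ (Gam k x)) -(mulmxA _ (Gam j x)) !GamF //.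
rewrite (partial_mx_comm k j oO sF Ox).
have GE i l : Gam i x *m G l x = Gam i x *m partial_mx l F x +
    (partial_mx i F x *m A l x + F x *m (A i x *m A l x)).
  rewrite -[G l x]/(partial_mx l F x + F x *m A l x) mulmxDr; congr (_ + _).
  by rewrite mulmxA GamF // /G mulmxDl -mulmxA.
rewrite !GE !(mulmxDr, mulmxN).
move: (partial_mx j (partial_mx k F) x) (partial_mx k F x *m A j x)
  (F x *m partial_mx k (A j) x) (Gam j x *m partial_mx k F x)
  (partial_mx j F x *m A k x) (F x *m partial_mx j (A k) x)
  (Gam k x *m partial_mx j F x) (F x *m (A j x *m A k x))
  (F x *m (A k x *m A j x)) => a b c d e f g p q.
apply/matrixP => r s; rewrite !mxE; ring.
Qed.

(** Each Christoffel symbol is written in one of the two forms given by its symmetry, so that the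
    quadratic terms of [ricci] become products of connection matrices. *)
Lemma ricci_frame i j x : O x ->
  ricci h x i j = \sum_k (F x *m frame_curvature k j x *m E x) i k.
Proof.
move=> Ox; rewrite mxE; apply: eq_bigr => k _; rewrite -curvature_gauge //.
pose Gam i y := G i y *m E y.
have dC a b c d : partial a (christoffel h b c d) x = partial_mx a (Gam d) x c b.
  rewrite partial_mxE; apply: (partial_ext _ oO) => // y Oy.
  exact: christoffel_frameC.
rewrite !dC; symmetry.
rewrite -/(Gam j) -/(Gam k) -/(Gam j x) -/(Gam k x).
transitivity (partial_mx k (Gam j) x i k - partial_mx j (Gam k) x i k +
  ((Gam j x *m Gam k x) i k - (Gam k x *m Gam j x) i k)).
  by move: (partial_mx _ _ x) (partial_mx _ _ x) (Gam j x *m _) (Gam k x *m _) =>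
    a b c d; rewrite !mxE addrA.
congr (_ + _).
have -> : (Gam j x *m Gam k x) i k = \sum_l Gam j x i l * Gam k x l k by rewrite mxE.
have -> : (Gam k x *m Gam j x) i k = \sum_l Gam k x i l * Gam j x l k by rewrite mxE.
rewrite -sumrB; apply: eq_bigr => l _.
rewrite (christoffel_frame k k l Ox) (christoffel_frameC l i j Ox).
rewrite (christoffel_frame k j l Ox) (christoffel_frameC l i k Ox).
by rewrite /Gam; ring.
Qed.

End Cartan.

(** * Conformal changes along a central null direction *)

Section MetricAlgebra.
Context {R : realType} {n : nat}.
Local Notation V := 'rV[R]_n.
Variables (eta : 'M[R]_n) (AD : {linear V -> 'M[R]_n}).

(* [AD x] is the matrix of [ad x] acting on row vectors: [x, y] is [y *m AD x]. *)
Record metric_algebra : Prop := MetricAlgebra {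
  eta_sym : eta^T = eta;
  eta_unit : eta \in unitmx;
  AD_anti : forall x y, x *m AD y = - (y *m AD x);
  AD_jacobi : forall x y, AD (y *m AD x) = AD y *m AD x - AD x *m AD y;
  AD_skew : forall x, AD x *m eta + eta *m (AD x)^T = 0
}.

Definition bform (x y : V) : R := (x *m eta *m y^T) 0 0.

Lemma bformE x y : x *m eta *m y^T = (bform x y)%:M.
Proof. by rewrite [LHS]mx11_scalar. Qed.

Hypothesis mA : metric_algebra.

Lemma bformC x y : bform x y = bform y x.
Proof.
rewrite /bform -[in LHS](trmxK (x *m eta *m y^T)) mxE !trmx_mul trmxK.
by rewrite (eta_sym mA) mulmxA.
Qed.

Lemma bformDr x y1 y2 : bform x (y1 + y2) = bform x y1 + bform x y2.
Proof. by rewrite /bform linearD mulmxDr mxE. Qed.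

Lemma bformZr x a y : bform x (a *: y) = a * bform x y.
Proof. by rewrite /bform linearZ /= -scalemxAr mxE. Qed.

Lemma bformDl x1 x2 y : bform (x1 + x2) y = bform x1 y + bform x2 y.
Proof. by rewrite /bform !mulmxDl mxE. Qed.

Lemma bformZl a x y : bform (a *: x) y = a * bform x y.
Proof. by rewrite /bform -!scalemxAl mxE. Qed.

Lemma bformNl x y : bform (- x) y = - bform x y.
Proof. by rewrite -scaleN1r bformZl mulN1r. Qed.

Lemma bformNr x y : bform x (- y) = - bform x y.
Proof. by rewrite bformC bformNl bformC. Qed.

Lemma bform0l y : bform 0 y = 0.
Proof. by rewrite /bform !mul0mx mxE. Qed.

Lemma bform0r y : bform y 0 = 0.
Proof. by rewrite bformC bform0l. Qed.

Lemma bform_skew x y w : bform (x *m AD w) y = - bform x (y *m AD w).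
Proof.
rewrite /bform trmx_mul; have H := AD_skew mA w.
rewrite -(mulmxA x (AD w)); have -> : AD w *m eta = - (eta *m (AD w)^T).
  by apply/eqP; rewrite -addr_eq0 H.
by rewrite mulmxN mulNmx mxE !mulmxA.
Qed.

Definition central z := AD z = 0.

Lemma central_mul z x : central z -> z *m AD x = 0.
Proof. by move=> cz; rewrite (AD_anti mA) cz mulmx0 oppr0. Qed.

Lemma central_orth z x y : central z -> bform (x *m AD y) z = 0.
Proof. by move=> cz; rewrite bform_skew central_mul // bform0r oppr0. Qed.

(** The skew endomorphism z ^ x, by which a conformal change along z modifies the Levi-Civita
    connection. *)
Definition wedge (z x : V) : 'M[R]_n := eta *m z^T *m x - eta *m x^T *m z.

Lemma mul_wedge z x v : v *m wedge z x = bform v z *: x - bform v x *: z.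
Proof.
by rewrite /wedge mulmxBr !mulmxA !bformE !mul_scalar_mx.
Qed.

Lemma wedge_is_linear z : linear (wedge z).
Proof.
move=> a x y; rewrite /wedge.
have -> : (a *: x + y)^T = a *: x^T + y^T by rewrite linearD linearZ.
rewrite !mulmxDr mulmxDl -!scalemxAr -scalemxAl.
by rewrite opprD addrACA scalerBr.
Qed.
HB.instance Definition _ z := GRing.isLinear.Build R _ _ _ (wedge z) (wedge_is_linear z).

Lemma wedge_skew z x : wedge z x *m eta + eta *m (wedge z x)^T = 0.
Proof.
rewrite /wedge linearB /= !trmx_mul !trmxK (eta_sym mA) mulmxBl mulmxBr !mulmxA.
by rewrite subrKA subrr.
Qed.

Lemma eq_mulmx (M N : 'M[R]_n) : (forall v : V, v *m M = v *m N) -> M = N.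
Proof. by move=> H; apply/row_matrixP => i; rewrite !rowE. Qed.

(* The Levi-Civita connection along x of the bi-invariant metric scaled by
   exp(2 phi), in a left-invariant frame scaled by exp(phi), if d phi = T <z, .>. *)
Definition conn z (T : R) x := 2^-1 *: AD x + T *: wedge z x.

(** As z is central and ad is skew, [wedge z] is equivariant under ad. The commutators of ad x with
    z ^ y and of ad y with z ^ x contribute equally, hence the factor 2. *)
Lemma wedge_bracket z x y : central z ->
  AD y *m wedge z x + wedge z y *m AD x - AD x *m wedge z y - wedge z x *m AD y =
  2 *: wedge z (y *m AD x).
Proof.
move=> cz; have := mul_wedge z; move: (wedge z : V -> 'M[R]_n) => w wE.
apply: eq_mulmx => v; rewrite -scalemxAr !(mulmxDr, mulmxN) !mulmxA !wE.
rewrite !(central_orth _ _ cz) !(mulmxDl, mulNmx) -!scalemxAl !(central_mul _ cz).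
rewrite !bform_skew (AD_anti mA x y) bformNr opprK !scaler0 !scale0r !subr0 !sub0r.
by apply/matrixP => i j; rewrite !mxE; ring.
Qed.

(** In general the commutator has a further term <z, z> times x ^ y, up to sign. *)
Lemma wedge_wedge z x y : bform z z = 0 ->
  wedge z y *m wedge z x - wedge z x *m wedge z y =
  bform y z *: wedge z x - bform x z *: wedge z y.
Proof.
move=> zz; have := mul_wedge z; move: (wedge z : V -> 'M[R]_n) => w wE.
apply: eq_mulmx => v; rewrite !mulmxBr -!scalemxAr !mulmxA.
rewrite !wE !(bformDl, bformNl, bformZl) zz (bformC x y) (bformC z x) (bformC z y).
by apply/matrixP => i j; rewrite !mxE; ring.
Qed.

(** The first three terms are what differentiating the connection gives, with T' = kap + T^2 and
    derivatives of the coframe replaced by brackets. [wedge_bracket] cancels the terms linear in T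
    and [wedge_wedge] those in T^2; what remains is the curvature - ad [x, y] / 4 of the
    bi-invariant metric and a term in kap. *)
Lemma conn_curvature z T kap x y : central z -> bform z z = 0 ->
  - (2^-1 *: AD (y *m AD x))
  + (kap + T ^+ 2) *: (bform x z *: wedge z y - bform y z *: wedge z x)
  - T *: wedge z (y *m AD x)
  + (conn z T y *m conn z T x - conn z T x *m conn z T y) =
  - (4^-1 *: AD (y *m AD x))
  + kap *: (bform x z *: wedge z y - bform y z *: wedge z x).
Proof.
move=> cz zz; have H1 := wedge_bracket x y cz; have H2 := wedge_wedge x y zz.
have H3 := AD_jacobi mA x y.
rewrite /conn !mulmxDl !mulmxDr -!scalemxAl -!scalemxAr !scalerA.
move: H1 H2 H3.
move: (wedge z y) (wedge z x) (wedge z (y *m AD x)) (AD (y *m AD x)) => wy wx wp ap.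
move: (wy *m wx) (wx *m wy) (AD y *m wx) (wy *m AD x) (AD x *m wy) (wx *m AD y)
  (AD y *m AD x) (AD x *m AD y) => a b c d e f g p.
move: (bform x z) (bform y z) => tx ty H1 H2 H3.
apply/matrixP => i j; move/matrixP/(_ i j): H1; move/matrixP/(_ i j): H2.
move/matrixP/(_ i j): H3; rewrite !mxE => H3 H2 H1.
have Hc : c i j = 2 * wp i j - d i j + e i j + f i j by lra.
have Ha : a i j = b i j + ty * wx i j - tx * wy i j by lra.
by rewrite H3 Hc Ha; field.
Qed.

End MetricAlgebra.

(** Bootstrapping for functions whose derivative involves the function itself, such as the
    exponential and the Riccati solution. *)
Lemma smooth_of_derive (R : realType) (V : normedModType R) (O : set V) (g : V -> R)
    (P : V -> V -> R) : open O ->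
  (forall x, O x -> {for x, continuous g}) ->
  (forall x v, O x -> is_derive x v g (P v x)) ->
  (forall k v, Ck k O g -> Ck k O (P v)) -> smooth_on O g.
Proof.
move=> oO gc gd gP; elim => [|k IH]; first by split.
split => // v; split; first by move=> x Ox; have [] := gd x v Ox.
by apply: Ck_ext oO _ (gP k v IH) => x Ox; have [_ ->] := gd x v Ox.
Qed.

Lemma smooth_expR (R : realType) (V : normedModType R) (O : set V) (f : V -> R) :
  open O -> smooth_on O f -> smooth_on O (fun x => expR (f x)).
Proof.
move=> oO sf.
apply: (@smooth_of_derive _ _ _ _ (fun v x => expR (f x) * 'D_v f x)) => //.
- move=> x Ox; apply: (@continuous_comp _ _ _ f expR).
    exact: smooth_continuous sf Ox.
  exact: continuous_expR.
- move=> x v Ox; apply: derive_comp1; exact: smooth_derivable sf Ox.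
- by move=> k v Ek; apply: CkM => //; exact: smooth_derive.
Qed.

(** * The Ricci tensor of the conformally changed metric *)

Section ConformalFrame.
Context {R : realType} {n : nat}.
Local Notation V := 'rV[R]_n.
Variables (eta : 'M[R]_n) (AD : {linear V -> 'M[R]_n}).
Hypothesis mA : metric_algebra eta AD.
Variables (O : set V) (F E : V -> 'M[R]_n) (h : V -> 'M[R]_n).
Hypotheses (oO : open O) (sF : smooth_mx O F) (sE : smooth_mx O E).
Hypothesis FE : forall x, O x -> F x *m E x = 1%:M.
Hypothesis hE : forall x, O x -> h x = F x *m eta *m (F x)^T.
Hypothesis maurer_cartan : forall i j x, O x ->
  row j (partial_mx i F x) - row i (partial_mx j F x) =
  - (row j (F x) *m AD (row i (F x))).
Variables (z : V) (phi T : V -> R) (kap : R).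
Hypotheses (cz : central AD z) (zz : bform eta z z = 0).
Hypotheses (sphi : smooth_on O phi) (sT : smooth_on O T).
Hypothesis dphi : forall i x, O x ->
  partial i phi x = T x * bform eta (row i (F x)) z.
Hypothesis dT : forall i x, O x ->
  partial i T x = (kap + T x ^+ 2) * bform eta (row i (F x)) z.

Let ef x := expR (phi x).
Let ef' x := expR (- phi x).
Let F' x := ef x *: F x.
Let E' x := ef' x *: E x.
Let h' x := expR (2 * phi x) *: h x.
Let A i x := conn eta AD z (T x) (row i (F x)).

Let sef : smooth_on O ef. Proof. exact: smooth_expR. Qed.
Let sef' : smooth_on O ef'.
Proof. by apply: (@smooth_expR _ _ _ (fun x => - phi x)) => //; exact: smoothN. Qed.

Let efef x : ef x * ef' x = 1. Proof. by rewrite /ef /ef' -expRD subrr expR0. Qed.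

Let AD_row_linear i : linear (fun M : 'M[R]_n => AD (row i M)).
Proof. by move=> a M N; rewrite !linearP. Qed.
Let AD_row i : {linear 'M[R]_n -> 'M[R]_n} :=
  HB.pack (fun M : 'M[R]_n => AD (row i M))
    (GRing.isLinear.Build _ _ _ _ _ (AD_row_linear i)).

Let wedge_row_linear i : linear (fun M : 'M[R]_n => wedge eta z (row i M)).
Proof. by move=> a M N; rewrite linearP wedge_is_linear. Qed.
Let wedge_row i : {linear 'M[R]_n -> 'M[R]_n} :=
  HB.pack (fun M : 'M[R]_n => wedge eta z (row i M))
    (GRing.isLinear.Build _ _ _ _ _ (wedge_row_linear i)).

Let sAD i : smooth_mx O (fun x => 2^-1 *: AD_row i (F x)).
Proof.
apply: smooth_mxZ => //; first exact: smooth_cst.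
exact: smooth_mx_linear.
Qed.

Let sW i : smooth_mx O (fun x => T x *: wedge_row i (F x)).
Proof. by apply: smooth_mxZ => //; exact: smooth_mx_linear. Qed.

Let sA i : smooth_mx O (A i).
Proof. exact: (smooth_mxD oO (sAD i) (sW i)). Qed.

Let dA k i x : O x -> partial_mx k (A i) x =
  2^-1 *: AD (row i (partial_mx k F x))
  + ((kap + T x ^+ 2) * bform eta (row k (F x)) z) *: wedge eta z (row i (F x))
  + T x *: wedge eta z (row i (partial_mx k F x)).
Proof.
move=> Ox; have H := partial_mxD k oO (sAD i) (sW i) Ox.
apply: (etrans H); rewrite -addrA; congr (_ + _).
  have -> := partial_mxZ k oO (smooth_cst O 2^-1) (smooth_mx_linear (AD_row i) oO sF) Ox.
  by rewrite partial_cst scale0r add0r (partial_mx_linear _ _ oO sF Ox).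
have -> := partial_mxZ k oO sT (smooth_mx_linear (wedge_row i) oO sF) Ox.
by rewrite dT // (partial_mx_linear _ _ oO sF Ox).
Qed.

Let curvA k j x : O x -> frame_curvature A k j x =
  - (4^-1 *: AD (row j (F x) *m AD (row k (F x))))
  + kap *: (bform eta (row k (F x)) z *: wedge eta z (row j (F x))
            - bform eta (row j (F x)) z *: wedge eta z (row k (F x))).
Proof.
move=> Ox; rewrite -(conn_curvature mA (T x) _ _ _ cz zz) /frame_curvature -addrA.
congr (_ + _); rewrite !dA //.
have -> : row j (F x) *m AD (row k (F x)) =
    row k (partial_mx j F x) - row j (partial_mx k F x).
  by rewrite -[LHS]opprK -maurer_cartan // opprB.
have wB a b : wedge eta z (a - b) = wedge eta z a - wedge eta z b.
  exact: (linearB (wedge eta z)).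
rewrite (linearB AD) wB.
move: (AD (row k (partial_mx j F x))) (AD (row j (partial_mx k F x)))
  (wedge eta z (row k (partial_mx j F x))) (wedge eta z (row j (partial_mx k F x)))
  (wedge eta z (row j (F x))) (wedge eta z (row k (F x))) => a b c d e f.
by apply/matrixP => r s; rewrite !mxE; ring.
Qed.

Let skewA i x : O x -> A i x *m eta + eta *m (A i x)^T = 0.
Proof.
move=> _; rewrite /A /conn; move: (row i (F x)) (T x) => v a.
have -> : (2^-1 *: AD v + a *: wedge eta z v)^T =
    2^-1 *: (AD v)^T + a *: (wedge eta z v)^T.
  by apply/matrixP => k l; rewrite !mxE.
rewrite mulmxDl mulmxDr -!scalemxAl -!scalemxAr.
by rewrite addrACA -!scalerDr (AD_skew mA) (wedge_skew mA) !scaler0 addr0.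
Qed.

Let dF' i x : O x -> partial_mx i F' x =
  ef x *: ((T x * bform eta (row i (F x)) z) *: F x + partial_mx i F x).
Proof.
move=> Ox; rewrite (partial_mxZ i oO sef sF Ox) scalerDr scalerA; congr (_ *: _ + _).
rewrite -dphi //.
have := derive_comp1 (is_derive_expR (phi x))
  (@smooth_derivable _ _ _ _ _ _ (delta_mx 0 i) sphi Ox).
by case=> _; exact.
Qed.

(** Half of ad accounts for the Maurer-Cartan defect of the coframe, and the term in [wedge]
    symmetrizes the one from differentiating exp(phi). *)
Let torsionA i j x : O x ->
  row j (partial_mx i F' x + F' x *m A i x) = row i (partial_mx j F' x + F' x *m A j x).
Proof.
move=> Ox; rewrite (dF' i Ox) (dF' j Ox) /F'.
have rE l (a b : R) (M N P : 'M[R]_n) : row l (a *: (b *: M + N) + a *: M *m P) =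
    a *: (b *: row l M + row l N + row l M *m P).
  by rewrite -row_mul -scalemxAl; apply/rowP => k; rewrite !mxE -mulrDr.
rewrite !rE; congr (_ *: _).
rewrite /A /conn !(mulmxDr (row _ _)) -!scalemxAr !mul_wedge.
have MC := maurer_cartan i j Ox.
have H1 : row j (partial_mx i F x) = row i (partial_mx j F x)
    - row j (F x) *m AD (row i (F x)) by rewrite -MC addrC subrK.
rewrite H1 (AD_anti mA (row i (F x))) (bformC mA (row i (F x)) (row j (F x))).
by apply/rowP => k; rewrite !mxE; field.
Qed.

Let F'E' x : O x -> F' x *m E' x = 1%:M.
Proof.
by move=> Ox; rewrite /F' /E' -scalemxAl -scalemxAr scalerA efef FE // scale1r.
Qed.

Let h'E x : O x -> h' x = F' x *m eta *m (F' x)^T.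
Proof.
move=> Ox; rewrite /h' hE // /F' linearZ /= -!scalemxAl -scalemxAr scalerA.
by rewrite -expRD -mulr2n mulr_natl.
Qed.

Lemma ricci_conformal i j x : O x -> ricci h' x i j =
  - 4^-1 * \tr (AD (row j (F x)) *m AD (row i (F x)))
  - kap * (n%:R - 2) * bform eta (row i (F x)) z * bform eta (row j (F x)) z.
Proof.
move=> Ox.
rewrite (ricci_frame oO (smooth_mxZ oO sef sF) (smooth_mxZ oO sef' sE) sA F'E'
  (eta_sym mA) (eta_unit mA) h'E skewA torsionA) //.
set y := row j (F x); set v := row i (F x).
(* M is the map w |-> R(w, y) v, the curvature as an operator on its first argument; its trace is
   the Ricci tensor, and the trace n of the identity becomes the factor n - 2. *)
pose M := - 4^-1 *: (AD y *m AD v) + kap *: (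
  eta *m z^T *m (bform eta v z *: y - bform eta v y *: z)
  - bform eta y z *: (bform eta v z *: 1%:M - eta *m v^T *m z)).
have key k : v *m frame_curvature A k j x = row k (F x) *m M.
  rewrite (curvA k j Ox).
  move: (mul_wedge eta z) (row k (F x)) => wE w; rewrite -/y.
  move: (wedge eta z : V -> 'M[R]_n) wE => W wE.
  have dist (a b c : R) (P Q S : 'M[R]_n) :
      v *m (- (a *: P) + kap *: (b *: Q - c *: S)) =
      - (a *: (v *m P)) + kap *: (b *: (v *m Q) - c *: (v *m S)).
    by rewrite mulmxDr mulmxN -!scalemxAr mulmxBr -!scalemxAr.
  rewrite dist !wE.
  have -> : v *m AD (y *m AD w) = w *m AD y *m AD v.
    by rewrite (AD_anti mA) (AD_anti mA y) mulNmx opprK.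
  have -> : w *m M = - 4^-1 *: (w *m AD y *m AD v) + kap *: (
      bform eta w z *: (bform eta v z *: y - bform eta v y *: z)
      - bform eta y z *: (bform eta v z *: w - bform eta w v *: z)).
    rewrite /M mulmxDr -!scalemxAr mulmxA; congr (_ + _ *: _).
    rewrite (mulmxBr w) mulmxA -scalemxAr (mulmxBr w) -scalemxAr mulmx1 !mulmxA !bformE.
    by rewrite !mul_scalar_mx.
  rewrite (bformC mA v w).
  by apply/rowP => l; rewrite !mxE; ring.
transitivity (\tr (F x *m M *m E x)).
  apply: eq_bigr => k _; rewrite /F' /E' -!scalemxAl -scalemxAr scalerA efef scale1r.
  have -> : (F x *m frame_curvature A k j x *m E x) i k =
      (v *m frame_curvature A k j x *m E x) 0 k.
    by rewrite /v -!row_mul [RHS]mxE.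
  by rewrite key -!row_mul [LHS]mxE.
rewrite mxtrace_mulC mulmxA (mulmx1C (FE Ox)) mul1mx /M.
have tr1 (u1 u2 : V) : \tr (eta *m u1^T *m u2) = bform eta u2 u1.
  by rewrite mxtrace_mulC mulmxA bformE mxtrace_scalar mulr1n.
rewrite mxtraceD !mxtraceZ mxtraceD tr1 linearN /= mxtraceZ linearB /= mxtraceZ tr1.
rewrite mxtrace1 bformDl // bformNl bformZl // bformZl // zz (bformC mA z v) /v /y.
by ring.
Qed.

End ConformalFrame.

(** For kap <= 0 a constant T = k with k^2 = - kap is enough. For kap > 0 the solution T = k tan(k
    s) blows up; since pi / 2 >= 1, it is defined for |s| < 1 / k. *)
Lemma riccati_solution (R : realType) (kap : R) :
  exists f T : R -> R, exists2 e : R, 0 < e & forall s : R, `|s| < e ->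
    is_derive s 1 f (T s) /\ is_derive s 1 T (kap + T s ^+ 2).
Proof.
have [k0|k0] := leP kap 0.
  pose k := Num.sqrt (- kap).
  have kk : kap + k ^+ 2 = 0 by rewrite sqr_sqrtr ?oppr_ge0 // addrN.
  exists (fun s => k * s), (fun=> k), 1 => // s _; split.
    have := is_derive_mull k (is_derive_id s (1 : R)).
    by rewrite mulr1.
  by rewrite kk; exact: is_derive_cst.
pose k := Num.sqrt kap.
have kk : k ^+ 2 = kap by rewrite sqr_sqrtr // ltW.
have k1 : 0 < k by rewrite sqrtr_gt0.
exists (fun s => - ln (cos (k * s))), (fun s => k * tan (k * s)), (k^-1).
  by rewrite invr_gt0.
move=> s se.
have ks : `|k * s| < 1 by rewrite normrM gtr0_norm // -ltr_pdivlMl // mulr1.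
have c0 : 0 < cos (k * s).
  apply: cos_gt0_pihalf; move: ks; rewrite ltr_norml => /andP[ks1 ks2].
  have pi1 : 1 <= pi / 2 :> R by rewrite pihalf_ge1.
  by apply/andP; split; lra.
have dk : is_derive s 1 (fun s : R => k * s) k.
  by have := is_derive_mull k (is_derive_id s (1 : R)); rewrite mulr1.
split.
  have H1 := derive_comp1 (is_derive_cos (k * s)) (@ex_derive _ _ _ _ _ _ _ dk).
  have H2 := derive_comp1 (is_derive1_ln c0) (@ex_derive _ _ _ _ _ _ _ H1).
  have H3 := is_deriveN H2.
  apply: is_derive_eq H3 _.
  have [_ ->] := H1; have [_ ->] := dk.
  rewrite /tan; move: (cos (k * s)) (sin (k * s)) c0 => c d c0.
  by field; rewrite gt_eqF.
have H1 := derive_comp1 (is_derive_tan (lt0r_neq0 c0)) (@ex_derive _ _ _ _ _ _ _ dk).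
have H2 := is_derive_mull k H1.
apply: is_derive_eq H2 _.
have [_ ->] := dk; rewrite exprMn kk -{1}kk.
have := cos2Dsin2 (k * s).
rewrite /tan; move: (cos (k * s)) (sin (k * s)) c0 => c d c0 cd.
have c1 : c != 0 by rewrite gt_eqF.
rewrite -kk; transitivity (k ^+ 2 * (c ^+ 2 + d ^+ 2) / c ^+ 2); last by field.
by rewrite cd; field.
Qed.

(** * Left-invariant frames on a Lie group *)

Section Coordinates.
Context {R : realType}.
Variables (g : metricLieAlgebra R) (n : nat).
Variables (eta : 'M[R]_n) (AD : {linear 'rV[R]_n -> 'M[R]_n}).
Variables (iota : 'rV[R]_n -> g) (coord : g -> 'rV[R]_n).

(** A choice of basis of g: [AD] carries the structure constants and [eta] is the Gram matrix. *)
Record coordinates : Prop := Coordinates {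
  coord_linear : linear coord;
  iota_linear : linear iota;
  iotaK : cancel iota coord;
  coordK : cancel coord iota;
  iota_bracket : forall x v, iota (v *m AD x) = mla_bracket (iota x) (iota v);
  iota_form : forall x y, bform eta x y = mla_form (iota x) (iota y)
}.

Hypothesis co : coordinates.

Let iota_inj : injective iota. Proof. exact: can_inj (iotaK co). Qed.

Lemma iota_add x y : iota (x + y) = iota x + iota y.
Proof. by have := iota_linear co 1 x y; rewrite !scale1r. Qed.

Lemma iota_zero : iota 0 = 0.
Proof.
have := iota_add 0 0; rewrite addr0 => /eqP.
by rewrite -subr_eq0 opprD addNKr oppr_eq0 => /eqP.
Qed.

Lemma iota_scale a x : iota (a *: x) = a *: iota x.
Proof. by have := iota_linear co a x 0; rewrite iota_zero !addr0. Qed.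

Lemma iota_opp x : iota (- x) = - iota x.
Proof. by rewrite -scaleN1r iota_scale scaleN1r. Qed.

Lemma mla_bracketDl (a b c : g) :
  mla_bracket (a + b) c = mla_bracket a c + mla_bracket b c.
Proof. by have := bracket_linearl c 1 a b; rewrite /= !scale1r. Qed.

Lemma mla_bracketDr (a b c : g) :
  mla_bracket c (a + b) = mla_bracket c a + mla_bracket c b.
Proof. by have := bracket_linearr c 1 a b; rewrite /= !scale1r. Qed.

Lemma mla_bracketC (x y : g) : mla_bracket x y = - mla_bracket y x.
Proof.
have := bracket_alt (x + y).
rewrite mla_bracketDl !mla_bracketDr !bracket_alt add0r addr0 => /eqP.
by rewrite addr_eq0 => /eqP.
Qed.

Lemma mla_bracketNr (x y : g) : mla_bracket x (- y) = - mla_bracket x y.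
Proof.
have b0 : mla_bracket x 0 = 0.
  have := mla_bracketDr 0 0 x; rewrite addr0 => /eqP.
  by rewrite -subr_eq0 opprD addNKr oppr_eq0 => /eqP.
by apply/eqP; rewrite -addr_eq0 -mla_bracketDr addNr b0.
Qed.

Lemma coordinates_metric_algebra : metric_algebra eta AD.
Proof.
have bE x y : bform eta x y = (x *m eta *m y^T) 0 0 by [].
have E k l : eta k l = bform eta (delta_mx 0 k) (delta_mx 0 l).
  by rewrite /bform trmx_delta -rowE -colE !mxE.
have esym : eta^T = eta.
  by apply/matrixP => i j; rewrite mxE !E !(iota_form co) form_sym.
split => //.
- rewrite -row_free_unit; apply: inj_row_free => v v0; apply: iota_inj.
  rewrite iota_zero; apply: form_nondeg => y.
  by rewrite -(coordK co y) -(iota_form co) /bform v0 mul0mx mxE.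
- move=> x y; apply: iota_inj.
  by rewrite iota_opp !(iota_bracket co) mla_bracketC.
- move=> x y; apply: eq_mulmx => v; apply: iota_inj.
  rewrite mulmxBr !mulmxA iota_add iota_opp !(iota_bracket co).
  have := bracket_jacobi (iota x) (iota y) (iota v).
  rewrite (mla_bracketC (iota v) (iota x)) mla_bracketNr.
  rewrite (mla_bracketC (iota v) (mla_bracket _ _)).
  by move/eqP; rewrite subr_eq0 => /eqP.
- move=> x; apply: eq_mulmx => v; rewrite mulmx0; apply/rowP => k.
  rewrite [RHS]mxE.
  have {1}-> : v *m (AD x *m eta + eta *m (AD x)^T) =
      v *m AD x *m eta + v *m eta *m (AD x)^T by rewrite mulmxDr !mulmxA.
  have entry (w : 'rV[R]_n) : w 0 k = (w *m (delta_mx 0 k : 'rV[R]_n)^T) 0 0.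
    by rewrite trmx_delta -colE mxE.
  have -> : (v *m AD x *m eta + v *m eta *m (AD x)^T) 0 k =
      bform eta (v *m AD x) (delta_mx 0 k) + bform eta v (delta_mx 0 k *m AD x).
    rewrite entry mulmxDl mxE /bform; congr (_ + _).
    by rewrite [in RHS]trmx_mul mulmxA.
  by rewrite !(iota_form co) !(iota_bracket co) form_ad_invariant.
Qed.
End Coordinates.

(** * Left-invariant frames in charts and the Maurer-Cartan equation *)

Section LocalFrame.
Context {R : realType} {n : nat}.
Local Notation V := 'rV[R]_n.

Lemma derive_mulmx_smooth O (E : V -> 'M[R]_n) (b w x : V) : open O ->
  smooth_mx O E -> O x ->
  'D_w (fun u => b *m E u) x = \sum_i w 0 i *: (b *m partial_mx i E x).
Proof.
move=> oO sE Ox.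
have sb : smooth_mx O (fun u => b *m E u).
  by apply: smooth_mxM => //; exact: smooth_mx_cst.
have db : derivable (fun u => b *m E u) x w.
  by apply/derivable_mxP => i j; exact: smooth_derivable (sb i j) Ox.
rewrite derive_mx //; apply/rowP => j; rewrite !mxE summxE.
rewrite (derive_partial w oO (sb 0 j) Ox); apply: eq_bigr => i _.
rewrite [RHS]mxE -partial_mxE; congr (_ * _).
by rewrite (partial_mxM i oO (smooth_mx_cst O b) sE Ox) partial_mx_cst mul0mx add0r.
Qed.

(** The bracket relation is used for the fields with constant frame components [row i (F x)] and
    [row j (F x)], which agree at x with coordinate fields; differentiating F E = 1 then trades
    derivatives of E for derivatives of F. *)
Lemma maurer_cartan_of_bracket O (AD : V -> 'M[R]_n) (E F : V -> 'M[R]_n) x :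
  open O -> smooth_mx O E -> smooth_mx O F ->
  (forall y, O y -> F y *m E y = 1%:M) -> O x ->
  (forall a b : V, b *m AD a *m E x =
    'D_(a *m E x) (fun u => b *m E u) x - 'D_(b *m E x) (fun u => a *m E u) x) ->
  forall i j, row j (partial_mx i F x) - row i (partial_mx j F x) =
    - (row j (F x) *m AD (row i (F x))).
Proof.
move=> oO sE sF FE Ox br i j.
have dE k l : row l (F x) *m partial_mx k E x = - (row l (partial_mx k F x) *m E x).
  have := partial_mxM k oO sF sE Ox.
  rewrite (partial_mx_ext _ oO FE Ox) partial_mx_cst => /eqP.
  rewrite eq_sym addr_eq0 => /eqP H.
  by rewrite -!row_mul H linearN opprK.
have De k l : 'D_(row k (F x) *m E x) (fun u => row l (F x) *m E u) x =
    row l (F x) *m partial_mx k E x.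
  rewrite (derive_mulmx_smooth _ _ oO sE Ox) -row_mul FE // row1.
  rewrite (bigD1 k) //= big1 ?addr0 => [|q qk]; first by rewrite mxE !eqxx scale1r.
  by rewrite mxE eqxx (negbTE qk) scale0r.
have := br (row i (F x)) (row j (F x)); rewrite !De !dE opprK => H.
apply: (row_free_inj (A := E x)).
  by rewrite row_free_unit; have [] := mulmx1_unit (FE _ Ox).
by rewrite mulNmx H mulmxBl opprD opprK.
Qed.

End LocalFrame.

Section LieGroupFrames.
Context {R : realType} (n : nat) (G : lieGroup R n) (g : metricLieAlgebra R).
Variables (L : g -> vfield G) (m : tensor2 G).
Hypotheses (HL : is_lie_algebra_of L) (Hm : is_semi_riemannian_metric m).
Hypotheses (Hbi : bi_invariant m) (Hext : metric_extends_form L m).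
Local Notation V := 'rV[R]_n.

Lemma gmulxV (x : G) : gmul x (ginv x) = gone G.
Proof.
rewrite -[LHS]gmul1 -[X in gmul X _](gmulV (ginv x)).
by rewrite -gmulA (gmulA (ginv x)) gmulV gmul1 gmulV.
Qed.

Lemma gmulx1 (x : G) : gmul x (gone G) = x.
Proof. by rewrite -(gmulV x) gmulA gmulxV gmul1. Qed.

(** Left translation by p carries the unit to p and preserves both the fields and the metric. *)
Lemma metric_left_invariant_fields c p x y : atlas c -> cdom c p ->
  tensor_eval m c p (L x c p) (L y c p) = mla_form x y.
Proof.
move=> ac cp; have [c0 a0 c01] := atlas_cover (gone G).
have cp1 : cdom c (gmul p (gone G)) by rewrite gmulx1.
have := (Hbi p).1 c0 c (gone G) (L x c0 (gone G)) (L y c0 (gone G)) a0 ac c01 cp1.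
rewrite -!(lie_left_invariant HL _ a0 ac c01 cp1) gmulx1 => ->.
exact: Hext.
Qed.

Lemma lie_coordinates : exists (eta : 'M[R]_n) (AD : {linear V -> 'M[R]_n})
  (iota : V -> g) (coord : g -> V), coordinates eta AD iota coord.
Proof.
have [c0 a0 c01] := atlas_cover (gone G).
pose coord (x : g) : V := L x c0 (gone G).
have coordl : linear coord by exact: (lie_linear HL a0 c01).
have [iota coordK iotaK] : bijective coord by exact: (lie_bijective HL a0 c01).
have iotal : linear iota.
  move=> a x y; apply: (can_inj coordK).
  by rewrite iotaK coordl !iotaK.
have brl x : linear (fun v => coord (mla_bracket (iota x) (iota v))).
  by move=> a u v; rewrite iotal (bracket_linearr (iota x) a) coordl.
pose f x : {linear V -> V} := HB.pack (fun v => coord (mla_bracket (iota x) (iota v)))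
  (GRing.isLinear.Build _ _ _ _ _ (brl x)).
pose AD0 x : 'M[R]_n := lin1_mx (f x).
have AD0l : linear AD0.
  move=> a x y; apply/matrixP => i j; rewrite !mxE /=.
  have -> : mla_bracket (iota (a *: x + y)) (iota (delta_mx 0 i)) =
     a *: mla_bracket (iota x) (iota (delta_mx 0 i))
     + mla_bracket (iota y) (iota (delta_mx 0 i)).
    by rewrite iotal; exact: (bracket_linearl (iota (delta_mx 0 i)) a).
  by rewrite coordl !mxE.
pose AD : {linear V -> 'M[R]_n} := HB.pack AD0 (GRing.isLinear.Build _ _ _ _ _ AD0l).
pose eta : 'M[R]_n := \matrix_(i, j) mla_form (iota (delta_mx 0 i)) (iota (delta_mx 0 j)).
have formZD (a : R) (x y w : g) : mla_form (a *: x + y) w = a * mla_form x w + mla_form y w.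
  by rewrite form_sym (form_linear w a) !(form_sym w).
have iota_sum (v : V) : iota v = \sum_i v 0 i *: iota (delta_mx 0 i).
  have i0 : iota 0 = 0.
    have := iotal 1 0 0; rewrite !scale1r addr0 => /eqP.
    by rewrite -subr_eq0 opprD addNKr oppr_eq0 => /eqP.
  rewrite {1}[v]row_sum_delta (big_morph iota (id1 := 0) (op1 := +%R)) //.
    apply: eq_bigr => i _; have := iotal (v 0 i) (delta_mx 0 i) 0.
    by rewrite i0 !addr0.
  by move=> x y; have := iotal 1 x y; rewrite !scale1r.
have form_sum (r : seq 'I_n) (a : 'I_n -> R) (e : 'I_n -> g) w :
    mla_form (\sum_(i <- r) a i *: e i) w = \sum_(i <- r) a i * mla_form (e i) w.
  elim: r => [|i r IH]; last by rewrite !big_cons formZD IH.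
  by rewrite !big_nil; have := formZD (-1) 0 0 w; rewrite scaler0 addr0; lra.
exists eta, AD, iota, coord; split => //.
- by move=> x v; apply: (can_inj coordK); rewrite iotaK (mul_rV_lin1 (f x)).
- move=> x y; rewrite (iota_sum x) form_sum /bform -mulmxA mxE.
  apply: eq_bigr => i _; congr (_ * _).
  rewrite form_sym (iota_sum y) form_sum mxE; apply: eq_bigr => j _.
  by rewrite !mxE form_sym mulrC.
Qed.

Variables (eta : 'M[R]_n) (AD : {linear V -> 'M[R]_n}).
Variables (iota : V -> g) (coord : g -> V).
Hypothesis co : coordinates eta AD iota coord.

(** The rows of E are the left-invariant fields of a basis in the chart c; the rows of F are the
    coordinate fields expressed in that basis. *)
Record chart_frame (c : chart R n G) (F E : V -> 'M[R]_n) : Prop := ChartFrame {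
  frame_smooth : smooth_mx (cmap c @` cdom c) F;
  coframe_smooth : smooth_mx (cmap c @` cdom c) E;
  frameK : forall u, (cmap c @` cdom c) u -> F u *m E u = 1%:M;
  frame_metric : forall u, (cmap c @` cdom c) u ->
    (m c \o cinv c) u = F u *m eta *m (F u)^T;
  frame_maurer_cartan : forall i j u, (cmap c @` cdom c) u ->
    row j (partial_mx i F u) - row i (partial_mx j F u) =
    - (row j (F u) *m AD (row i (F u)));
  frame_field : forall v p, cdom c p -> v *m E (cmap c p) = L (iota v) c p
}.

Lemma chart_frame_exists c : atlas c -> exists F E, chart_frame c F E.
Proof.
move=> ac; pose O := cmap c @` cdom c.
have oO : open O by exact: cim_open.
have mA := coordinates_metric_algebra co.
pose E u : 'M[R]_n := \matrix_(i, j) L (iota (delta_mx 0 i)) c (cinv c u) 0 j.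
have Ofield v p : cdom c p -> v *m E (cmap c p) = L (iota v) c p.
  move=> cp; pose ev v := L (iota v) c p.
  have evl : linear ev.
    by move=> a x y; rewrite /ev (iota_linear co) (lie_linear HL ac cp).
  pose f : {linear V -> V} := HB.pack ev (GRing.isLinear.Build _ _ _ _ _ evl).
  rewrite -[RHS]/(f v) -mul_rV_lin1; congr (_ *m _).
  by apply/matrixP => i j; rewrite !mxE /= cmapK.
have sE : smooth_mx O E.
  move=> i j.
  have := smooth_entry 0 j oO ((lie_vfield HL (iota (delta_mx 0 i))).2 c ac).
  by apply: smooth_ext oO _ => u _; rewrite mxE.
pose h := m c \o cinv c.
have sh : smooth_mx O h.
  by move=> i j; apply: smooth_entry => //; exact: metric_smooth.
(* F is the inverse of E, obtained from E h E^T = [eta]; in this form it is smooth without inverting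
   a matrix that varies with the point. *)
pose F u := h u *m (E u)^T *m invmx eta.
have sF : smooth_mx O F.
  apply: smooth_mxM => //; last exact: smooth_mx_cst.
  by apply: smooth_mxM => //; exact: smooth_mx_tr.
have EhE u : O u -> E u *m h u *m (E u)^T = eta.
  move=> [p cp <-]; have hE : h (cmap c p) = m c p by rewrite /h /= cmapK.
  apply/matrixP => i j.
  have -> : (E (cmap c p) *m h (cmap c p) *m (E (cmap c p))^T) i j =
      tensor_eval m c p (L (iota (delta_mx 0 i)) c p) (L (iota (delta_mx 0 j)) c p).
    rewrite -!Ofield // /tensor_eval hE trmx_mul.
    by rewrite -!rowE !mulmxA -!row_mul trmx_delta -colE !mxE.
  rewrite metric_left_invariant_fields // -(iota_form co) /bform.
  by rewrite trmx_delta -rowE -colE !mxE.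
have FE u : O u -> F u *m E u = 1%:M.
  move=> Ou; apply: mulmx1C; rewrite /F !mulmxA EhE // mulmxV //.
  exact: (eta_unit mA).
exists F, E; split => //.
- move=> u Ou; have EF := mulmx1C (FE _ Ou).
  rewrite -(EhE u Ou) !mulmxA FE // mul1mx -mulmxA -trmx_mul FE //.
  by rewrite trmx1 mulmx1.
- move=> i j u Ou; apply: (maurer_cartan_of_bracket oO sE sF FE Ou) => a b.
  have [p cp pu] := Ou.
  have near_field v : \near u, v *m E u = (L (iota v) c \o cinv c) u.
    have := open_nbhs_nbhs (conj oO Ou); apply: filterS => y [q cq <-].
    by rewrite Ofield //= cmapK.
  rewrite !(near_eq_derive _ (near_field _)) -pu !Ofield // (iota_bracket co).
  by rewrite (lie_bracket HL _ _ ac cp).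
Qed.

End LieGroupFrames.

(** All that the geometry requires of the algebra; 2 < n allows division by n - 2 when the Riccati
    constant is chosen. *)
Definition killing_condition (R : realType) n (eta : 'M[R]_n)
    (AD : {linear 'rV[R]_n -> 'M[R]_n}) :=
  (exists lam, forall x y, \tr (AD x *m AD y) = lam * bform eta x y) \/
  (exists z c, [/\ central AD z, bform eta z z = 0, (2 < n)%N &
     forall x y, \tr (AD x *m AD y) = c * bform eta x z * bform eta y z]).

(** * Local potentials and reduction to the Killing form *)

Section Potential.
Context {R : realType} (n : nat) (G : lieGroup R n) (g : metricLieAlgebra R).
Variables (L : g -> vfield G) (m : tensor2 G).
Hypotheses (HL : is_lie_algebra_of L) (Hm : is_semi_riemannian_metric m).
Hypotheses (Hbi : bi_invariant m) (Hext : metric_extends_form L m).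
Local Notation V := 'rV[R]_n.
Variables (eta : 'M[R]_n) (AD : {linear V -> 'M[R]_n}).
Variables (iota : V -> g) (coord : g -> V).
Hypothesis co : coordinates eta AD iota coord.

Let mA := coordinates_metric_algebra co.

(* The form dual to a central element is closed, so it has local primitives. *)
Lemma central_potential z p0 (e : R) : central AD z -> 0 < e ->
  exists (U : set G) (r : G -> R), [/\ open U, U p0, forall q, U q -> `|r q| < e &
    forall c F E, atlas c -> chart_frame L m eta AD iota c F E ->
      forall u v, (cmap c @` (cdom c `&` U)) u ->
      is_derive u v (r \o cinv c) (\sum_i v 0 i * bform eta (row i (F u)) z)].
Proof.
move=> cz e0.
have [d ad dp0] := atlas_cover p0.
have [Fd [Ed fd]] := chart_frame_exists HL Hm Hbi Hext co ad.
pose Od := cmap d @` cdom d; have oOd : open Od by exact: cim_open.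
have Od0 : Od (cmap d p0) by exists p0.
have /nbhs_ballP[d0 /= d00 dO] := open_nbhs_nbhs (conj oOd Od0).
pose th i u := bform eta (row i (Fd u)) z.
have [zc bE] : exists zc : 'cV[R]_n,
    forall M : V, bform eta M z = \sum_k M 0 k * zc k 0.
  by exists (eta *m z^T) => M; rewrite /bform -mulmxA mxE.
have sth i : smooth_on Od (th i).
  have S : smooth_on Od (fun u => \sum_k Fd u i k * zc k 0).
    apply: smooth_sum => // k _; apply: smoothM => //; last exact: smooth_cst.
    exact: (frame_smooth fd).
  by apply: smooth_ext oOd _ S => u _; rewrite /th bE; apply: eq_bigr => k _; rewrite mxE.
have dth i j u : Od u -> partial j (th i) u = bform eta (row i (partial_mx j Fd u)) z.
  move=> Ou; rewrite bE.
  transitivity (partial j (fun u => \sum_k zc k 0 * Fd u i k) u).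
    apply: (partial_ext _ oOd) => // y _; rewrite /th bE; apply: eq_bigr => k _.
    by rewrite mxE mulrC.
  rewrite (partial_sum _ _ oOd) //; last first.
    move=> k; apply: smoothM => //; first exact: smooth_cst.
    exact: (frame_smooth fd).
  apply: eq_bigr => k _; rewrite (partialMl _ _ (frame_smooth fd i k) Ou) mulrC.
  by rewrite [in RHS]mxE partial_mxE.
have [r r0 dr] : exists2 r : V -> R, r (cmap d p0) = 0 &
    forall x v, ball (cmap d p0) d0 x -> is_derive x v r (\sum_i v 0 i * th i x).
  apply: closed_form_primitive => [i|x i j xb].
    by apply: smooth_sub (sth i); exact: dO.
  have Ox := dO _ xb; rewrite (dth j i x Ox) (dth i j x Ox); apply/eqP; rewrite -subr_eq0.
  (* Closedness: by Maurer-Cartan the exterior derivative is a pairing of z with a bracket, and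
     brackets are orthogonal to central elements. *)
  rewrite -bformNl -bformDl (frame_maurer_cartan fd) // bformNl central_orth //.
  by rewrite oppr0.
have sr : smooth_on (ball (cmap d p0) d0) r.
  apply: (smooth_of_partials _ _ dr); first exact: ball_open.
  by move=> i; apply: smooth_sub (sth i); exact: dO.
(* The second condition keeps r in the interval where the Riccati solution exists. *)
pose W := [set x | ball (cmap d p0) d0 x /\ `|r x| < e].
have oW : open W.
  rewrite openE => x [xb xe]; rewrite /interior.
  have rc : {for x, continuous r} by exact: smooth_continuous sr xb.
  have e1 : 0 < (e - `|r x|) / 2 by rewrite divr_gt0 // subr_gt0.
  near=> y; split.
    by near: y; apply: open_nbhs_nbhs; split => //; exact: ball_open.
  have : `|r x - r y| <= (e - `|r x|) / 2.
    by near: y; exact: (continuous_dist r x).1 rc _ e1.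
  have := ler_normB (r x) (r x - r y); rewrite subKr.
  by move: xe; lra.
pose U := [set q | cdom d q /\ W (cmap d q)].
have oU : open U.
  rewrite openE => q [dq Wq]; rewrite /interior.
  have H1 : nbhs q (cdom d) by apply: open_nbhs_nbhs; split => //; exact: cdom_open.
  have H2 : nbhs q (cmap d @^-1` W).
    by apply: (cmap_continuous dq); apply: open_nbhs_nbhs.
  exact: filterI.
exists U, (r \o cmap d); split => //.
- by split => //; split; [exact: ballxx|rewrite r0 normr0].
- by move=> q [_ []].
move=> c F E ac fc u v [p [cp [dp [bp _]]] pu].
have pK : cinv c u = p by rewrite -pu cmapK.
have Ou : (cmap c @` (cdom c `&` cdom d)) u by exists p.
have dtau : derivable (cmap d \o cinv c) u v.
  exact: smooth_derivable (atlas_compatible ac ad) Ou.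
have bt : ball (cmap d p0) d0 ((cmap d \o cinv c) u) by rewrite /= pK.
have H := derive_chain (ball_open _ _) sr bt dtau.
have -> : r \o cmap d \o cinv c = r \o (cmap d \o cinv c) by [].
apply: is_derive_eq H _.
have [_ ->] := dr _ ('D_v (cmap d \o cinv c) u) bt.
have Oc : (cmap c @` cdom c) u by exists p.
have th_sum (w : V) (M : 'M[R]_n) :
    \sum_i w 0 i * bform eta (row i M) z = bform eta (w *m M) z.
  rewrite bE [RHS](eq_bigr (fun k => \sum_i w 0 i * M i k * zc k 0)); last first.
    by move=> k _; rewrite mxE mulr_suml.
  rewrite exchange_big /=; apply: eq_bigr => i _; rewrite bE mulr_sumr.
  by apply: eq_bigr => k _; rewrite mxE mulrA.
rewrite /th !th_sum; congr bform.
(* The frame components of the tangent vector v in the chart c. The field [L (iota a)] is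
   transported by the transition map, so they are also its components in the frame of the chart
   d. *)
pose a := v *m F u.
have aE : a *m E u = v by rewrite /a -mulmxA (frameK fc) // mulmx1.
have Lc : L (iota a) c p = v by rewrite -(frame_field fc) // pu aE.
have := (lie_vfield HL (iota a)).1 c d p ac ad cp dp; rewrite Lc.
rewrite -(frame_field fd) // /tangent_map pu => aEd.
have tE : (cmap d \o cinv c) u = cmap d p by rewrite /= pK.
rewrite tE -aEd -mulmxA (mulmx1C (frameK fd _)) ?mulmx1 //.
Unshelve. all: by end_near. Qed.

End Potential.

Lemma chart_image_open (R : realType) n (T : topologicalType) (c : chart R n T)
  (U : set T) : open U -> open (cmap c @` (cdom c `&` U)).
Proof.
move=> oU; rewrite openE => u [p [cp Up] pu]; rewrite /interior.
have Ou : (cmap c @` cdom c) u by exists p.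
have H1 : nbhs u (cmap c @` cdom c).
  by apply: open_nbhs_nbhs; split => //; exact: cim_open.
have H2 : nbhs u (cinv c @^-1` U).
  apply: (cinv_continuous Ou); apply: open_nbhs_nbhs; split => //.
  by rewrite -pu cmapK.
apply: filterS (filterI H1 H2) => y [[q cq qy] Uy].
by exists q => //; split => //; move: Uy; rewrite /= -qy cmapK.
Qed.

Theorem conformally_einstein_of_killing (R : realType) (g : metricLieAlgebra R) :
  (forall n (eta : 'M[R]_n) (AD : {linear 'rV[R]_n -> 'M[R]_n}) iota coord,
     @coordinates R g n eta AD iota coord -> killing_condition eta AD) ->
  conformally_einstein g.
Proof.
move=> HK n G L m _ HL Hm Hbi Hext p0.
have [eta [AD [iota [coord co]]]] := lie_coordinates HL.
have mA := coordinates_metric_algebra co.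
have mE c F E p i j : chart_frame L m eta AD iota c F E -> cdom c p ->
    m c p i j = bform eta (row i (F (cmap c p))) (row j (F (cmap c p))).
  move=> fc cp; have Ou : (cmap c @` cdom c) (cmap c p) by exists p.
  have := frame_metric fc Ou; rewrite /= cmapK // => ->.
  rewrite /bform -row_mul tr_row; move: (F _ *m eta) (F _)^T => A B.
  by rewrite !mxE; apply: eq_bigr => k _; rewrite !mxE.
have [[lam Hlam]|[z [c0 [cz zz n2 Hc]]]] := HK _ _ _ _ _ co.
  exists setT, (fun=> 0); split => //; first exact: openT.
    by move=> c ac; exact: smooth_cst.
  exists (- 4^-1 * lam) => c p ac cp _.
  have [F [E fc]] := chart_frame_exists HL Hm Hbi Hext co ac.
  have Ou : (cmap c @` cdom c) (cmap c p) by exists p.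
  apply/matrixP => i j.
  have d0 k (x : 'rV[R]_n) : partial k (fun=> 0) x = 0 by exact: partial_cst.
  (* The conformal formula is applied with z = 0, T = 0 and kap = 0, that is, with conformal factor
     1. *)
  transitivity (- 4^-1 * \tr (AD (row j (F (cmap c p))) *m AD (row i (F (cmap c p))))
      - 0 * (n%:R - 2) * bform eta (row i (F (cmap c p))) 0
        * bform eta (row j (F (cmap c p))) 0).
    have dphi k (x : 'rV[R]_n) : (cmap c @` cdom c) x ->
        partial k (fun=> 0) x = 0 * bform eta (row k (F x)) 0.
      by rewrite d0 mul0r.
    have dT k (x : 'rV[R]_n) : (cmap c @` cdom c) x ->
        partial k (fun=> 0) x = (0 + 0 ^+ 2) * bform eta (row k (F x)) 0.
      by rewrite d0 add0r expr0n /= mul0r.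
    exact: (ricci_conformal mA (@cim_open _ _ _ c) (frame_smooth fc) (coframe_smooth fc)
      (frameK fc) (frame_metric fc) (frame_maurer_cartan fc) (linear0 AD)
      (bform0l _ _) (smooth_cst _ 0) (smooth_cst _ 0) dphi dT i j Ou).
  rewrite Hlam !mul0r subr0 mulrA (bformC mA) mxE [in RHS]mxE.
  by rewrite (mE _ _ _ _ _ _ fc cp) mulr0 expR0 mul1r.
(* The solution of - c0 / 4 - kap (n - 2) = 0. *)
pose kap := - c0 / (4 * (n%:R - 2)) : R.
have [f [T [e e0 fT]]] := riccati_solution kap.
have [U [r [oU Up0 rU dr]]] :=
  central_potential HL Hm Hbi Hext co p0 cz e0.
pose Im (c : chart R n G) := cmap c @` (cdom c `&` U).
have oI (c : chart R n G) : open (Im c) by exact: chart_image_open.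
have sI (c : chart R n G) : Im c `<=` cmap c @` cdom c.
  by move=> u [p [cp _] pu]; exists p.
have rI (c : chart R n G) u : Im c u -> `|(r \o cinv c) u| < e.
  by move=> [p [cp Up] <-]; rewrite /= cmapK //; exact: rU.
have props c F E : atlas c -> chart_frame L m eta AD iota c F E ->
    [/\ smooth_on (Im c) (f \o (r \o cinv c)),
        smooth_on (Im c) (T \o (r \o cinv c)),
        forall i u, Im c u -> partial i (f \o (r \o cinv c)) u =
          (T \o (r \o cinv c)) u * bform eta (row i (F u)) z &
        forall i u, Im c u -> partial i (T \o (r \o cinv c)) u =
          (kap + (T \o (r \o cinv c)) u ^+ 2) * bform eta (row i (F u)) z].
  move=> ac fc; have drc := dr c F E ac fc.
  pose th i u := bform eta (row i (F u)) z.
  have sth i : smooth_on (Im c) (th i).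
    have S : smooth_on (Im c) (fun u => \sum_k F u i k * (eta *m z^T) k 0).
      apply: smooth_sum => // k _; apply: smoothM => //; last exact: smooth_cst.
      exact: smooth_sub (sI c) (frame_smooth fc i k).
    apply: smooth_ext (oI c) _ S => u _; rewrite /th /bform -mulmxA [RHS]mxE.
    by apply: eq_bigr => k _; rewrite [in RHS]mxE.
  have src : smooth_on (Im c) (r \o cinv c).
    exact: smooth_of_partials (oI c) sth drc.
  have rcd u v : Im c u -> derivable (r \o cinv c) u v.
    by move=> Iu; exact: smooth_derivable src Iu.
  have comp (q q' : R -> R) (u v : 'rV[R]_n) : (forall s : R, `|s| < e -> is_derive s 1 q (q' s)) ->
      Im c u -> is_derive u v (q \o (r \o cinv c))
        (q' ((r \o cinv c) u) * 'D_v (r \o cinv c) u).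
    by move=> qd Iu; apply: derive_comp1 (rcd u v Iu); apply: qd; exact: rI.
  have fd (s : R) : `|s| < e -> is_derive s 1 f (T s) by move=> /fT[].
  have Td (s : R) : `|s| < e -> is_derive s 1 T (kap + T s ^+ 2) by move=> /fT[].
  have cont (q q' : R -> R) (u : 'rV[R]_n) : (forall s : R, `|s| < e -> is_derive s 1 q (q' s)) ->
      Im c u -> {for u, continuous (q \o (r \o cinv c))}.
    move=> qd Iu; apply: (@continuous_comp _ _ _ (r \o cinv c) q).
      exact: smooth_continuous src Iu.
    apply: differentiable_continuous; apply/derivable1_diffP.
    by have [] := qd _ (rI c u Iu).
  have sD v : smooth_on (Im c) (fun u => 'D_v (r \o cinv c) u).
    exact: smooth_derive.
  have sTr : smooth_on (Im c) (T \o (r \o cinv c)).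
    apply: (@smooth_of_derive _ _ _ _ (fun v u =>
      (kap + T ((r \o cinv c) u) ^+ 2) * 'D_v (r \o cinv c) u)).
    - exact: oI.
    - by move=> u Iu; exact: cont Td Iu.
    - by move=> u v Iu; exact: (comp T (fun s => kap + T s ^+ 2) u v Td Iu).
    - move=> k v Ck_; apply: (CkM (oI c)); last exact: sD.
      by apply: (CkD (oI c)); [exact: Ck_cst|exact: (CkM (oI c))].
  split => //.
  - apply: (@smooth_of_derive _ _ _ _ (fun v u =>
      T ((r \o cinv c) u) * 'D_v (r \o cinv c) u)).
    + exact: oI.
    + by move=> u Iu; exact: cont fd Iu.
    + by move=> k v _; apply: (CkM (oI c)); [exact: sTr|exact: sD].
  - move=> i u Iu; rewrite /partial.
    have [_ ->] := comp _ _ u (delta_mx 0 i) fd Iu; congr (_ * _).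
    have [_ ->] := drc u (delta_mx 0 i) Iu.
    rewrite (bigD1 i) //= big1 ?addr0 => [|k ki]; first by rewrite mxE !eqxx mul1r.
    by rewrite mxE (negbTE ki) andbF mul0r.
  - move=> i u Iu; rewrite /partial.
    have [_ ->] := comp _ _ u (delta_mx 0 i) Td Iu; congr (_ * _).
    have [_ ->] := drc u (delta_mx 0 i) Iu.
    rewrite (bigD1 i) //= big1 ?addr0 => [|k ki]; first by rewrite mxE !eqxx mul1r.
    by rewrite mxE (negbTE ki) andbF mul0r.
exists U, (f \o r); split => //.
  move=> c ac; have [F [E fc]] := chart_frame_exists HL Hm Hbi Hext co ac.
  by have [] := props c F E ac fc.
exists 0 => c p ac cp Up; have [F [E fc]] := chart_frame_exists HL Hm Hbi Hext co ac.
have [sphi sT dphi dT] := props c F E ac fc.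
have Iu : Im c (cmap c p) by exists p.
rewrite scale0r; apply/matrixP => i j; rewrite [RHS]mxE.
transitivity (- 4^-1 * \tr (AD (row j (F (cmap c p))) *m AD (row i (F (cmap c p))))
      - kap * (n%:R - 2) * bform eta (row i (F (cmap c p))) z
        * bform eta (row j (F (cmap c p))) z).
  have subF (M : 'rV[R]_n -> 'M[R]_n) :
    smooth_mx (cmap c @` cdom c) M -> smooth_mx (Im c) M.
    by move=> sM a b; exact: smooth_sub (sI c) (sM a b).
  have FE u (Ou : Im c u) := frameK fc (sI c u Ou).
  have hE u (Ou : Im c u) := frame_metric fc (sI c u Ou).
  have MC k l u (Ou : Im c u) := frame_maurer_cartan fc k l (sI c u Ou).
  exact: (ricci_conformal mA (oI c) (subF _ (frame_smooth fc))
    (subF _ (coframe_smooth fc)) FE hE MC cz zz sphi sT dphi dT i j Iu).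
rewrite Hc /kap; have n20 : n%:R - 2 != 0 :> R.
  by rewrite subr_eq0 eqr_nat; apply: contraL n2 => /eqP ->.
by field.
Qed.

(** * Killing forms of oscillator algebras *)

Section NullReduction.
Context {R : realType} {n : nat}.
Local Notation V := 'rV[R]_n.
Variables (eta : 'M[R]_n) (AD : {linear V -> 'M[R]_n}).
Hypothesis mA : metric_algebra eta AD.

Lemma bform_nondeg x : (forall y, bform eta x y = 0) -> x = 0.
Proof.
move=> H; have x0 : x *m eta = 0.
  apply/rowP => k; rewrite [RHS]mxE -(H (delta_mx 0 k)) /bform trmx_delta.
  by rewrite -colE [RHS]mxE.
by rewrite -[x](mulmxK (eta_unit mA)) x0 mul0mx.
Qed.

Lemma null_dual z : z != 0 -> bform eta z z = 0 ->
  exists2 f, bform eta f z = 1 & bform eta f f = 0.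
Proof.
move=> z0 zz.
have [y yz] : exists y, bform eta y z = 1.
  have [y yz] : exists y, bform eta z y != 0.
    apply: contrapT => H; move/eqP: z0; apply; apply: bform_nondeg => y.
    by apply/eqP/negPn/negP => yz; apply: H; exists y.
  by exists ((bform eta z y)^-1 *: y); rewrite bformZl (bformC mA y) mulVf.
(* Adding a multiple of the null vector z keeps the pairing with z and changes <y, y> by twice the
   coefficient. *)
exists (y - (2^-1 * bform eta y y) *: z).
  by rewrite bformDl bformNl bformZl zz mulr0 subr0.
rewrite !(bformDl, bformDr, bformNl, bformNr mA, bformZl, bformZr) zz.
rewrite (bformC mA z y) yz; by field.
Qed.

(* For null z and f with <f, z> = 1, the projection onto the complement of the plane
   they span. *)
Definition null_proj (z f : V) : 'M[R]_n :=
  1%:M - eta *m z^T *m f - eta *m f^T *m z.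

Lemma mul_null_proj z f v :
  v *m null_proj z f = v - bform eta v z *: f - bform eta v f *: z.
Proof.
by rewrite /null_proj !mulmxBr mulmx1 !mulmxA !bformE !mul_scalar_mx.
Qed.

(** The operator induced by ad x on the quotient of the orthogonal of z by z, realized on the
    complement of z and f. *)
Definition reduced_ad z f x := null_proj z f *m AD x *m null_proj z f.

(** ad x kills z and has its image in the orthogonal of z, so inserting the projection between two
    factors changes nothing, and the two rank-one corrections have trace 0. *)
Lemma trace_reduced z f x y : central AD z -> bform eta z z = 0 ->
  bform eta f z = 1 -> bform eta f f = 0 ->
  \tr (AD x *m AD y) = \tr (reduced_ad z f x *m reduced_ad z f y).
Proof.
move=> cz zz fz ff.
have QE v := mul_null_proj z f v.
have bzf : bform eta z f = 1 by rewrite (bformC mA).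
have zQ : z *m null_proj z f = 0.
  by rewrite QE zz bzf scale0r subr0 scale1r subrr.
have fQ : f *m null_proj z f = 0.
  by rewrite QE fz ff scale0r subr0 scale1r subrr.
have zA w : z *m AD w = 0 by exact: (central_mul mA _ cz).
have QQ : null_proj z f *m null_proj z f = null_proj z f.
  apply: eq_mulmx => v; rewrite mulmxA [X in X *m _](QE v) !(mulmxDl, mulNmx) -!scalemxAl zQ fQ.
  by rewrite !scaler0 !subr0.
have AQA w1 w2 : AD w1 *m null_proj z f *m AD w2 = AD w1 *m AD w2.
  apply: eq_mulmx => v; rewrite !mulmxA QE !(mulmxDl, mulNmx) -!scalemxAl zA.
  by rewrite (central_orth mA) // scale0r scaler0 !subr0.
rewrite /reduced_ad.
have -> : null_proj z f *m AD x *m null_proj z f *m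
    (null_proj z f *m AD y *m null_proj z f) =
    null_proj z f *m (AD x *m AD y) *m null_proj z f.
  by rewrite -(AQA x y) !mulmxA -(mulmxA (null_proj z f *m AD x)) QQ.
rewrite [RHS]mxtrace_mulC (mulmxA (null_proj z f) (null_proj z f)) QQ [RHS]mxtrace_mulC.
have t1 : \tr (AD x *m AD y *m (eta *m z^T *m f)) = 0.
  rewrite mulmxA mxtrace_mulC !mulmxA bformE (central_orth mA) //.
  by rewrite mxtrace_scalar mul0rn.
have t2 : \tr (AD x *m AD y *m (eta *m f^T *m z)) = 0.
  by rewrite mulmxA mxtrace_mulC !mulmxA zA !mul0mx mxtrace0.
by rewrite /null_proj !(mulmxBr (AD x *m AD y)) mulmx1 !raddfB /= t1 t2 !subr0.
Qed.

(** Elements orthogonal to z have reduced operator 0, hence lie in the radical of the Killing form,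
    which therefore depends only on <., z>. The constant c is Tr (ad f)^2 for a null f with <f, z> =
    1. *)
Lemma killing_of_abelian_reduction z : z != 0 -> central AD z ->
  bform eta z z = 0 ->
  (forall x y, bform eta x z = 0 -> bform eta y z = 0 -> exists a, y *m AD x = a *: z) ->
  exists c, forall x y, \tr (AD x *m AD y) = c * bform eta x z * bform eta y z.
Proof.
move=> z0 cz zz zab; have [f fz ff] := null_dual z0 zz.
have bzf : bform eta z f = 1 by rewrite (bformC mA).
have D0 x : bform eta x z = 0 -> reduced_ad z f x = 0.
  move=> xz; apply: eq_mulmx => v; rewrite mulmx0 /reduced_ad !mulmxA.
  have [|a ->] := zab x (v *m null_proj z f) xz.
    by rewrite mul_null_proj !bformDl !bformNl !bformZl zz fz mulr1 mulr0 subrr subr0.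
  rewrite -scalemxAl mul_null_proj zz bzf scale0r subr0 scale1r subrr.
  by rewrite scaler0.
have tr0 x y : bform eta x z = 0 -> \tr (AD x *m AD y) = 0.
  by move=> xz; rewrite (trace_reduced x y cz zz fz ff) D0 // mul0mx linear0.
exists (\tr (AD f *m AD f)) => x y.
have dec u : exists2 u', bform eta u' z = 0 & u = u' + bform eta u z *: f.
  exists (u - bform eta u z *: f); last by rewrite subrK.
  by rewrite bformDl bformNl bformZl fz mulr1 subrr.
have dtr a u v w : \tr (AD (u + a *: v) *m AD w) =
    \tr (AD u *m AD w) + a * \tr (AD v *m AD w).
  by rewrite (linearD AD) (linearZ_LR AD) mulmxDl -scalemxAl mxtraceD mxtraceZ.
have [x' x'z {1}->] := dec x; have [y' y'z {1}->] := dec y.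
by rewrite dtr tr0 // mxtrace_mulC dtr tr0 //; ring.
Qed.

End NullReduction.

(** * The invariant 3-form *)

Section AlternatingForm.
Context {R : realType} {n : nat}.
Local Notation V := 'rV[R]_n.
Variables (eta : 'M[R]_n) (AD : {linear V -> 'M[R]_n}).
Hypothesis mA : metric_algebra eta AD.

Lemma mul_AD_diag x : x *m AD x = 0.
Proof.
have H := AD_anti mA x x; apply/rowP => k; rewrite [RHS]mxE.
by move/rowP/(_ k): H; rewrite [RHS]mxE; lra.
Qed.

Lemma bform_AD_alt2 x y : bform eta (y *m AD x) y = 0.
Proof.
have := bform_skew mA y y x; rewrite (bformC mA y) => H; lra.
Qed.

Lemma bform_AD_alt1 x y : bform eta (y *m AD x) x = 0.
Proof. by rewrite (AD_anti mA) bformNl bform_AD_alt2 oppr0. Qed.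

Lemma bform_AD_rot x y w : bform eta (y *m AD x) w = bform eta (w *m AD y) x.
Proof.
by rewrite [RHS](bform_skew mA) (AD_anti mA x y) (bformNr mA) opprK (bformC mA).
Qed.

Lemma AD_eq0 z : (forall i j : 'I_n,
    bform eta (delta_mx 0 i *m AD z) (delta_mx 0 j) = 0) -> AD z = 0.
Proof.
move=> H; apply/row_matrixP => i; rewrite row0 rowE.
apply: (bform_nondeg mA) => y; rewrite /bform mxE big1 // => j _.
have := H i j; rewrite /bform trmx_delta -colE mxE => ->.
by rewrite mul0r.
Qed.

(** <[x, y], w> is alternating, and among three basis vectors in dimension at most 2 two
    coincide. *)
Lemma AD_low_dim z : (n <= 2)%N -> AD z = 0.
Proof.
move=> n2; rewrite [z]row_sum_delta linear_sum big1 // => k _.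
rewrite linearZ /=; suff -> : AD (delta_mx 0 k) = 0 by rewrite scaler0.
apply: AD_eq0 => i j.
have : [|| i == k, j == k | i == j].
  have := ltn_ord i; have := ltn_ord j; have := ltn_ord k.
  by rewrite -!(inj_eq val_inj) /=; lia.
case/or3P => /eqP ->.
- by rewrite mul_AD_diag bform0l.
- exact: bform_AD_alt1.
- exact: bform_AD_alt2.
Qed.

End AlternatingForm.

(** Here z = (1, 0, 0), whose orthogonal is r = 0, where the bracket is <Phi X, Y> z. The case t + s
    = 0 has dimension 2 and falls under the first alternative. *)
Lemma killing_condition_osc (R : realType) t s (Phi : 'M[R]_(t + s))
    (Phi_so : in_so Phi) n (eta : 'M[R]_n) (AD : {linear 'rV[R]_n -> 'M[R]_n})
    iota coord :
  @coordinates R (osc Phi_so) n eta AD iota coord -> killing_condition eta AD.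
Proof.
move=> co; have mA := coordinates_metric_algebra co.
have [n2|n2] := leqP n 2.
  by left; exists 0 => x y; rewrite (AD_low_dim mA x n2) mul0mx mxtrace0 mul0r.
pose z0 : osc Phi_so := (1, 0, 0); pose z := coord z0.
have iz : iota z = z0 by rewrite (coordK co).
have inj := can_inj (iotaK co).
have cz : central AD z.
  apply: eq_mulmx => v; apply: inj; rewrite (iota_bracket co) iz mulmx0 (iota_zero co).
  case: (iota v) => [[a Y] r] /=; rewrite mulmx0 scale0r scaler0 subr0.
  by rewrite -(scale0r 0) std_innerZl mul0r scale0r.
have form_z x : mla_form x z0 = x.2.
  case: x => [[a Y] r] /=.
  have -> : std_inner Y (0 : 'cV[R]_(t + s)) = 0 by rewrite -(scale0r 0) std_innerZr mul0r.
  by rewrite !(mul0r, mulr0, mul1r, add0r).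
right; exists z.
have [| | | |c Hc] := @killing_of_abelian_reduction R n eta AD mA z.
- apply/eqP => z00; move: iz; rewrite z00 (iota_zero co) => /(congr1 (fun x => x.1.1)).
  by move/eqP; rewrite eq_sym oner_eq0.
- exact: cz.
- by rewrite (iota_form co) iz form_z.
- move=> x y; rewrite !(iota_form co) iz !form_z => xz yz.
  have [a Ha] : exists a : R, mla_bracket (iota x) (iota y) = a *: z0.
    move: xz yz; case: (iota x) => [[a X] p]; case: (iota y) => [[b Y] q] /= -> ->.
    exists (std_inner (Phi *m X) Y); rewrite !scale0r subr0 /z0.
    by congr (_, _, _); rewrite /= ?scaler0 //; rewrite /GRing.scale /= mulr1.
  exists a; apply: inj; rewrite (iota_bracket co) Ha.
  by rewrite (iota_scale co) iz.
by exists c; split => //; rewrite (iota_form co) iz form_z.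
Qed.

(** * Indecomposability and invariant operators *)

Section Splitting.
Context {R : realType} (g : metricLieAlgebra R) (n : nat).
Local Notation V := 'rV[R]_n.
Variables (eta : 'M[R]_n) (AD : {linear V -> 'M[R]_n}).
Variables (iota : V -> g) (coord : g -> V).
Hypothesis co : coordinates eta AD iota coord.

(** The self-adjoint elements of the centroid of g. *)
Definition invariant_op (N : 'M[R]_n) :=
  (forall x, AD x *m N = N *m AD x) /\
  (forall x y, bform eta (x *m N) y = bform eta x (y *m N)).

(* The kernel and the image of such an operator are orthogonal ideals. *)
Lemma indecomposable_op (N : 'M[R]_n) : indecomposable g -> invariant_op N ->
  (forall v : V, v *m N *m N = 0 -> v *m N = 0) ->
  N = 0 \/ (forall v : V, v *m N = 0 -> v = 0).
Proof.
move=> ig [Ncomm Nself] NN; apply: contrapT => /not_orP[N0 Ninj]; apply: ig.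
have mA := coordinates_metric_algebra co.
have inj := can_inj (iotaK co).
pose phi (x : g) : g := iota (coord x *m N).
have phil : linear phi.
  by move=> a x y; rewrite /phi (coord_linear co) mulmxDl -scalemxAl (iota_linear co).
pose phiL : {linear g -> g} := HB.pack phi (GRing.isLinear.Build _ _ _ _ _ phil).
have phiE x : linfun phiL x = iota (coord x *m N) by rewrite lfunE.
have cinj : injective coord by exact: can_inj (coordK co).
have bracketE x y : mla_bracket x y = iota (coord y *m AD (coord x)).
  by rewrite (iota_bracket co) !(coordK co).
have coord0 : coord 0 = 0 by rewrite -(iota_zero co) (iotaK co).
have iota_eq0 v : iota v = 0 -> v = 0 by move=> H; rewrite -(iotaK co v) H coord0.
have kerE x : (x \in lker (linfun phiL)) = (coord x *m N == 0).
  rewrite memv_ker phiE; apply/eqP/eqP => [/iota_eq0 //|->]; exact: (iota_zero co).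
have imgP x : x \in limg (linfun phiL) -> exists v, x = iota (v *m N).
  by case/memv_imgP => y _ ->; exists (coord y); rewrite phiE.
have imgI v : iota (v *m N) \in limg (linfun phiL).
  have := memv_img (linfun phiL) (memvf (iota v)); rewrite phiE (iotaK co); exact.
(* Image and kernel of N meet in 0, so N and N^2 have the same rank and hence the same row space; X
   then splits each v as v X N plus an element of the kernel. *)
have [X HX] : exists X, N = X *m (N *m N).
  apply/submxP; have [_] := mxrank_leqif_sup (submxMl N N).
  have := mxrank_mul_ker N N.
  have -> : (N :&: kermx N)%MS = 0.
    apply/eqP; rewrite -submx0; apply/rV_subP => u; rewrite sub_capmx.
    move=> /andP[/submxP[v ->]]; rewrite sub_kermx => /eqP/NN ->.
    exact: sub0mx.
  by rewrite mxrank0 addn0 => -> <-; rewrite eqxx.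
exists (limg (linfun phiL)), (lker (linfun phiL)); split.
- split=> [x y /imgP[v ->]|x y].
    rewrite bracketE (iotaK co) -mulmxA -Ncomm mulmxA; exact: imgI.
  rewrite !kerE bracketE (iotaK co) -mulmxA Ncomm mulmxA => /eqP ->.
  by rewrite mul0mx.
- split; apply/eqP => H0.
    apply: N0; apply: eq_mulmx => v; rewrite mulmx0; apply: iota_eq0.
    by apply/eqP; rewrite -memv0 -H0; exact: imgI.
  apply: Ninj => v vN; apply: iota_eq0; apply/eqP; rewrite -memv0 -H0 kerE.
  by rewrite (iotaK co) vN.
- move=> x y /imgP[v ->]; rewrite kerE => /eqP yN.
  rewrite -(coordK co y) -(iota_form co) Nself yN; exact: (bform0r mA).
- apply/eqP; rewrite -subv0; apply/subvP => x; rewrite memv_cap => /andP[/imgP[v ->]].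
  by rewrite kerE (iotaK co) => /eqP/NN ->; rewrite (iota_zero co) mem0v.
- apply/eqP; rewrite eqEsubv subvf /=; apply/subvP => x _.
  pose v := coord x.
  have -> : x = iota (v *m X *m N) + iota (v - v *m X *m N).
    by rewrite -(iota_add co) addrC subrK (coordK co).
  apply: memv_add; first exact: imgI.
  by rewrite kerE (iotaK co) mulmxBl -!mulmxA -HX subrr.
Qed.

(** For non-null z the operator v |-> <v, z> z is invariant and a nonzero multiple of a projection,
    and having rank one it is not injective when n > 1. *)
Lemma central_null z : indecomposable g -> (1 < n)%N -> central AD z ->
  bform eta z z = 0.
Proof.
move=> ig n1 cz; apply: contrapT => /eqP zz.
have mA := coordinates_metric_algebra co.
have [N NE] : exists N : 'M[R]_n, forall v, v *m N = bform eta v z *: z.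
  by exists (eta *m z^T *m z) => v; rewrite !mulmxA bformE mul_scalar_mx.
have z0 : z != 0 by apply: contra_neq zz => ->; rewrite bform0l.
have [| |N0|Ninj] := indecomposable_op (N := N) ig.
- split=> [x|x y].
    apply: eq_mulmx => v; rewrite !mulmxA !NE (central_orth mA) // scale0r.
    by rewrite -scalemxAl (central_mul mA) // scaler0.
  by rewrite !NE bformZl bformZr mulrC (bformC mA z).
- move=> v; rewrite (NE (v *m N)) (NE v) bformZl => /eqP.
  rewrite scaler_eq0 mulf_eq0 (negbTE zz) (negbTE z0) !orbF => /eqP ->.
  by rewrite scale0r.
- have := NE z; rewrite N0 mulmx0 => /esym/eqP.
  by rewrite scaler_eq0 (negbTE zz) (negbTE z0).
have : row_free (eta *m z^T).
  apply: inj_row_free => v vz; apply: Ninj.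
  by rewrite NE /bform -mulmxA vz mxE scale0r.
rewrite /row_free => /eqP H; have := rank_leq_col (eta *m z^T).
by rewrite H leqNgt n1.
Qed.

End Splitting.

(** * Dimension four *)

Section DimensionFour.
Context {R : realType}.
Local Notation V := 'rV[R]_4.
Variables (eta : 'M[R]_4) (AD : {linear V -> 'M[R]_4}).
Hypothesis mA : metric_algebra eta AD.

Lemma four_vectors (a b c d : V) :
  (exists u0 u1 u2 u3, u0 *: a + u1 *: b + u2 *: c + u3 *: d = 0 /\
     ~ [/\ u0 = 0, u1 = 0, u2 = 0 & u3 = 0]) \/
  (forall y, exists u0 u1 u2 u3, y = u0 *: a + u1 *: b + u2 *: c + u3 *: d).
Proof.
pose M : 'M[R]_4 := \matrix_(i < 4) [:: a; b; c; d]`_i.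
have ME v : v *m M = v 0 0 *: a + v 0 1 *: b + v 0 2 *: c + v 0 3 *: d.
  rewrite mulmx_sum_row !big_ord_recl big_ord0 addr0 !rowK /= !addrA.
  by congr (_ *: _ + _ *: _ + _ *: _ + _ *: _); congr (v _ _); apply: val_inj.
have [Mf|Mf] := boolP (row_free M).
  right=> y; pose v := y *m invmx M.
  by exists (v 0 0), (v 0 1), (v 0 2), (v 0 3); rewrite -ME mulmxKV // -row_free_unit.
left; apply: contrapT => H; move/negP: Mf; apply; apply: inj_row_free => v.
rewrite ME => vM; apply: contrapT => v0; apply: H.
exists (v 0 0), (v 0 1), (v 0 2), (v 0 3); split => // -[h0 h1 h2 h3]; apply: v0.
apply/rowP => -[[|[|[|[|//]]]] Hi]; rewrite [RHS]mxE.
- by rewrite -[RHS]h0; congr (v _ _); apply: val_inj.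
- by rewrite -[RHS]h1; congr (v _ _); apply: val_inj.
- by rewrite -[RHS]h2; congr (v _ _); apply: val_inj.
- by rewrite -[RHS]h3; congr (v _ _); apply: val_inj.
Qed.

Lemma orthogonal_exists n k (e : 'M[R]_n) (P : 'M[R]_(k, n)) : (k < n)%N ->
  exists2 z : 'rV[R]_n, z != 0 & forall i, bform e z (row i P) = 0.
Proof.
move=> kn; have nf : ~~ row_free (e *m P^T).
  rewrite /row_free; apply: contraL kn => /eqP <-; rewrite -leqNgt.
  exact: rank_leq_col.
apply: contrapT => H; move/negP: nf; apply; apply: inj_row_free => v vP.
apply: contrapT => /eqP v0; apply: H; exists v => // i.
by rewrite /bform tr_row colE mulmxA -(mulmxA v) vP mul0mx mxE.
Qed.

(* If the 3-form om(x, y, w) = <[x, y], w> does not vanish on (a, b, c), then any z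
   with om(z, b, c) = om(a, z, c) = om(a, b, z) = 0 lies in its kernel. *)
Lemma central_exists4 : exists2 z, z != 0 & central AD z.
Proof.
pose om x y w := bform eta (y *m AD x) w.
have omE x y w : bform eta (y *m AD x) w = om x y w by [].
have rot x y w : om x y w = om y w x by exact: (bform_AD_rot mA).
have anti x y w : om x y w = - om y x w.
  by rewrite /om (AD_anti mA) bformNl.
have alt x w : om x x w = 0 by rewrite /om (mul_AD_diag mA) bform0l.
have [om0|] := pselect (forall x y w, om x y w = 0).
  exists (delta_mx 0 0).
    apply/eqP => /rowP/(_ 0)/eqP; rewrite !mxE !eqxx /=; exact/negP/oner_neq0.
  by apply: (AD_eq0 mA) => i j; exact: om0.
move=> /existsNP[a /existsNP[b /existsNP[c /eqP abc]]].
(* The rows are [b, c], [c, a] and [a, b]: three linear conditions on z in dimension four. *)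
pose P : 'M[R]_(3, 4) := \matrix_(i < 3) [:: c *m AD b; a *m AD c; b *m AD a]`_i.
have [z z0 zP] := @orthogonal_exists 4 3 eta P isT.
have z1 : om b c z = 0 by have := zP 0; rewrite rowK /= (bformC mA).
have z2 : om c a z = 0 by have := zP 1; rewrite rowK /= (bformC mA).
have z3 : om a b z = 0 by have := zP 2; rewrite rowK /= (bformC mA).
exists z => //.
have alt2 x y : om x y y = 0 by rewrite -rot -rot alt.
have alt3 x y : om x y x = 0 by rewrite -rot alt.
have lin x y (u0 u1 u2 u3 : R) p q r s :
    om x y (u0 *: p + u1 *: q + u2 *: r + u3 *: s) =
    u0 * om x y p + u1 * om x y q + u2 * om x y r + u3 * om x y s.
  by rewrite /om !bformDr !bformZr.
have om00 x y : om x y 0 = 0 by rewrite /om (bform0r mA).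
(* Pairing a linear relation with om(b, c, .), om(c, a, .) and om(a, b, .) kills the coefficients of
   a, b and c, and then that of z; hence a, b, c, z span. *)
have [[u0 [u1 [u2 [u3 [H []]]]]]|span] := four_vectors a b c z.
  have := om00 b c; rewrite -{1}H lin -(rot a) alt3 alt2 z1 !mulr0 !addr0 => /eqP.
  rewrite mulf_eq0 (negbTE abc) orbF => /eqP e0.
  have := om00 c a; rewrite -{1}H lin (rot c a b) alt2 alt3 z2 !mulr0 !addr0 add0r => /eqP.
  rewrite mulf_eq0 (negbTE abc) orbF => /eqP e1.
  have := om00 a b; rewrite -{1}H lin alt2 alt3 z3 !mulr0 !addr0 !add0r => /eqP.
  rewrite mulf_eq0 (negbTE abc) orbF => /eqP e2.
  move: H; rewrite e0 e1 e2 !scale0r !add0r => /eqP.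
  by rewrite scaler_eq0 (negbTE z0) orbF => /eqP.
have ker x : om z x a = 0 -> om z x b = 0 -> om z x c = 0 -> x *m AD z = 0.
  move=> xa xb xc; apply: (bform_nondeg mA) => y.
  have [u0 [u1 [u2 [u3 ->]]]] := span y.
  by rewrite omE lin xa xb xc alt3 !mulr0 !addr0.
have az : a *m AD z = 0.
  by apply: ker; [exact: alt2|rewrite rot|rewrite rot anti z2 oppr0].
have bz : b *m AD z = 0.
  by apply: ker; [rewrite rot anti z3 oppr0|exact: alt2|rewrite rot].
have cz : c *m AD z = 0.
  by apply: ker; [rewrite rot|rewrite rot anti z1 oppr0|exact: alt2].
apply: eq_mulmx => v; rewrite mulmx0; have [u0 [u1 [u2 [u3 ->]]]] := span v.
by rewrite !mulmxDl -!scalemxAl az bz cz (mul_AD_diag mA) !scaler0 !addr0.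
Qed.

Lemma abelian_reduction4 z : z != 0 -> central AD z -> bform eta z z = 0 ->
  forall x y, bform eta x z = 0 -> bform eta y z = 0 -> exists a, y *m AD x = a *: z.
Proof.
move=> z0 cz zz.
have [f fz ff] := null_dual mA z0 zz.
have zf : bform eta z f = 1 by rewrite (bformC mA).
have yAz y : y *m AD z = 0 by rewrite cz mulmx0.
have zAx x : z *m AD x = 0 by exact: (central_mul mA).
have om0 x y w : bform eta x z = 0 -> bform eta y z = 0 -> bform eta w z = 0 ->
    bform eta (y *m AD x) w = 0.
  move=> xz yz wz.
  have solve (p q r s : V) (u0 u1 u2 u3 : R) : u1 != 0 ->
      u0 *: p + u1 *: q + u2 *: r + u3 *: s = 0 ->
      q = (- u0 / u1) *: p + (- u2 / u1) *: r + (- u3 / u1) *: s.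
    move=> u10 H; apply: (scalerI u10); rewrite !scalerDr !scalerA.
    rewrite ![u1 * _]mulrC !divfK // !scaleNr.
    apply/eqP; rewrite -subr_eq0 -[X in _ == X]H; apply/eqP.
    by apply/rowP => k; rewrite !mxE; ring.
  (* All four vectors are orthogonal to z, so by nondegeneracy they cannot span. One of x, y, w is
     therefore a combination of z and the other two, and the alternating form with z in its kernel
     vanishes on them. *)
  have [[u0 [u1 [u2 [u3 [H nz]]]]]|span] := four_vectors z x y w; last first.
    move/eqP: z0; case; apply: (bform_nondeg mA) => v.
    have [u0 [u1 [u2 [u3 ->]]]] := span v.
    rewrite (bformC mA) !bformDl !bformZl zz xz yz wz.
    by rewrite !mulr0 !addr0.
  have [u1z|u1n] := eqVneq u1 0; last first.
    rewrite (solve _ _ _ _ _ _ _ _ u1n H) !(linearD AD) !(linearZ_LR AD).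
    rewrite !mulmxDr -!scalemxAr yAz (mul_AD_diag mA y) !scaler0 !add0r.
    by rewrite bformZl (bform_AD_alt1 mA) mulr0.
  have [u2z|u2n] := eqVneq u2 0; last first.
    have H' : u0 *: z + u2 *: y + u1 *: x + u3 *: w = 0.
      by rewrite -H; apply/rowP => k; rewrite !mxE; ring.
    rewrite (solve _ _ _ _ _ _ _ _ u2n H') !mulmxDl -!scalemxAl zAx (mul_AD_diag mA x).
    by rewrite !scaler0 !add0r bformZl (bform_AD_alt2 mA) mulr0.
  have [u3z|u3n] := eqVneq u3 0; last first.
    have H' : u0 *: z + u3 *: w + u1 *: x + u2 *: y = 0.
      by rewrite -H; apply/rowP => k; rewrite !mxE; ring.
    rewrite (solve _ _ _ _ _ _ _ _ u3n H') !bformDr !bformZr.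
    by rewrite (central_orth mA) // (bform_AD_alt1 mA) (bform_AD_alt2 mA) !mulr0 !addr0.
  move: H; rewrite u1z u2z u3z !scale0r !addr0 => /eqP.
  rewrite scaler_eq0 (negbTE z0) orbF => /eqP u0z.
  by case: nz.
move=> x y xz yz; exists (bform eta (y *m AD x) f).
apply/eqP; rewrite -subr_eq0; apply/eqP; apply: (bform_nondeg mA) => u.
have uz : bform eta (u - bform eta u z *: f) z = 0.
  by rewrite bformDl bformNl bformZl fz mulr1 subrr.
have := om0 x y _ xz yz uz; rewrite bformDr (bformNr mA) bformZr => /eqP.
rewrite subr_eq0 => /eqP E.
by rewrite bformDl bformNl bformZl E (bformC mA z u) mulrC subrr.
Qed.

End DimensionFour.

Lemma coordinates_dim (R : realType) (g : metricLieAlgebra R) n (eta : 'M[R]_n) AD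
    iota coord : @coordinates R g n eta AD iota coord -> n = \dim (fullv : {vspace g}).
Proof.
move=> co.
pose f : {linear 'rV[R]_n -> g} :=
  HB.pack iota (GRing.isLinear.Build _ _ _ _ _ (iota_linear co)).
have fE v : linfun f v = iota v by rewrite lfunE.
have img : limg (linfun f) = fullv.
  apply/eqP; rewrite eqEsubv subvf /=; apply/subvP => x _.
  by rewrite -(coordK co x) -fE; exact: memv_img (memvf _).
have ker : lker (linfun f) = 0%VS.
  apply/eqP/lker0P => u v; rewrite !fE; exact: (can_inj (iotaK co)).
have := limg_ker_dim (linfun f) fullv; rewrite ker capv0 dimv0 add0n img => ->.
by rewrite dimvf /dim /= mul1n.
Qed.

Lemma killing_condition_dim4 (R : realType) (g : metricLieAlgebra R) n
    (eta : 'M[R]_n) (AD : {linear 'rV[R]_n -> 'M[R]_n}) iota coord :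
  indecomposable g -> \dim (fullv : {vspace g}) = 4%N ->
  @coordinates R g n eta AD iota coord -> killing_condition eta AD.
Proof.
move=> ig g4 co; have n4 := coordinates_dim co; rewrite g4 in n4; subst n.
have mA := coordinates_metric_algebra co.
have [z z0 cz] := central_exists4 mA.
have zz := central_null co ig isT cz.
have [c Hc] := killing_of_abelian_reduction mA z0 cz zz (abelian_reduction4 mA z0 cz zz).
by right; exists z, c.
Qed.

(** * Lorentzian algebras *)

Section KillingOperator.
Context {R : realType} {n : nat}.
Local Notation V := 'rV[R]_n.
Variables (eta : 'M[R]_n) (AD : {linear V -> 'M[R]_n}).
Hypothesis mA : metric_algebra eta AD.

Lemma killing_invariant x y w :
  \tr (AD (y *m AD x) *m AD w) = - \tr (AD y *m AD (w *m AD x)).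
Proof.
rewrite !(AD_jacobi mA) mulmxBl mulmxBr !raddfB /= !mulmxA.
by rewrite (mxtrace_mulC (AD x *m AD y)) !mulmxA (mxtrace_mulC (AD w *m AD x)) !mulmxA; ring.
Qed.

(** The Killing form and the metric are both symmetric and ad-invariant, so the operator relating
    them is self-adjoint and commutes with ad. *)
Lemma killing_operator : exists2 K : 'M[R]_n,
  forall x y, bform eta (x *m K) y = \tr (AD x *m AD y) & invariant_op eta AD K.
Proof.
pose beta : 'M[R]_n := \matrix_(i, j) \tr (AD (delta_mx 0 i) *m AD (delta_mx 0 j)).
have tr_sum (A : 'M[R]_n) (y : V) :
    \tr (A *m AD y) = \sum_j y 0 j * \tr (A *m AD (delta_mx 0 j)).
  have ADy : AD y = \sum_j y 0 j *: AD (delta_mx 0 j).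
    by rewrite {1}[y]row_sum_delta linear_sum; apply: eq_bigr => j _; rewrite linearZ.
  rewrite ADy mulmx_sumr raddf_sum; apply: eq_bigr => j _.
  by rewrite -scalemxAr; exact: mxtraceZ.
have betaE x y : (x *m beta *m y^T) 0 0 = \tr (AD x *m AD y).
  rewrite tr_sum mxE; apply: eq_bigr => j _; rewrite mulrC [X in X * _]mxE.
  congr (_ * _); rewrite mxtrace_mulC tr_sum mxE; apply: eq_bigr => i _.
  by rewrite mxE mxtrace_mulC.
have KE x y : bform eta (x *m (beta *m invmx eta)) y = \tr (AD x *m AD y).
  by rewrite -betaE /bform mulmxA mulmxKV // (eta_unit mA).
exists (beta *m invmx eta) => //; move: (beta *m invmx eta) KE => K KE; split.
  move=> x; apply: eq_mulmx => v; apply/eqP; rewrite -subr_eq0; apply/eqP.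
  apply: (bform_nondeg mA) => w; rewrite bformDl bformNl !mulmxA KE.
  by rewrite (bform_skew mA) KE killing_invariant opprK addNr.
by move=> x y; rewrite (bformC mA x) !KE mxtrace_mulC.
Qed.

Lemma invariant_sub_scalar N a : invariant_op eta AD N -> invariant_op eta AD (N - a%:M).
Proof.
move=> [Nc Ns]; split=> [x|x y].
  by rewrite mulmxBl mulmxBr Nc scalar_mxC.
rewrite mulmxBr (mulmxBr y) !mul_mx_scalar bformDl bformDr bformNl (bformNr mA).
by rewrite bformZl bformZr Ns.
Qed.

Lemma invariant_mul N M : invariant_op eta AD N -> invariant_op eta AD M ->
  N *m M = M *m N -> invariant_op eta AD (N *m M).
Proof.
move=> [Nc Ns] [Mc Ms] NM; split=> [x|x y].
  by rewrite mulmxA Nc -mulmxA Mc mulmxA.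
by rewrite mulmxA Ms Ns -mulmxA -NM.
Qed.

End KillingOperator.

(** * Nilpotent invariant operators in Lorentzian signature *)

Section LorentzianOperators.
Context {R : realType} (g : metricLieAlgebra R) (n : nat).
Local Notation V := 'rV[R]_n.+1.
Variables (eta : 'M[R]_n.+1) (AD : {linear V -> 'M[R]_n.+1}).
Variables (iota : V -> g) (coord : g -> V).
Hypotheses (co : coordinates eta AD iota coord) (ig : indecomposable g).

Let mA := coordinates_metric_algebra co.

Lemma invariant_exp N k : invariant_op eta AD N -> invariant_op eta AD (N ^+ k).
Proof.
move=> iN; elim: k => [|k IH].
  by rewrite expr0; split=> [x|x y]; rewrite ?mulmx1 ?mul1mx.
by rewrite exprS; apply: invariant_mul => //; rewrite mulmxE -exprS -exprSr.
Qed.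

(* Fitting: the image of a power of N of minimal rank meets its kernel trivially. *)
Lemma invariant_nilpotent N (x : V) : invariant_op eta AD N -> x != 0 -> x *m N = 0 ->
  exists k, N ^+ k = 0.
Proof.
move=> iN x0 xN.
(* Only positive powers compete, so that x remains in the kernel of the chosen one. *)
have exr : exists r, `[< exists k, \rank (N ^+ k.+1) = r >].
  by exists (\rank (N ^+ 1)); apply/asboolP; exists 0%N.
have [r /asboolP[k kr] rmin] := ex_minnP exr.
pose M := N ^+ k.+1.
have iM : invariant_op eta AD M by exact: invariant_exp.
have cap : (M :&: kermx M)%MS = 0.
  apply/eqP; rewrite -mxrank_eq0 -leqn0 -(leq_add2l (\rank (M *m M))).
  rewrite mxrank_mul_ker addn0 kr.
  apply: rmin; apply/asboolP; exists (k + k.+1)%N.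
  by rewrite mulmxE /M -exprD addSn.
have [|M0|Minj] := indecomposable_op co ig iM.
- move=> v vMM; apply/eqP; rewrite -submx0 -cap sub_capmx submxMl /=.
  by rewrite sub_kermx vMM.
- by exists k.+1.
move/eqP: x0; case; apply: Minj.
by rewrite /M exprS -mulmxE mulmxA xN mul0mx.
Qed.

Variable e : V.
Hypothesis e_neg : bform eta e e < 0.
Hypothesis e_pos : forall x, x != 0 -> bform eta x e = 0 -> 0 < bform eta x x.

Lemma null_not_orth z : z != 0 -> bform eta z z = 0 -> bform eta z e != 0.
Proof.
move=> z0 zz; apply/eqP => ze; have := e_pos z0 ze; rewrite zz.
by rewrite ltxx.
Qed.

(** A multiple of z can be subtracted from x to make it orthogonal to e; the difference is still
    null, hence 0 by positivity. *)
Lemma null_collinear z x : z != 0 -> bform eta z z = 0 -> bform eta x x = 0 ->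
  bform eta x z = 0 -> exists a, x = a *: z.
Proof.
move=> z0 zz xx xz; have ze := null_not_orth z0 zz.
exists (bform eta x e / bform eta z e).
apply/eqP; rewrite -subr_eq0; apply/negPn/negP => d0.
have := e_pos d0.
rewrite !(bformDl, bformNl, bformZl, bformDr, bformNr mA, bformZr) divfK // subrr.
by move/(_ erefl); rewrite zz xx xz (bformC mA z x) xz !(mulr0, subr0, oppr0) ltxx.
Qed.

(* The top nonzero power of N has a null line as its image, which is an ideal, and
   a null line that is an ideal is central. *)
Lemma nilpotent_central N : invariant_op eta AD N -> N != 0 -> (exists k, N ^+ k = 0) ->
  exists k v, [/\ (0 < k)%N /\ N ^+ k.+1 = 0, v *m N ^+ k != 0,
    bform eta (v *m N ^+ k) (v *m N ^+ k) = 0, central AD (v *m N ^+ k) &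
    forall u : V, exists a, u *m N ^+ k = a *: (v *m N ^+ k)].
Proof.
move=> iN N0 nil.
have nilb : exists k, `[< N ^+ k = 0 >] by case: nil => k kN; exists k; apply/asboolP.
have [[|[|k]] /asboolP Nk kmin] := ex_minnP nilb.
- by move: (oner_neq0 'M[R]_n.+1); rewrite -(expr0 N) Nk eqxx.
- by move: N0; rewrite -(expr1 N) Nk eqxx.
have Nk0 : N ^+ k.+1 != 0.
  by apply/eqP => H; have := kmin k.+1 (asboolT H); rewrite ltnn.
have [v vN] : exists v : V, v *m N ^+ k.+1 != 0.
  apply: contrapT => H; move/eqP: Nk0; apply; apply: eq_mulmx => v.
  rewrite mulmx0; apply/eqP/negPn/negP => vN; apply: H; by exists v.
have [Mc Ms] := invariant_exp k.+1 iN.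
(* By self-adjointness the pairing involves N^(2k+2), a multiple of N^(k+2) = 0. The image is
   totally null, hence a line. *)
have iso u w : bform eta (u *m N ^+ k.+1) (w *m N ^+ k.+1) = 0.
  rewrite Ms -mulmxA mulmxE -exprD addSnnS addnC exprD Nk mul0r mulmx0.
  exact: (bform0r mA).
have col u : exists a, u *m N ^+ k.+1 = a *: (v *m N ^+ k.+1).
  by apply: null_collinear.
exists k.+1, v; split => //.
set z := v *m N ^+ k.+1 in vN col *.
have zz : bform eta z z = 0 by exact: iso.
have lam x : exists a, z *m AD x = a *: z.
  by rewrite /z -mulmxA -Mc mulmxA; exact: col.
(* With [x, z] = a z, invariance gives 0 = <[x, z], x> = a <z, x>. *)
have zx0 x : z *m AD x != 0 -> bform eta z x = 0.
  have [a za] := lam x; rewrite za => az.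
  have := bform_AD_alt1 mA x z; rewrite za bformZl => /eqP.
  rewrite mulf_eq0 => /orP[/eqP a0|/eqP //].
  by move: az; rewrite a0 scale0r eqxx.
have zA x : z *m AD x = 0.
  (* As <f, z> = 1, f commutes with z. If x did not, neither would x + f, so both would be
     orthogonal to z, and then f as well. *)
  apply/eqP/negPn/negP => zx; have [f fz _] := null_dual mA vN zz.
  have zf : z *m AD f = 0.
    apply/eqP/negPn/negP => /zx0; rewrite (bformC mA) fz => /eqP.
    by rewrite oner_eq0.
  have : bform eta z (x + f) = 0.
    by apply: zx0; rewrite (linearD AD) mulmxDr zf addr0.
  by rewrite bformDr zx0 // add0r (bformC mA) fz => /eqP; rewrite oner_eq0.
by apply: eq_mulmx => u; rewrite mulmx0 (AD_anti mA) zA oppr0.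
Qed.

End LorentzianOperators.

Section ComplexEigenvalue.
Local Open Scope complex_scope.

(** x and y are the real and imaginary parts of an eigenvector over the complex numbers for the
    eigenvalue a + i b. *)
Lemma complex_eigenvector (R : rcfType) n (M : 'M[R]_n.+1) :
  exists (a b : R) (x y : 'rV[R]_n.+1),
    [/\ x *m M = a *: x - b *: y, y *m M = b *: x + a *: y & ~ (x = 0 /\ y = 0)].
Proof.
pose MC := map_mx (real_complex R) M.
have /closed_rootP[l rl] : size (char_poly MC) != 1%N by rewrite size_char_poly.
have : eigenvalue MC l by rewrite eigenvalue_root_char.
move=> /eigenvalueP[v vM v0].
pose x := map_mx (@complex.Re R) v; pose y := map_mx (@complex.Im R) v.
have vE i j : v i j = (x i j +i* y i j) by rewrite !mxE; case: (v i j).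
have ReS (I : finType) (f : I -> R[i]) : complex.Re (\sum_i f i) = \sum_i complex.Re (f i).
  by rewrite raddf_sum.
have ImS (I : finType) (f : I -> R[i]) : complex.Im (\sum_i f i) = \sum_i complex.Im (f i).
  by rewrite raddf_sum.
exists (complex.Re l), (complex.Im l), x, y; split.
- apply/rowP => j; move/rowP/(_ j)/(congr1 (@complex.Re R)): vM.
  rewrite !mxE ReS => H.
  transitivity (\sum_j0 complex.Re (v 0 j0 * MC j0 j)); last first.
    by rewrite H; case: l {rl H} => a b; case: (v 0 j) => p q /=.
  by apply: eq_bigr => k _; rewrite !mxE; case: (v 0 k) => p q /=; rewrite mulr0 subr0.
- apply/rowP => j; move/rowP/(_ j)/(congr1 (@complex.Im R)): vM.
  rewrite !mxE ImS => H.
  transitivity (\sum_j0 complex.Im (v 0 j0 * MC j0 j)); last first.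
    rewrite H; case: l {rl H} => a b; case: (v 0 j) => p q /=.
    by rewrite addrC.
  by apply: eq_bigr => k _; rewrite !mxE; case: (v 0 k) => p q /=; rewrite mulr0 add0r.
- move=> [x0 y0]; move/eqP: v0; apply; apply/matrixP => i j.
  by rewrite vE x0 y0 !mxE.
Qed.
End ComplexEigenvalue.

(** * Negativity of the Killing form in Lorentzian signature *)

Section LorentzianKilling.
Context {R : realType} (n : nat).
Local Notation V := 'rV[R]_n.+1.
Variables (eta : 'M[R]_n.+1) (AD : {linear V -> 'M[R]_n.+1}).
Hypothesis mA : metric_algebra eta AD.

Definition lorentzian_basis (P : 'M[R]_n.+1) := forall i j,
  bform eta (row i P) (row j P) = if i == j then sig_sign R 1 i else 0.

Variable P : 'M[R]_n.+1.
Hypothesis P_lorentz : lorentzian_basis P.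
Let J := P *m eta *m P^T.
Let e := row 0 P.

Let JE i j : J i j = if i == j then sig_sign R 1 i else 0.
Proof.
by rewrite -P_lorentz /bform -row_mul tr_row colE mulmxA -colE -row_mul !mxE.
Qed.

Let mulJ (A : 'M[R]_n.+1) i j : (A *m J) i j = A i j * sig_sign R 1 j.
Proof.
rewrite mxE (bigD1 j) //= JE eqxx big1 ?addr0 // => k kj.
by rewrite JE (negbTE kj) mulr0.
Qed.

Let Jmul (A : 'M[R]_n.+1) i j : (J *m A) i j = sig_sign R 1 i * A i j.
Proof.
rewrite mxE (bigD1 i) //= JE eqxx big1 ?addr0 // => k ki.
by rewrite JE eq_sym (negbTE ki) mul0r.
Qed.

Lemma lorentzian_basis_unit : P \in unitmx.
Proof.
have JJ : J *m J = 1%:M.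
  apply/matrixP => i j; rewrite mulJ JE !mxE; case: eqVneq => [->|]; last by rewrite mul0r.
  by rewrite /sig_sign; case: ifP => _; rewrite ?mulrNN mulr1.
have : P *m (eta *m P^T *m J) = 1%:M by rewrite (mulmxA P) (mulmxA P eta); exact: JJ.
by case/mulmx1_unit.
Qed.

Let Psig0 : sig_sign R 1 (0%R : 'I_n.+1) = -1. Proof. by []. Qed.
Let Psig (i : 'I_n.+1) : i != 0 -> sig_sign R 1 i = 1.
Proof. by rewrite -(inj_eq val_inj) /= /sig_sign; case: (val i). Qed.

Lemma lorentzian_basis_neg : bform eta e e = -1.
Proof. by rewrite P_lorentz eqxx. Qed.

Lemma lorentzian_basis_pos x : x != 0 -> bform eta x e = 0 -> 0 < bform eta x x.
Proof.
move=> x0; have [y xy] : exists y, x = y *m P.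
  by exists (x *m invmx P); rewrite mulmxKV // lorentzian_basis_unit.
have bE u v : bform eta (u *m P) (v *m P) = \sum_(i < n.+1) sig_sign R 1 i * u 0 i * v 0 i.
  rewrite /bform trmx_mul; have -> : u *m P *m eta *m (P^T *m v^T) = u *m (J *m v^T).
    by rewrite /J !mulmxA.
  rewrite mxE; apply: eq_bigr => i _; rewrite mxE (bigD1 i) //= JE eqxx.
  by rewrite big1 ?addr0 ?mxE => [|k ki]; rewrite ?JE 1?eq_sym ?(negbTE ki) ?mul0r //; ring.
have eP : e = delta_mx 0 0 *m P by rewrite -rowE.
rewrite {1}xy eP bE (bigD1 0) //= big1 ?addr0 => [|k k0]; last first.
  by rewrite mxE (negbTE k0) andbF mulr0.
rewrite mxE eqxx Psig0 mulr1 mulN1r => /eqP; rewrite oppr_eq0 => /eqP y00.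
rewrite xy bE lt_def; apply/andP; split; last first.
  apply: sumr_ge0 => i _; have [->|i0] := eqVneq i 0; first by rewrite y00 mulr0.
  by rewrite Psig // mul1r -expr2 sqr_ge0.
apply: contra x0; rewrite psumr_eq0 => [/allP H|i _]; last first.
  have [->|i0] := eqVneq i 0; first by rewrite y00 mulr0.
  by rewrite Psig // mul1r -expr2 sqr_ge0.
suff -> : x = 0 by [].
suff y0 : y = 0 by rewrite xy y0 mul0mx.
apply/rowP => i; rewrite [RHS]mxE; have [->|i0] := eqVneq i 0; first exact: y00.
have := H i (mem_index_enum i); rewrite /= Psig // mul1r mulf_eq0 orbb.
by move/eqP.
Qed.

(* Tr (ad x)^2 is minus the squared norm of the reduced operator of x, which acts on
   the Euclidean space orthogonal to z and e. *)
Lemma killing_null_radical z x : z != 0 -> central AD z -> bform eta z z = 0 ->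
  \tr (AD x *m AD x) = 0 -> forall y, \tr (AD x *m AD y) = 0.
Proof.
move=> z0 cz zz.
have ez : bform eta e z != 0.
  apply/eqP => ez; have := lorentzian_basis_pos z0.
  by rewrite (bformC mA) ez zz ltxx => /(_ erefl).
have [f [fz ff eQ]] : exists f, [/\ bform eta f z = 1, bform eta f f = 0 &
    e *m null_proj eta z f = 0].
  pose al := (bform eta e z)^-1.
  have al0 : al != 0 by rewrite invr_eq0.
  have ale : al * bform eta e z = 1 by rewrite mulVf.
  (* f is taken in the plane of e and z, so that the projection kills e; the coefficient of z makes
     f null because <e, e> = -1. *)
  exists (al *: e + (al ^+ 2 / 2) *: z).
  have fz : bform eta (al *: e + (al ^+ 2 / 2) *: z) z = 1.
    by rewrite bformDl !bformZl zz mulr0 addr0.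
  have ff : bform eta (al *: e + (al ^+ 2 / 2) *: z) (al *: e + (al ^+ 2 / 2) *: z) = 0.
    rewrite bformDr !bformZr fz mulr1 (bformC mA) bformDr !bformZr.
    rewrite lorentzian_basis_neg.
    have -> : al * (al * -1 + al ^+ 2 / 2 * bform eta e z) =
        - al ^+ 2 + al ^+ 2 / 2 * (al * bform eta e z) by ring.
    by rewrite ale; field.
  split => //; move: fz ff; set f := al *: e + _ => fz ff.
  have -> : e = al^-1 *: (f - (al ^+ 2 / 2) *: z).
    by rewrite /f addrK scalerA mulVf // scale1r.
  have fQ : f *m null_proj eta z f = 0.
    by rewrite mul_null_proj fz ff scale0r subr0 scale1r subrr.
  have zQ : z *m null_proj eta z f = 0.
    by rewrite mul_null_proj zz (bformC mA) fz scale0r subr0 scale1r subrr.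
  by rewrite -scalemxAl mulmxDl mulNmx -scalemxAl fQ zQ scaler0 subrr scaler0.
rewrite (trace_reduced mA x x cz zz fz ff) => trD y.
rewrite (trace_reduced mA x y cz zz fz ff).
suff -> : reduced_ad eta AD z f x = 0 by rewrite mul0mx mxtrace0.
move: trD; set D := reduced_ad eta AD z f x => trD.
have Qs : null_proj eta z f *m eta = eta *m (null_proj eta z f)^T.
  have trB (A B : 'M[R]_n.+1) : (A - B)^T = A^T - B^T.
    by apply/matrixP => i j; rewrite !mxE.
  rewrite /null_proj !trB trmx1 !trmx_mul !trmxK (eta_sym mA).
  rewrite !mulmxBl !mulmxBr mul1mx mulmx1 !mulmxA.
  by rewrite addrAC.
have Ds : D *m eta = - (eta *m D^T).
  rewrite /D /reduced_ad !trmx_mul -!mulmxA Qs !mulmxA.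
  rewrite -(mulmxA (null_proj eta z f) (AD x)).
  have -> : AD x *m eta = - (eta *m (AD x)^T).
    by apply/eqP; rewrite -addr_eq0 (AD_skew mA).
  by rewrite mulmxN mulNmx mulmxA Qs.
have eD : e *m D = 0 by rewrite /D /reduced_ad !mulmxA eQ !mul0mx.
clearbody D; have Pu := lorentzian_basis_unit.
(* In the basis P the operator is skew for J and its row 0 vanishes, hence also its column 0. It is
   then antisymmetric in the ordinary sense, and - Tr D'^2 is the sum of the squares of its
   entries. *)
pose D' := P *m D *m invmx P.
have D's : D' *m J = - (J *m D'^T).
  have PTi : P^T *m (invmx P)^T = 1%:M by rewrite -trmx_mul mulVmx // trmx1.
  rewrite /D' /J !trmx_mul !mulmxA mulmxKV //.
  rewrite -(mulmxA _ P^T) PTi mulmx1 -(mulmxA P D) Ds mulmxN mulNmx.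
  by rewrite !mulmxA.
have D'0 j : D' 0 j = 0.
  have -> : D' 0 j = row 0 D' 0 j by rewrite [RHS]mxE.
  by rewrite /D' !row_mul -/e eD mul0mx mxE.
have D'a i j : D' i j = - D' j i.
  have H k l : D' k l * sig_sign R 1 l = - (sig_sign R 1 k * D' l k).
    by rewrite -mulJ D's mxE Jmul [in LHS]mxE.
  have [->|i0] := eqVneq i 0.
    have := H j 0; rewrite Psig0 !D'0 mulr0 oppr0 mulrN1 => /eqP.
    by rewrite oppr_eq0 => /eqP ->; rewrite ?D'0 ?oppr0.
  have [->|j0] := eqVneq j 0.
    have := H i 0; rewrite Psig0 !D'0 mulr0 oppr0 mulrN1 => /eqP.
    by rewrite oppr_eq0 => /eqP ->; rewrite ?D'0 ?oppr0.
  by have := H i j; rewrite !Psig // mulr1 mul1r.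
have trD' : \sum_i \sum_j D' i j ^+ 2 = 0.
  have <- : - \tr (D' *m D') = \sum_i \sum_j D' i j ^+ 2.
    rewrite -sumrN; apply: eq_bigr => i _; rewrite mxE -sumrN; apply: eq_bigr => j _.
    by rewrite (D'a j i) mulrN opprK.
  have -> : D' *m D' = P *m (D *m D) *m invmx P by rewrite /D' !mulmxA mulmxKV.
  by rewrite mxtrace_mulC (mulmxA (invmx P) P) mulVmx // mul1mx trD oppr0.
have D'z : D' = 0.
  apply/matrixP => i j; rewrite [RHS]mxE.
  have H1 : \sum_j D' i j ^+ 2 = 0.
    by apply: (psumr_eq0P _ trD') => // k _; apply: sumr_ge0 => l _; exact: sqr_ge0.
  have : D' i j ^+ 2 = 0.
    by apply: (psumr_eq0P _ H1) => // k _; exact: sqr_ge0.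
  by move/eqP; rewrite sqrf_eq0 => /eqP.
have -> : D = invmx P *m D' *m P by rewrite /D' !mulmxA mulVmx // mul1mx mulmxKV.
by rewrite D'z mulmx0 mul0mx.
Qed.

End LorentzianKilling.

Lemma killing_condition_lorentzian (R : realType) (g : metricLieAlgebra R) n
    (eta : 'M[R]_n) (AD : {linear 'rV[R]_n -> 'M[R]_n}) iota coord :
  indecomposable g -> lorentzian g ->
  @coordinates R g n eta AD iota coord -> killing_condition eta AD.
Proof.
move=> ig [d [b [bb bform_b]]] co; have mA := coordinates_metric_algebra co.
have [n2|n2] := leqP n 2.
  by left; exists 0 => x y; rewrite (AD_low_dim mA x n2) mul0mx mxtrace0 mul0r.
have nd : n = d.+1 by rewrite (coordinates_dim co) (size_basis bb).
subst n.
pose P : 'M[R]_d.+1 := \matrix_(i < d.+1) coord b`_i.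
have PL : lorentzian_basis eta P.
  by move=> i j; rewrite !rowK (iota_form co) !(coordK co); exact: bform_b.
pose e := row 0 P.
have e_neg : bform eta e e < 0.
  by rewrite (lorentzian_basis_neg PL) oppr_lt0 ltr01.
have e_pos := lorentzian_basis_pos PL.
have [K KE iK] := killing_operator mA.
have centralK z : central AD z -> z *m K = 0.
  move=> cz; apply: (bform_nondeg mA) => y.
  by rewrite KE cz mul0mx mxtrace0.
have [l [x x0 xK]] : exists l, exists2 x : 'rV[R]_d.+1, x != 0 & x *m K = l *: x.
  have [a [b' [x [y [xK yK xy0]]]]] := complex_eigenvector K.
  have [bz|b0] := eqVneq b' 0.
    have [xz|xn] := eqVneq x 0; last first.
      by exists a, x; rewrite // xK bz scale0r subr0.
    have [yz|yn] := eqVneq y 0; first by case: xy0.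
    by exists a, y; rewrite // yK bz scale0r add0r.
  pose A := K - a%:M.
  have iA : invariant_op eta AD A by exact: invariant_sub_scalar.
  have xA : x *m A = - b' *: y.
    by rewrite /A mulmxBr mul_mx_scalar xK addrAC subrr add0r scaleNr.
  have yA : y *m A = b' *: x by rewrite /A mulmxBr mul_mx_scalar yK addrK.
  (* N kills x and y. If it is nonzero, it is nilpotent and provides a nonzero central vector, which
     K sends to 0: a real eigenvalue after all. *)
  pose N := A *m A - (- b' ^+ 2)%:M.
  have iN : invariant_op eta AD N.
    by apply: invariant_sub_scalar => //; apply: invariant_mul.
  have [w w0 wN] : exists2 w : 'rV[R]_d.+1, w != 0 & w *m N = 0.
    have [xz|xn] := eqVneq x 0; last first.
      exists x => //; rewrite /N mulmxBr mul_mx_scalar mulmxA xA -scalemxAl yA.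
      by rewrite scalerA mulNr -expr2 subrr.
    have [yz|yn] := eqVneq y 0; first by case: xy0.
    exists y => //; rewrite /N mulmxBr mul_mx_scalar mulmxA yA -scalemxAl xA.
    by rewrite scalerA mulrN -expr2 subrr.
  have [N0|N0] := eqVneq N 0; last first.
    have [k [v [_ z0 _ cz _]]] := nilpotent_central co e_pos iN N0
      (invariant_nilpotent co ig iN w0 wN).
    by exists 0, (v *m N ^+ k); rewrite // centralK // scale0r.
  (* In dimension at least 3 some nonzero v is orthogonal to e and to e A. Then v and v A both lie
     in the positive definite orthogonal of e, against <v A, v A> = - b'^2 <v, v>. *)
  pose Q : 'M[R]_(2, d.+1) := \matrix_(i < 2) [:: e; e *m A]`_i.
  have [v v0 vQ] := orthogonal_exists eta Q n2.
  have ve : bform eta v e = 0 by have := vQ 0; rewrite rowK.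
  have vAe : bform eta (v *m A) e = 0 by rewrite iA.2; have := vQ 1; rewrite rowK.
  have vAA : v *m A *m A = - b' ^+ 2 *: v.
    by move/eqP: N0; rewrite subr_eq0 -mulmxA => /eqP ->; rewrite mul_mx_scalar.
  have vv := e_pos v v0 ve.
  have vAv : bform eta (v *m A) (v *m A) = - b' ^+ 2 * bform eta v v.
    by rewrite iA.2 vAA bformZr.
  have bb0 : 0 < b' ^+ 2 by rewrite lt_def sqr_ge0 sqrf_eq0 b0.
  have [vA0|vA0] := eqVneq (v *m A) 0.
    move: vAv; rewrite vA0 bform0l => /esym/eqP; rewrite mulf_eq0 oppr_eq0.
    by rewrite (gt_eqF bb0) (gt_eqF vv).
  have := e_pos _ vA0 vAe; rewrite vAv mulNr oppr_gt0 => H.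
  by have := mulr_gt0 bb0 vv; rewrite ltNge (ltW H).
pose N := K - l%:M.
have iN : invariant_op eta AD N by exact: invariant_sub_scalar.
have xN : x *m N = 0 by rewrite /N mulmxBr mul_mx_scalar xK subrr.
have [N0|N0] := eqVneq N 0.
  left; exists l => u v; rewrite -KE; move/eqP: N0; rewrite subr_eq0 => /eqP ->.
  by rewrite mul_mx_scalar bformZl.
have [k [v [[k0 Nk] z0 zz cz col]]] := nilpotent_central co e_pos iN N0
  (invariant_nilpotent co ig iN x0 xN).
(* The vector v N^k is killed by N as k is the top power, and by K as it is central. *)
have l0 : l = 0.
  have zN : v *m N ^+ k *m N = - l *: (v *m N ^+ k).
    by rewrite {2}/N mulmxBr mul_mx_scalar centralK // sub0r scaleNr.
  move/eqP: zN; rewrite -mulmxA mulmxE -exprSr Nk mulmx0 eq_sym.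
  by rewrite scaler_eq0 (negbTE z0) orbF oppr_eq0 => /eqP.
have NK : N = K by rewrite /N l0 raddf0 subr0.
rewrite NK in iN Nk z0 zz cz col.
(* If k >= 2, put u = v K^(k-1). Then Tr (ad u)^2 = <u K, u> = <v, v K^(2k-1)> = 0 since 2k - 1 > k,
   so u is in the radical of the Killing form, that is, u K = 0; but u K = v K^k is nonzero. *)
have k1 : k = 1%N.
  case: k k0 Nk z0 zz cz col => // -[//|k] _ Nk z0 zz cz col.
  have [_ Ms] := invariant_exp k.+2 iN.
  have Bx : \tr (AD (v *m K ^+ k.+1) *m AD (v *m K ^+ k.+1)) = 0.
    rewrite -KE -mulmxA mulmxE -exprSr Ms -mulmxA mulmxE -exprD.
    by rewrite addSnnS addnC exprD Nk mul0r mulmx0 (bform0r mA).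
  have Bxy := killing_null_radical mA PL z0 cz zz Bx.
  move/eqP: z0; case; apply: (bform_nondeg mA) => y.
  by rewrite exprSr -mulmxE mulmxA KE Bxy.
rewrite k1 expr1 in z0 zz cz col.
set z := v *m K in z0 zz cz col.
have [f fz ff] := null_dual mA z0 zz.
(* If x1 K = a z, self-adjointness gives a = <x1 K, f> = <x1, f K> = c <x1, z>. *)
have [c fK] := col f.
right; exists z, c; split => // x1 x2; rewrite -KE.
have [a aK] := col x1.
have : bform eta (x1 *m K) f = bform eta x1 (f *m K) by rewrite iN.2.
rewrite aK fK bformZl bformZr (bformC mA z f) fz mulr1 => ->.
by rewrite bformZl (bformC mA z).
Qed.

Local Close Scope ring_scope.
Local Close Scope classical_set_scope.

Theorem theorem1p5 (R : realType) :
  (forall (t s : nat) (Phi : 'M[R]_(t + s)) (Phi_so : in_so Phi),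
     conformally_einstein (osc Phi_so))
  /\ (forall g : metricLieAlgebra R,
        indecomposable g -> lorentzian g -> conformally_einstein g)
  /\ (forall g : metricLieAlgebra R,
        indecomposable g -> \dim (fullv : {vspace g}) = 4%N ->
        conformally_einstein g).
Proof.
split=> [t s Phi Phi_so|]; last split=> g ig hg.
- apply: conformally_einstein_of_killing => n eta AD iota coord.
  exact: killing_condition_osc.
- apply: conformally_einstein_of_killing => n eta AD iota coord.
  exact: killing_condition_lorentzian.
- apply: conformally_einstein_of_killing => n eta AD iota coord.
  exact: killing_condition_dim4.
Qed.
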